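(* Let $f$ be semiregular on $B = B(0,R)$ and suppose $f \not \equiv 0$. For all $x,y\in\mathbb{R}$ with $x+y\mathbb{S} \subseteq B$, there exist $m \in \mathbb{Z}$, $n \in \mathbb{N}$, and $p_1,\dots,p_n \in x+y\mathbb{S}$ with $p_i \neq \bar p_{i+1}$ for all $i$ (that is, $1\le i\le n-1$) such that $$f(q) = [(q-x)^2+y^2]^m (q-p_1)*(q-p_2)*\cdots*(q-p_n)*g(q)$$ for some semiregular function $g$ on $B$ which does not have poles nor zeros in $x+y\mathbb{S}$.
   Context: $\mathbb{H}$ is the skew field of real quaternions, $\mathbb{S} = \{q \in \mathbb{H} : q^2=-1\}$, $x+y\mathbb{S}=\{x+yI:I\in\mathbb{S}\}$ (a single real point if $y=0$), $L_I = \mathbb{R} + I\mathbb{R}$ for $I\in\mathbb{S}$, $B(0,R)=\{q\in\mathbb{H}:|q|<R\}$ with $0<R\le\infty$, $\mathbb{N}\ni 0$. For a domain $\Omega\subseteq\mathbb{H}$ set $\Omega_I=\Omega\cap L_I$ and, for $f:\Omega\to\mathbb{H}$, $f_I=f|_{\Omega_I}$. A real differentiable $f:\Omega\to\mathbb{H}$ is regular if for every $I\in\mathbb{S}$ the function $\frac12\left(\frac{\partial}{\partial x}+I\frac{\partial}{\partial y}\right)f_I(x+Iy)$ vanishes identically on $\Omega_I$. Regular functions on $B(0,R)$ are exactly the sums of power series $\sum_{n\ge0}q^na_n$, $a_n\in\mathbb{H}$, converging in $B(0,R)$. Poles: if a regular $f$ is defined on an annulus $\{z\in L_I: R_1<|z-p|<R_2\}$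 in a complex line $L_I$ through $p$ (for an isolated singularity in $L_I$, $R_1=0$), write $f_I(z)=\sum_{n\in\mathbb{Z}}(z-p)^na_n$ there, $a_n\in\mathbb{H}$ (for real $p$ the $a_n$ do not depend on $I$). The point $p$ is a pole if there is $n\in\mathbb{N}$ with $a_{-m}=0$ for all $m>n$; the minimum such $n$ is its order. Otherwise $p$ is an essential singularity. That $g$ has no poles in a set means it has no poles of positive order there. Semiregular: let $\mathcal{S}\subseteq\Omega$ be such that $\mathcal{S}\cap L_I$ is a discrete subset of $\Omega_I$ for all $I\in\mathbb{S}$; a regular function $f:\Omega\setminus\mathcal{S}\to\mathbb{H}$ is semiregular on $\Omega$ if $\mathcal{S}$ contains no essential singularities for $f$; removable singularities are removed by extending the function. Regular operations: for $f=\sum q^na_n$, $g=\sum q^nb_n$ regular on a ball, $f*g(q)=\sum_n q^n\sum_{k=0}^na_kb_{n-k}$, $f^c(q)=\sum_n q^n\bar a_n$, $f^s=f*f^c=f^c*f$, $f^{-s}(q)=1/f^s(q)$. For $f\not\equiv0$, the left regular quotient is $f^{-*}*g(q)=\frac{1}{f^s(q)}\,f^c*g(q)$, defined off the zeros of $f^s$. Left regular quotients on a ball are multiplied by $(f^{-*}*g)*(h^{-*}*k)=f^{-s}h^{-s}f^c*g*h^c*k$. A semiregular function on $B(0,R_0)$ restricts to a left regular quotient of regular functions on every $B(0,R)$ with $0<R<R_0$; the product $f*g$ of semiregular functions on $B(0,R_0)$ is the semiregular function whose restriction to each such $B(0,R)$ is the product of the restrictions. The factor $[(q-x)^2+y^2]^m$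 multiplies pointwise. Equality of semiregular functions means equality at the points where both sides are defined. *)

(* Defs.v *)
From HB Require Import structures.
From mathcomp Require Import all_boot all_order all_algebra.
From mathcomp Require Import ring.
From mathcomp Require Import all_classical all_reals all_analysis.

Set Implicit Arguments.
Unset Strict Implicit.
Unset Printing Implicit Defensive.

Import Order.TTheory GRing.Theory Num.Theory.
Import numFieldNormedType.Exports.

Local Open Scope classical_set_scope.
Local Open Scope ring_scope.

Record quat (R : realType) := Quat { q0 : R; q1 : R; q2 : R; q3 : R }.

Section QuaternionAlgebra.
Variable R : realType.
Implicit Types p q r : quat R.

Definition quat_tuple q := (q0 q, q1 q, q2 q, q3 q).
Definition tuple_quat (t : R * R * R * R) :=
  let: (a, b, c, d) := t in Quat a b c d.

Lemma quat_tupleK : cancel quat_tuple tuple_quat. Proof. by case. Qed.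

HB.instance Definition _ := Choice.copy (quat R) (can_type quat_tupleK).

Lemma quatP p q :
  q0 p = q0 q -> q1 p = q1 q -> q2 p = q2 q -> q3 p = q3 q -> p = q.
Proof. by case: p; case: q => /= ? ? ? ? ? ? ? ? -> -> -> ->. Qed.

Definition qzero : quat R := Quat 0 0 0 0.
Definition qone : quat R := Quat 1 0 0 0.
Definition qopp p : quat R := Quat (- q0 p) (- q1 p) (- q2 p) (- q3 p).
Definition qadd p q : quat R :=
  Quat (q0 p + q0 q) (q1 p + q1 q) (q2 p + q2 q) (q3 p + q3 q).
Definition qscale (k : R) p : quat R :=
  Quat (k * q0 p) (k * q1 p) (k * q2 p) (k * q3 p).
Definition qmul p q : quat R :=
  Quat (q0 p * q0 q - q1 p * q1 q - q2 p * q2 q - q3 p * q3 q)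
       (q0 p * q1 q + q1 p * q0 q + q2 p * q3 q - q3 p * q2 q)
       (q0 p * q2 q - q1 p * q3 q + q2 p * q0 q + q3 p * q1 q)
       (q0 p * q3 q + q1 p * q2 q - q2 p * q1 q + q3 p * q0 q).
Definition qconj p : quat R := Quat (q0 p) (- q1 p) (- q2 p) (- q3 p).
Definition qsqnorm p : R := q0 p ^+ 2 + q1 p ^+ 2 + q2 p ^+ 2 + q3 p ^+ 2.
Definition qnorm p : R := Num.sqrt (qsqnorm p).
(* The inverse of 0 is 0, since 0^-1 = 0 in R. *)
Definition qinv p : quat R := qscale (qsqnorm p)^-1 (qconj p).

Lemma qaddA : associative qadd.
Proof. by move=> p q r; apply: quatP => /=; ring. Qed.
Lemma qaddC : commutative qadd.
Proof. by move=> p q; apply: quatP => /=; ring. Qed.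
Lemma qadd0 : left_id qzero qadd.
Proof. by move=> p; apply: quatP => /=; ring. Qed.
Lemma qaddN : left_inverse qzero qopp qadd.
Proof. by move=> p; apply: quatP => /=; ring. Qed.

HB.instance Definition _ :=
  GRing.isZmodule.Build (quat R) qaddA qaddC qadd0 qaddN.

Lemma qmulA : associative qmul.
Proof. by move=> p q r; apply: quatP => /=; ring. Qed.
Lemma qmul1l : left_id qone qmul.
Proof. by move=> p; apply: quatP => /=; ring. Qed.
Lemma qmul1r : right_id qone qmul.
Proof. by move=> p; apply: quatP => /=; ring. Qed.
Lemma qmulDl : left_distributive qmul +%R.
Proof. by move=> p q r; apply: quatP => /=; ring. Qed.
Lemma qmulDr : right_distributive qmul +%R.
Proof. by move=> p q r; apply: quatP => /=; ring. Qed.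
Lemma qone_neq0 : qone != 0.
Proof. by apply/eqP => -[/eqP]; rewrite oner_eq0. Qed.

HB.instance Definition _ := GRing.Zmodule_isNzRing.Build (quat R)
  qmulA qmul1l qmul1r qmulDl qmulDr qone_neq0.

Lemma qscaleA (a b : R) p : qscale a (qscale b p) = qscale (a * b) p.
Proof. by apply: quatP => /=; ring. Qed.
Lemma qscale1 : left_id 1 qscale.
Proof. by move=> p; apply: quatP => /=; ring. Qed.
Lemma qscaleDr : right_distributive qscale +%R.
Proof. by move=> a p q; apply: quatP => /=; ring. Qed.
Lemma qscaleDl p : {morph qscale^~ p : a b / a + b}.
Proof. by move=> a b; apply: quatP => /=; ring. Qed.

HB.instance Definition _ := GRing.Zmodule_isLmodule.Build R (quat R)
  qscaleA qscale1 qscaleDr qscaleDl.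

Lemma qscaleAl (a : R) p q : a *: (p * q) = (a *: p) * q.
Proof. by apply: quatP => /=; ring. Qed.

HB.instance Definition _ := GRing.Lmodule_isLalgebra.Build R (quat R) qscaleAl.

Lemma qscaleAr (a : R) p q : a *: (p * q) = p * (a *: q).
Proof. by apply: quatP => /=; ring. Qed.

HB.instance Definition _ := GRing.Lalgebra_isAlgebra.Build R (quat R) qscaleAr.

Lemma qsqnorm_ge0 p : 0 <= qsqnorm p.
Proof. by rewrite !addr_ge0 ?sqr_ge0. Qed.

Lemma qsqnorm_eq0 p : qsqnorm p = 0 -> p = 0.
Proof.
move=> /eqP; rewrite /qsqnorm !paddr_eq0 ?addr_ge0 ?sqr_ge0//.
rewrite !sqrf_eq0 => /andP[/andP[/andP[/eqP h0 /eqP h1] /eqP h2] /eqP h3].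
exact: quatP.
Qed.

Lemma qsqnorm_neq0 p : p != 0 -> qsqnorm p != 0.
Proof. by apply: contra => /eqP /qsqnorm_eq0 ->. Qed.

Lemma qmulV : {in [pred p : quat R | p != 0], left_inverse 1 qinv *%R}.
Proof.
move=> p /= /qsqnorm_neq0 N; apply: quatP => /=; rewrite /qsqnorm in N *;
  by field.
Qed.
Lemma qmulrV : {in [pred p : quat R | p != 0], right_inverse 1 qinv *%R}.
Proof.
move=> p /= /qsqnorm_neq0 N; apply: quatP => /=; rewrite /qsqnorm in N *;
  by field.
Qed.
Lemma qunitP p q : q * p = 1 /\ p * q = 1 -> [pred p : quat R | p != 0] p.
Proof.
move=> [h _] /=; apply/eqP => p0; move: h; rewrite p0 mulr0 => /esym/eqP.
by rewrite oner_eq0.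
Qed.
Lemma qinv_out : {in [predC [pred p : quat R | p != 0]], qinv =1 id}.
Proof.
by move=> p; rewrite !inE negbK => /eqP ->; apply: quatP => /=; ring.
Qed.

HB.instance Definition _ := GRing.NzRing_hasMulInverse.Build (quat R)
  qmulV qmulrV qunitP qinv_out.

Lemma qnormD p q : qnorm (p + q) <= qnorm p + qnorm q.
Proof.
rewrite -(ler_pXn2r (n := 2)) ?nnegrE ?addr_ge0 ?sqrtr_ge0//.
rewrite sqrrD !sqr_sqrtr ?qsqnorm_ge0//.
set s := q0 p * q0 q + q1 p * q1 q + q2 p * q2 q + q3 p * q3 q.
have -> : qsqnorm (p + q) = qsqnorm p + s *+ 2 + qsqnorm q.
  by rewrite /qsqnorm /s /=; ring.
rewrite lerD2r lerD2l lerMn2r /= (le_trans (ler_norm s))//.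
rewrite -(ler_pXn2r (n := 2)) ?nnegrE ?mulr_ge0 ?sqrtr_ge0//.
rewrite real_normK ?num_real// exprMn !sqr_sqrtr ?qsqnorm_ge0// -subr_ge0.
suff -> : qsqnorm p * qsqnorm q - s ^+ 2 =
    (q0 p * q1 q - q1 p * q0 q) ^+ 2 + (q0 p * q2 q - q2 p * q0 q) ^+ 2 +
    (q0 p * q3 q - q3 p * q0 q) ^+ 2 + (q1 p * q2 q - q2 p * q1 q) ^+ 2 +
    (q1 p * q3 q - q3 p * q1 q) ^+ 2 + (q2 p * q3 q - q3 p * q2 q) ^+ 2.
  by rewrite !addr_ge0 ?sqr_ge0.
by rewrite /qsqnorm /s; ring.
Qed.

Lemma qnormZ (a : R) p : qnorm (a *: p) = `|a| * qnorm p.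
Proof.
rewrite /qnorm; have -> : qsqnorm (a *: p) = a ^+ 2 * qsqnorm p.
  by rewrite /qsqnorm /=; ring.
by rewrite sqrtrM ?sqr_ge0// sqrtr_sqr.
Qed.

Lemma qnorm0_eq0 p : qnorm p = 0 -> p = 0.
Proof.
move=> /eqP; rewrite sqrtr_eq0 => h; apply: qsqnorm_eq0.
by apply/eqP; rewrite eq_le h qsqnorm_ge0.
Qed.

HB.instance Definition _ :=
  Lmodule_isNormed.Build R (quat R) qnormD qnormZ qnorm0_eq0.

End QuaternionAlgebra.

Section Semiregular.
Variable R : realType.
Local Notation H := (quat R).
Implicit Types (f g h : H -> H) (I p q z : H) (D S Omega U : set H).

Definition imaginary_units : set H := [set I | I ^+ 2 = -1].

Definition slice_point I (x y : R) : H := x%:A + y *: I.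

Definition slice I : set H := [set z | exists x y, z = slice_point I x y].

Definition sphere (x y : R) : set H :=
  [set slice_point I x y | I in imaginary_units].

(* B(0, rho), where rho = +oo is allowed. *)
Definition qball (rho : \bar R) : set H := [set q | (`|q|%:E < rho)%E].

(* A function on D is given by a total f whose values outside D are
   irrelevant; D is always open where this is used. *)
Definition dbar I f (x y : R) : H :=
  2^-1 *: (derive1 (fun s => f (slice_point I s y)) x
           + I * derive1 (fun t => f (slice_point I x t)) y).

Definition regular_on D f : Prop :=
  (forall q, D q -> differentiable f q) /\
  (forall I, imaginary_units I ->
   forall x y, D (slice_point I x y) -> dbar I f x y = 0).

Definition laurent_term p (a : int -> H) z (n : int) : H := (z - p) ^ n * a n.

(* The values at [Posz n] are the terms of index n >= 0 and those at [Negz n]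
   the terms of index -(n+1) < 0. *)
Definition laurent_sum p (a : int -> H) z (w : H) : Prop :=
  exists s t : H,
  [/\ series (laurent_term p a z \o Posz) n @[n --> \oo] --> s,
      series (laurent_term p a z \o Negz) n @[n --> \oo] --> t &
      w = s + t].

(* If p is not real there is only one line L_I through p (for two opposite I);
   if p is real, all lines L_I go through p and share the same coefficients. *)
Definition laurent_at D f p (a : int -> H) : Prop :=
  forall I, imaginary_units I -> slice I p ->
  exists2 r : R, 0 < r & forall z, slice I z -> 0 < `|z - p| < r ->
    D z /\ laurent_sum p a z (f z).

Definition principal_part_le (a : int -> H) (n : nat) : Prop :=
  forall m : nat, (n < m)%N -> a (- m%:Z) = 0.

Definition pole D f p : Prop :=
  exists2 a, laurent_at D f p a & exists n, principal_part_le a n.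

Definition pole_order D f p (n : nat) : Prop :=
  exists2 a, laurent_at D f p a &
    principal_part_le a n /\ forall k, principal_part_le a k -> (n <= k)%N.

Definition essential_singularity D f p : Prop := ~ pole D f p.

Definition removable_singularity D f p : Prop :=
  exists U h, [/\ open_nbhs p U, regular_on U h &
                  forall q, U q -> D q -> h q = f q].

(* f is regular on Omega `\` S. The last clause is the convention that
   removable singularities have been removed by extending f. *)
Definition semiregular Omega S f : Prop :=
  [/\ S `<=` Omega /\ open (Omega `\` S),
      forall I, imaginary_units I -> S `&` slice I `<=` isolated (S `&` slice I),
      regular_on (Omega `\` S) f,
      forall p, S p -> ~ essential_singularity (Omega `\` S) f p &
      forall p, S p -> ~ removable_singularity (Omega `\` S) f p].

(* A regular function on a ball centred at 0 is given by the sequence of the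
   coefficients of its power series. *)
Implicit Types a b c d : nat -> H.

Definition power_series_term a q (n : nat) : H := q ^+ n * a n.

Definition power_sum a q : H := limn (series (power_series_term a q)).

Definition power_series_on (r : R) a : Prop :=
  forall q, `|q| < r -> cvgn (series (power_series_term a q)).

Definition star a b (n : nat) : H := \sum_(k < n.+1) a k * b (n - k)%N.

Definition star_one (n : nat) : H := if n is 0%N then 1 else 0.

(* coefficients of q - p *)
Definition linear_coef p (n : nat) : H :=
  match n with 0%N => - p | 1%N => 1 | _ => 0 end.

Definition reg_conj a (n : nat) : H := qconj (a n).

Definition symmetrization a : nat -> H := star a (reg_conj a).

(* The function u on B(0, r) `\` S is the left regular quotient of the power
   series b by the power series a. *)
Definition left_quotient_on (r : R) S (u : H -> H) a b : Prop :=
  [/\ power_series_on r a, power_series_on r b, exists n, a n <> 0 &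
      forall q, `|q| < r -> ~ S q -> power_sum (symmetrization a) q <> 0 ->
        u q = (power_sum (symmetrization a) q)^-1
              * power_sum (star (reg_conj a) b) q].

(* The product of the quotients a^{-*} * b and c^{-*} * d is
   a^{-s} c^{-s} (a^c * b * c^c * d) ; (h, Sh) is (f, Sf) * (g, Sg). *)
Definition semiregular_product (rho : \bar R) Sf f Sg g Sh h : Prop :=
  semiregular (qball rho) Sh h /\
  forall r : R, 0 < r -> (r%:E < rho)%E ->
  exists a b c d,
  [/\ left_quotient_on r Sf f a b, left_quotient_on r Sg g c d &
      forall q, `|q| < r -> ~ Sh q ->
        power_sum (symmetrization a) q <> 0 ->
        power_sum (symmetrization c) q <> 0 ->
        h q = (power_sum (symmetrization a) q)^-1
              * (power_sum (symmetrization c) q)^-1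
              * power_sum (star (star (star (reg_conj a) b) (reg_conj c)) d) q].

End Semiregular.

(* Main.v *)
From HB Require Import structures.
Require Import Defs.
From mathcomp Require Import all_boot all_order all_algebra.
From mathcomp Require Import ring lra.
From mathcomp Require Import all_classical all_reals all_analysis.

Set Implicit Arguments.
Unset Strict Implicit.
Unset Printing Implicit Defensive.

Import Order.TTheory GRing.Theory Num.Theory.
Import numFieldNormedType.Exports.

Local Open Scope classical_set_scope.
Local Open Scope ring_scope.

(** The theorem is a statement about numerators.  On each ball of radius [r] smaller than
    that of [B], a semiregular function [f] is a quotient of a power series [A r] by a
    product [den (L r)] of real quadratic polynomials [delta x y = (q - x)^2 + y^2]
    ([semiregular_quotient]).  To see this, fix a slice.  It has finitely many singularities
    in a closed disc, all of them poles; multiplying by the corresponding quadratic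
    polynomials removes them, and the resulting function satisfies the Cauchy--Riemann
    equation in the slice, hence is the sum of a power series ([cauchy_slice], from Goursat's
    lemma).  Denominators and series found in different slices are proportional, because the
    slices share the real axis.

    The numerator is factored along the sphere ([factor_sphere]): first the largest possible
    power [delta ^ k] is extracted, then as many linear factors [q - p_i] with [p_i] on the
    sphere as possible.  The remaining series [G] has no zero on the sphere, since a zero
    would give a further linear factor; if the next factor is the conjugate of the last one,
    both combine into a further factor [delta].  That the process stops is a form of Jensen's
    inequality ([multiplicity_bound]).  If the denominator contains [delta] to the power [l],
    then [m = k - l].

    The function [g] is P^c * f divided by a power of [delta], where [P] is the star product of
    the linear factors: indeed P^c * P = delta^n.  It has to be a semiregular function on all of
    [B], so it is given by its numerators and denominators on all smaller balls, which are
    glued together ([glue_quotients]); poles are found by expanding these quotients in the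
    slices.  The product [h] of [P] and [g] is constructed in the same way, and the equation
    [f = delta ^ m * h] is checked on the level of numerators ([delta_quotient_eq]).

    Identities between quotients are proved at the points [q + t] for small real [t], where
    denominators are invertible, and carried over to [q] by continuity ([eq_by_real]). *)

(** * Quaternions, slices and spheres *)

Section QuaternionNorm.
Variable R : realType.
Local Notation H := (quat R).
Implicit Types (p q z w I : H).

Lemma qsqnormM p q : qsqnorm (p * q) = qsqnorm p * qsqnorm q.
Proof. by rewrite /qsqnorm /=; ring. Qed.

Lemma qnormM p q : `|p * q| = `|p| * `|q|.
Proof.
by rewrite -[LHS]/(qnorm _) /qnorm qsqnormM sqrtrM// qsqnorm_ge0.
Qed.

Lemma qnorm_sqr q : `|q| ^+ 2 = qsqnorm q.
Proof. by rewrite -[`|q|]/(qnorm q) sqr_sqrtr// qsqnorm_ge0. Qed.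

Lemma qnorm1 : `|1 : H| = 1.
Proof. by rewrite -[LHS]/(qnorm _) /qnorm /qsqnorm /= expr1n !expr0n !addr0 sqrtr1. Qed.

Lemma qnormX q n : `|q ^+ n| = `|q| ^+ n.
Proof. by elim: n => [|n ih]; rewrite ?expr0 ?qnorm1// !exprS qnormM ih. Qed.

Lemma qnorm_conj q : `|qconj q| = `|q|.
Proof.
by rewrite -[LHS]/(qnorm _) -[RHS]/(qnorm _) /qnorm /qsqnorm /= !sqrrN.
Qed.

Lemma qnorm_real (x : R) : `|x%:A : H| = `|x|.
Proof. by rewrite normrZ qnorm1 mulr1. Qed.

Lemma qmul_neq0 p q : p != 0 -> q != 0 -> p * q != 0.
Proof.
move=> p0 q0; rewrite -normr_eq0 qnormM mulf_eq0 !normr_eq0.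
by rewrite (negbTE p0) (negbTE q0).
Qed.

Lemma qmul_eq0 p q : p * q = 0 -> p = 0 \/ q = 0.
Proof.
move=> /eqP; rewrite -normr_eq0 qnormM mulf_eq0 !normr_eq0 => /orP[]/eqP.
  by left.
by right.
Qed.

Lemma qunitE q : (q \is a GRing.unit) = (q != 0).
Proof. by []. Qed.

Lemma qnormV q : `|q^-1| = `|q|^-1.
Proof.
have [->|q0] := eqVneq q 0; first by rewrite invr_out ?qunitE ?eqxx// normr0 invr0.
have q0' : `|q| != 0 by rewrite normr_eq0.
apply: (mulfI q0'); rewrite -qnormM mulfV// mulrV ?qnorm1//.
Qed.

Lemma qconjM p q : qconj (p * q) = qconj q * qconj p.
Proof. by apply: quatP => /=; ring. Qed.

Lemma qconjD p q : qconj (p + q) = qconj p + qconj q.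
Proof. by apply: quatP => /=; ring. Qed.

Lemma qconjK : involutive (@qconj R).
Proof. by move=> p; apply: quatP => /=; ring. Qed.

Lemma q0_le q : `|q0 q| <= `|q|.
Proof.
rewrite -(ler_pXn2r (n := 2)) ?nnegrE// qnorm_sqr real_normK ?num_real//.
by rewrite /qsqnorm -!addrA lerDl !addr_ge0// sqr_ge0.
Qed.

Lemma q1_le q : `|q1 q| <= `|q|.
Proof.
rewrite -(ler_pXn2r (n := 2)) ?nnegrE// qnorm_sqr real_normK ?num_real//.
rewrite /qsqnorm; move: (sqr_ge0 (q0 q)) (sqr_ge0 (q2 q)) (sqr_ge0 (q3 q)); lra.
Qed.

Lemma q2_le q : `|q2 q| <= `|q|.
Proof.
rewrite -(ler_pXn2r (n := 2)) ?nnegrE// qnorm_sqr real_normK ?num_real//.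
rewrite /qsqnorm; move: (sqr_ge0 (q0 q)) (sqr_ge0 (q1 q)) (sqr_ge0 (q3 q)); lra.
Qed.

Lemma q3_le q : `|q3 q| <= `|q|.
Proof.
rewrite -(ler_pXn2r (n := 2)) ?nnegrE// qnorm_sqr real_normK ?num_real//.
rewrite /qsqnorm; move: (sqr_ge0 (q0 q)) (sqr_ge0 (q1 q)) (sqr_ge0 (q2 q)); lra.
Qed.

Lemma quat_sum q : q = (q0 q)%:A + (q1 q) *: Quat 0 1 0 0
  + (q2 q) *: Quat 0 0 1 0 + (q3 q) *: Quat 0 0 0 1.
Proof. by apply: quatP => /=; ring. Qed.

Lemma qnorm_units :
  [/\ `|Quat 0 1 0 0 : H| = 1, `|Quat 0 0 1 0 : H| = 1 & `|Quat 0 0 0 1 : H| = 1].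
Proof.
by split; rewrite -[LHS]/(qnorm _) /qnorm /qsqnorm /= expr1n !expr0n
  ?addr0 ?add0r sqrtr1.
Qed.

Lemma qnorm_le_sum q : `|q| <= `|q0 q| + `|q1 q| + `|q2 q| + `|q3 q|.
Proof.
have [e1 e2 e3] := qnorm_units.
rewrite {1}[q]quat_sum (le_trans (ler_normD _ _))// lerD//; last first.
  by rewrite normrZ e3 mulr1.
rewrite (le_trans (ler_normD _ _))// lerD//; last by rewrite normrZ e2 mulr1.
rewrite (le_trans (ler_normD _ _))// lerD//; last by rewrite normrZ e1 mulr1.
by rewrite qnorm_real.
Qed.

End QuaternionNorm.

Section QuaternionTopology.
Variable R : realType.
Local Notation H := (quat R).

Lemma cvg_qM {T : Type} {F : set_system T} {FF : Filter F} (f g : T -> H) (a b : H) :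
  f @ F --> a -> g @ F --> b -> (fun x => f x * g x) @ F --> a * b.
Proof.
move=> fa gb.
have fa0 : (fun x => `|f x - a|) @ F --> (0 : R).
  rewrite -[X in _ --> X](normr0 H); apply: cvg_norm; rewrite -(subrr a).
  by apply: cvgB => //; exact: cvg_cst.
have gb0 : (fun x => `|g x - b|) @ F --> (0 : R).
  rewrite -[X in _ --> X](normr0 H); apply: cvg_norm; rewrite -(subrr b).
  by apply: cvgB => //; exact: cvg_cst.
apply/cvgrPdist_le => e e0; near=> x.
have -> : a * b - f x * g x = - ((f x - a) * (g x - b) + a * (g x - b) + (f x - a) * b).
  by rewrite !(mulrDl, mulrDr, mulrN, mulNr) opprK !opprD !opprK; apply: quatP => /=; ring.
rewrite normrN.
apply: (@le_trans _ _ (`|f x - a| * `|g x - b| + `|a| * `|g x - b| + `|f x - a| * `|b|)).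
  rewrite -!qnormM (le_trans (ler_normD _ _))// lerD2r.
  exact: ler_normD.
near: x.
have h : (fun x => `|f x - a| * `|g x - b| + `|a| * `|g x - b| + `|f x - a| * `|b|) @ F --> (0 : R).
  rewrite -[X in _ --> X]addr0; apply: cvgD; last first.
    by rewrite -[X in _ --> X](mul0r `|b|); apply: cvgM => //; exact: cvg_cst.
  rewrite -[X in _ --> X]addr0; apply: cvgD.
    by rewrite -[X in _ --> X](mul0r 0); apply: cvgM.
  by rewrite -[X in _ --> X](mulr0 `|a|); apply: cvgM => //; exact: cvg_cst.
move/cvgrPdist_le : h => /(_ _ e0); apply: filterS => x.
by rewrite sub0r normrN; exact: le_trans (ler_norm _).
Unshelve. all: by end_near. Qed.

End QuaternionTopology.

Section Slices.
Variable R : realType.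
Local Notation H := (quat R).
Implicit Types (p q z w I : H) (x y : R).

Definition imsq q : R := q1 q ^+ 2 + q2 q ^+ 2 + q3 q ^+ 2.

Lemma imsq_ge0 q : 0 <= imsq q.
Proof. by rewrite !addr_ge0 ?sqr_ge0. Qed.

Lemma unit_coord I : imaginary_units I <-> q0 I = 0 /\ imsq I = 1.
Proof.
rewrite /imaginary_units /= expr2; split.
  move=> h; have := congr1 (@q0 R) h; have := congr1 (@q1 R) h.
  have := congr1 (@q2 R) h; have := congr1 (@q3 R) h => /=.
  rewrite /imsq; set a := q0 I; set b := q1 I; set c := q2 I; set d := q3 I.
  move=> h3 h2 h1 h0.
  have ab : a * b = 0 by lra.
  have ac : a * c = 0 by lra.
  have ad : a * d = 0 by lra.
  have a0 : a = 0.
    apply/eqP; apply/negPn/negP => an0.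
    have b0 : b = 0 by apply: (mulfI an0); rewrite mulr0.
    have c0 : c = 0 by apply: (mulfI an0); rewrite mulr0.
    have d0 : d = 0 by apply: (mulfI an0); rewrite mulr0.
    move: h0; rewrite b0 c0 d0 !mulr0 !subr0 => h0.
    have := sqr_ge0 a; rewrite expr2 h0; lra.
  split=> //; move: h0; rewrite a0 !expr2; lra.
move=> [h0 h1]; apply: quatP => /=; rewrite h0; move: h1; rewrite /imsq !expr2; lra.
Qed.

Definition unit_i : H := Quat 0 1 0 0.

Lemma unit_iP : imaginary_units unit_i.
Proof. by apply/unit_coord; split=> //; rewrite /imsq /= expr1n !expr0n !addr0. Qed.

Lemma qnorm_unit I : imaginary_units I -> `|I| = 1.
Proof.
move=> /unit_coord[h0 h1]; apply/eqP.
rewrite -(eqrXn2 (n := 2))// qnorm_sqr expr1n /qsqnorm h0 expr0n /= add0r.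
by apply/eqP.
Qed.

Lemma unit_mul I : imaginary_units I -> I * I = -1.
Proof. by rewrite -expr2. Qed.

Lemma qsqnorm_slice_point I x y : imaginary_units I ->
  qsqnorm (slice_point I x y) = x ^+ 2 + y ^+ 2.
Proof.
move=> /unit_coord[h0]; rewrite /imsq /qsqnorm /slice_point /= h0 => h1.
transitivity (x ^+ 2 + y ^+ 2 * (q1 I ^+ 2 + q2 I ^+ 2 + q3 I ^+ 2)); first ring.
by rewrite h1 mulr1.
Qed.

Lemma slice_point_coord I z : slice I z -> imaginary_units I ->
  z = slice_point I (q0 z) (q1 z * q1 I + q2 z * q2 I + q3 z * q3 I).
Proof.
move=> [x [y ->]] /unit_coord[h0]; rewrite /imsq => h1.
have -> : q0 (slice_point I x y) = x by rewrite /= h0; ring.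
congr (slice_point I x _) => /=.
rewrite -[LHS]mulr1 -h1; ring.
Qed.

Lemma q0_slice_point I x y : imaginary_units I -> q0 (slice_point I x y) = x.
Proof. by move=> /unit_coord[h0 _]; rewrite /= h0; ring. Qed.

Lemma imsq_slice_point I x y : imaginary_units I -> imsq (slice_point I x y) = y ^+ 2.
Proof. by move=> /unit_coord[_]; rewrite /imsq /= => h; rewrite -[RHS]mulr1 -h; ring. Qed.

Lemma slice_pointD I x y x' y' :
  slice_point I x y + slice_point I x' y' = slice_point I (x + x') (y + y').
Proof. by apply: quatP => /=; ring. Qed.

Lemma slice_pointN I x y : - slice_point I x y = slice_point I (- x) (- y).
Proof. by apply: quatP => /=; ring. Qed.

Lemma slice_pointB I x y x' y' :
  slice_point I x y - slice_point I x' y' = slice_point I (x - x') (y - y').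
Proof. by rewrite slice_pointN slice_pointD. Qed.

Lemma slice_pointM I x y x' y' : imaginary_units I ->
  slice_point I x y * slice_point I x' y' =
  slice_point I (x * x' - y * y') (x * y' + y * x').
Proof.
move=> /unit_mul II; rewrite /slice_point !(mulrDl, mulrDr).
rewrite -!(scalerAl, scalerAr) II !scalerA !mul1r !mulr1 !scalerN.
by apply: quatP => /=; ring.
Qed.

Lemma slice_pointZ I a x y : a *: slice_point I x y = slice_point I (a * x) (a * y).
Proof. by apply: quatP => /=; ring. Qed.

Lemma slice_point_conj I x y : imaginary_units I ->
  qconj (slice_point I x y) = slice_point I x (- y).
Proof. by move=> /unit_coord[h0 _]; apply: quatP => /=; rewrite ?h0; ring. Qed.

Lemma slice_real I x : slice I x%:A.
Proof. by exists x, 0; rewrite /slice_point scale0r addr0. Qed.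

Lemma slice0 I : slice I 0.
Proof. by rewrite -(scale0r 1); exact: slice_real. Qed.

Lemma slice1 I : slice I 1.
Proof. by rewrite -(scale1r 1); exact: slice_real. Qed.

Lemma slice_unit I : slice I I.
Proof. by exists 0, 1; rewrite /slice_point scale0r add0r scale1r. Qed.

Lemma sliceD I z w : slice I z -> slice I w -> slice I (z + w).
Proof. by move=> [a [b ->]] [c [d ->]]; rewrite slice_pointD; exists (a + c), (b + d). Qed.

Lemma sliceN I z : slice I z -> slice I (- z).
Proof. by move=> [a [b ->]]; rewrite slice_pointN; exists (- a), (- b). Qed.

Lemma sliceB I z w : slice I z -> slice I w -> slice I (z - w).
Proof. by move=> hz hw; apply: sliceD => //; exact: sliceN. Qed.

Lemma sliceZ I a z : slice I z -> slice I (a *: z).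
Proof. by move=> [x [y ->]]; rewrite slice_pointZ; exists (a * x), (a * y). Qed.

Lemma sliceM I z w : imaginary_units I -> slice I z -> slice I w -> slice I (z * w).
Proof. by move=> hI [a [b ->]] [c [d ->]]; rewrite slice_pointM//; eexists; eexists. Qed.

Lemma slice_conj I z : imaginary_units I -> slice I z -> slice I (qconj z).
Proof. by move=> hI [a [b ->]]; rewrite slice_point_conj//; eexists; eexists. Qed.

Lemma sliceV I z : imaginary_units I -> slice I z -> slice I z^-1.
Proof. by move=> hI hz; apply: sliceZ; exact: slice_conj. Qed.

Lemma sliceX I z n : imaginary_units I -> slice I z -> slice I (z ^+ n).
Proof.
move=> hI hz; elim: n => [|n ih]; first by rewrite expr0; exact: slice1.
by rewrite exprS; exact: sliceM.
Qed.

Lemma sliceC I z w : imaginary_units I -> slice I z -> slice I w -> z * w = w * z.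
Proof.
move=> hI [a [b ->]] [c [d ->]]; rewrite !slice_pointM//.
by congr slice_point; ring.
Qed.

Lemma slice_pointP q : exists I x y, imaginary_units I /\ q = slice_point I x y.
Proof.
have [v0|v0] := eqVneq (imsq q) 0.
  exists unit_i, (q0 q), 0; split; first exact: unit_iP.
  move: v0 => /eqP; rewrite /imsq !paddr_eq0 ?addr_ge0 ?sqr_ge0//.
  rewrite !sqrf_eq0 => /andP[/andP[/eqP h1 /eqP h2] /eqP h3].
  by apply: quatP => /=; rewrite ?h1 ?h2 ?h3; ring.
set s := Num.sqrt (imsq q).
have s0 : s != 0 by rewrite sqrtr_eq0 -ltNge lt_neqAle eq_sym v0 imsq_ge0.
have ss : s ^+ 2 = imsq q by rewrite sqr_sqrtr// imsq_ge0.
exists (s^-1 *: (q - (q0 q)%:A)), (q0 q), s; split.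
  apply/unit_coord; split; first by rewrite /=; ring.
  rewrite /imsq /= -[RHS](mulVf v0) -{1}ss /imsq.
  by rewrite -exprVn; field.
by rewrite /slice_point scalerA divff// scale1r addrC subrK.
Qed.

Lemma real_commute a q : a%:A * q = q * a%:A.
Proof. by apply: quatP => /=; ring. Qed.

Lemma sphereP x y q : sphere x y q <-> q0 q = x /\ imsq q = y ^+ 2.
Proof.
split=> [[I hI <-]|[h0 h1]].
  by rewrite q0_slice_point// imsq_slice_point.
have [I [a [b [hI qE]]]] := slice_pointP q.
move: h0 h1; rewrite qE q0_slice_point// imsq_slice_point// => -> /eqP.
rewrite eqf_sqr => /orP[/eqP ->|/eqP ->]; first by exists I.
exists (- I); first by rewrite /imaginary_units /= sqrrN.
by rewrite /slice_point scalerN scaleNr.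
Qed.

(** The expression written out in the main statement. *)
Definition qDelta x y q : H := (q - x%:A) ^+ 2 + (y ^+ 2)%:A.

Lemma qDelta_factor I x y z : imaginary_units I -> slice I z ->
  qDelta x y z = (z - slice_point I x y) * (z - slice_point I x (- y)).
Proof.
move=> hI [a [b ->]]; rewrite /qDelta !slice_pointB slice_pointM//.
have -> : x%:A = slice_point I x 0 by rewrite /slice_point scale0r addr0.
have -> : (y ^+ 2)%:A = slice_point I (y ^+ 2) 0 by rewrite /slice_point scale0r addr0.
rewrite slice_pointB expr2 slice_pointM// slice_pointD.
by congr slice_point; ring.
Qed.

Lemma qDelta_eq0 x y q : qDelta x y q = 0 <-> sphere x y q.
Proof.
rewrite sphereP; have [I [a [b [hI ->]]]] := slice_pointP q.
rewrite q0_slice_point// imsq_slice_point// (qDelta_factor _ _ hI); last by exists a, b.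
rewrite !slice_pointB.
have sp0 c d : slice_point I c d = 0 <-> c = 0 /\ d = 0.
  split=> [/(congr1 (@qsqnorm R))|[-> ->]]; last first.
    by rewrite /slice_point !scale0r addr0.
  rewrite qsqnorm_slice_point// /qsqnorm /= expr0n/= !addr0 => /eqP.
  by rewrite paddr_eq0 ?sqr_ge0// !sqrf_eq0 => /andP[/eqP -> /eqP ->].
split.
  move=> /qmul_eq0[] /sp0[/eqP]; rewrite subr_eq0 => /eqP -> h; split=> //.
    by rewrite (_ : b = y)//; lra.
  by rewrite (_ : b = - y) ?sqrrN//; lra.
move=> [-> /eqP]; rewrite eqf_sqr subrr => /orP[]/eqP->.
  by rewrite (subrr y) (_ : slice_point I 0 0 = 0) ?mul0r//; apply/sp0.
by rewrite (subrr (- y)) (_ : slice_point I 0 0 = 0) ?mulr0//; apply/sp0.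
Qed.

End Slices.

Section SliceDiff.
Variable R : realType.
Local Notation H := (quat R).
Implicit Types (p q z w I : H) (x y : R) (F G u : H -> H).

Lemma qinvE q : q^-1 = (`|q| ^- 2) *: qconj q.
Proof. by rewrite qnorm_sqr. Qed.

Lemma cvg_qconj {T : Type} {F : set_system T} {FF : Filter F} (f : T -> H) (a : H) :
  f @ F --> a -> (fun t => qconj (f t)) @ F --> qconj a.
Proof.
move=> fa; apply/cvgrPdist_le => e e0; move/cvgrPdist_le : fa => /(_ _ e0).
apply: filterS => x; rewrite (_ : qconj a - qconj (f x) = qconj (a - f x)) ?qnorm_conj//.
by apply: quatP => /=; ring.
Qed.

Lemma cvg_qV {T : Type} {F : set_system T} {FF : Filter F} (f : T -> H) (a : H) :
  a != 0 -> f @ F --> a -> (fun t => (f t)^-1) @ F --> a^-1.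
Proof.
move=> a0 fa.
have na0 : `|a| ^+ 2 != 0 by rewrite expf_neq0// normr_eq0.
rewrite (_ : (fun t => (f t)^-1) = (fun t => (`|f t| ^- 2) *: qconj (f t))); last first.
  by apply/funext => t; rewrite qinvE.
rewrite qinvE; apply: cvgZ; last exact: cvg_qconj.
apply: (@cvgV _ _ _ FF (fun t => `|f t| ^+ 2)) => //.
by rewrite expr2; apply: cvgM; exact: cvg_norm.
Qed.

Definition slice_nbhs I z := within (slice I) (nbhs z).

Lemma sn_near0 I z (P : H -> Prop) : (\forall w \near slice_nbhs I z, P w) <->
  exists2 d : R, 0 < d & forall w, slice I w -> `|w - z| < d -> P w.
Proof.
split.
  move=> /nbhs_ballP[d d0 h]; exists d => // w Iw wz; apply: h => //.
  by rewrite -ball_normE /= distrC.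
move=> [d d0 h]; apply/nbhs_ballP; exists d => // w; rewrite -ball_normE /= distrC => wz Iw.
exact: h.
Qed.

Lemma cvg_sn_id I z : w @[w --> slice_nbhs I z] --> z.
Proof. exact: cvg_within. Qed.

Lemma sn_slice I z : \forall w \near slice_nbhs I z, slice I w.
Proof. by apply/sn_near0; exists 1. Qed.

(** Differentiability within a slice in Caratheodory's form.  The increment [w - z] is a
    left factor and commutes with [I], so that this says that the differential commutes
    with multiplication by [I]: it encodes the vanishing of [dbar] without reference to
    partial derivatives and is stable under the operations below. *)
Definition sdiff I F z :=
  exists2 Phi : H -> H, Phi w @[w --> slice_nbhs I z] --> Phi z &
    \forall w \near slice_nbhs I z, F w = F z + (w - z) * Phi w.

Lemma cvg_near_eq {T : Type} {F : set_system T} {FF : Filter F} (f g : T -> H) (a : H) :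
  (\forall x \near F, g x = f x) -> f @ F --> a -> g @ F --> a.
Proof.
by move=> fg; apply: cvg_trans; apply: near_eq_cvg; apply: filterS fg => x ->.
Qed.

Lemma sdiff_cvg I F z : sdiff I F z -> F w @[w --> slice_nbhs I z] --> F z.
Proof.
move=> [Phi cPhi FE]; apply: (cvg_near_eq FE).
have : F z + (w - z) * Phi w @[w --> slice_nbhs I z] --> F z + (z - z) * Phi z.
  apply: cvgD; first exact: cvg_cst.
  by apply: cvg_qM => //; apply: cvgB; [exact: cvg_sn_id|exact: cvg_cst].
by rewrite subrr mul0r addr0.
Qed.

Lemma sdiff_near I F G z : slice I z -> (\forall w \near slice_nbhs I z, F w = G w) ->
  sdiff I F z -> sdiff I G z.
Proof.
move=> Iz FG [Phi cPhi FE]; exists Phi => //.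
have FGz : F z = G z.
  by move/sn_near0 : FG => [d d0]; apply => //; rewrite subrr normr0.
by near=> w; rewrite -FGz -(near FG w)//; near: w.
Unshelve. all: by end_near. Qed.

Lemma sdiff_cst I c z : sdiff I (fun=> c) z.
Proof.
exists (fun=> 0); first exact: cvg_cst.
by near=> w; rewrite mulr0 addr0.
Unshelve. all: by end_near. Qed.

Lemma sdiff_id I z : sdiff I (fun w => w) z.
Proof.
exists (fun=> 1); first exact: cvg_cst.
by near=> w; rewrite mulr1 addrC subrK.
Unshelve. all: by end_near. Qed.

Lemma sdiffD I F G z : sdiff I F z -> sdiff I G z -> sdiff I (fun w => F w + G w) z.
Proof.
move=> [P cP FE] [Q cQ GE]; exists (fun w => P w + Q w); first exact: cvgD.
by near=> w; rewrite mulrDr addrACA; congr (_ + _); near: w.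
Unshelve. all: by end_near. Qed.

(** The slice-valued factor must be the left one: the increment [w - z] has to be moved
    through it. *)
Lemma sdiffM I u F z : imaginary_units I -> slice I z -> (forall w, slice I w -> slice I (u w)) ->
  sdiff I u z -> sdiff I F z -> sdiff I (fun w => u w * F w) z.
Proof.
move=> hI Iz uI [U cU uE] dF; have cF := sdiff_cvg dF; move: dF => [P cP FE].
exists (fun w => u z * P w + U w * F w).
  by apply: cvgD; [apply: cvg_qM => //; exact: cvg_cst|exact: cvg_qM].
near=> w.
have Iw : slice I w by near: w; exact: sn_slice.
have -> : u w = u z + (w - z) * U w by near: w.
have FwE : F w = F z + (w - z) * P w by near: w.
rewrite mulrDl {1}FwE 2!mulrDr -!addrA !mulrA; congr (_ + _).
have cm : u z * (w - z) = (w - z) * u z by apply: (sliceC hI); [exact: uI|exact: sliceB].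
by rewrite cm.
Unshelve. all: by end_near. Qed.

Lemma cvg_neq0 {T : Type} {F : set_system T} {FF : Filter F} (f : T -> H) (a : H) :
  a != 0 -> f @ F --> a -> \forall x \near F, f x != 0.
Proof.
move=> a0 /cvgrPdist_lt /(_ `|a|); rewrite normr_gt0 => /(_ a0).
apply: filterS => x; apply: contraTneq => ->; by rewrite subr0 ltxx.
Qed.

Lemma sdiffV I u z : imaginary_units I -> slice I z -> (forall w, slice I w -> slice I (u w)) ->
  u z != 0 -> sdiff I u z -> sdiff I (fun w => (u w)^-1) z.
Proof.
move=> hI Iz uI uz0 du; have cu := sdiff_cvg du; move: du => [U cU uE].
have ui : (u w)^-1 @[w --> slice_nbhs I z] --> (u z)^-1 by exact: cvg_qV.
exists (fun w => - ((u w)^-1 * U w * (u z)^-1)).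
  by apply: cvgN; apply: cvg_qM; [exact: cvg_qM|exact: cvg_cst].
near=> w.
have Iw : slice I w by near: w; exact: sn_slice.
have uw0 : u w != 0 by near: w; exact: cvg_neq0 cu.
have uwE : u w = u z + (w - z) * U w by near: w.
have -> : (w - z) * - ((u w)^-1 * U w / u z) = - ((u w)^-1 * ((w - z) * U w) * (u z)^-1).
  have cm : (w - z) * (u w)^-1 = (u w)^-1 * (w - z).
    by apply: (sliceC hI); [exact: sliceB|apply: sliceV => //; exact: uI].
  by rewrite mulrN !mulrA cm.
have -> : (w - z) * U w = u w - u z by rewrite uwE (addrC (u z)) addrK.
by rewrite mulrBr mulVr ?qunitE// mulrBl mul1r -mulrA divrr ?qunitE// mulr1 opprB addrC subrK.
Unshelve. all: by end_near. Qed.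

Lemma sdiff_comp I F u z : slice I z -> (forall w, slice I w -> slice I (u w)) ->
  sdiff I u z -> sdiff I F (u z) -> sdiff I (fun w => F (u w)) z.
Proof.
move=> Iz uI du [P cP FE]; have cu := sdiff_cvg du; move: du => [U cU uE].
have cu' : u w @[w --> slice_nbhs I z] --> slice_nbhs I (u z).
  move=> A /= /cu; rewrite /nbhs /= => h.
  near=> w.
  have Iw : slice I w by near: w; exact: sn_slice.
  by have := uI _ Iw; near: w.
exists (fun w => U w * P (u w)).
  by apply: cvg_qM => //; exact: (cvg_comp u P cu' cP).
near=> w.
have -> : F (u w) = F (u z) + (u w - u z) * P (u w) by near: w; exact: (cu' _ FE).
have uwE : u w = u z + (w - z) * U w by near: w.
by rewrite {1}uwE (addrC (u z)) addrK mulrA.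
Unshelve. all: by end_near. Qed.

(** ** Slice differentiability and the operator [dbar] *)

Lemma dbarE I F x y : dbar I F x y =
  2^-1 *: ('D_1 F (slice_point I x y) + I * 'D_I F (slice_point I x y)).
Proof.
have h1 : derive1 (fun s => F (slice_point I s y)) x = 'D_1 F (slice_point I x y).
  rewrite /derive1 /derive; apply: (congr1 (fun f : R -> H => lim (f @ (0 : R)^'))).
  apply/funext => h /=; congr (_ *: (F _ - _)); by apply: quatP => /=; ring.
have h2 : derive1 (fun t => F (slice_point I x t)) y = 'D_I F (slice_point I x y).
  rewrite /derive1 /derive; apply: (congr1 (fun f : R -> H => lim (f @ (0 : R)^'))).
  apply/funext => h /=; congr (_ *: (F _ - _)); by apply: quatP => /=; ring.
by rewrite /dbar h1 h2.
Qed.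

(** By [dbar = 0] the differential [L] satisfies [L I = I * L 1], so it is right
    multiplication of the increment by [L 1] on the slice. *)
Lemma dbar_sdiff I F x y : imaginary_units I ->
  differentiable F (slice_point I x y) -> dbar I F x y = 0 ->
  sdiff I F (slice_point I x y).
Proof.
set q := slice_point I x y => hI dF.
have Iq : slice I q by exists x, y.
rewrite dbarE !deriveE// -/q => /eqP; rewrite scaler_eq0 invr_eq0 pnatr_eq0/= => /eqP.
set L := 'd F q => LE.
have LI : L I = I * L 1.
  have -> : L 1 = - (I * L I) by apply/eqP; rewrite -addr_eq0 LE.
  by rewrite mulrN mulrA unit_mul// mulN1r opprK.
have Lz w : slice I w -> L w = w * L 1.
  move=> [a [b ->]]; rewrite /slice_point linearD !linearZ LI mulrDl -!scalerAl.
  by rewrite mul1r.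
move/diff_locallyP : dF => [cL].
move/eqaddoP => FE.
exists (fun w => if w == q then L 1 else (w - q)^-1 * (F w - F q)); rewrite ?eqxx.
  apply/cvgrPdist_le => e e0.
  move: (FE _ e0) => /nbhs_ballP[d d0 h]; apply/sn_near0; exists d => // w Iw wq.
  case: ifPn => [_|wnq]; first by rewrite subrr normr0 ltW.
  have wq0 : w - q != 0 by rewrite subr_eq0.
  have -> : L 1 = (w - q)^-1 * L (w - q).
    by rewrite (Lz (w - q)) ?mulKr ?qunitE//; exact: sliceB.
  rewrite -mulrBr qnormM qnormV ler_pdivrMl ?normr_gt0// mulrC.
  have /h : ball (0 : H) d (w - q) by rewrite -ball_normE /= sub0r normrN.
  rewrite -[X in `|X| <= _ -> _]/(F (w - q + q) - (F q + L (w - q))) subrK.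
  by move=> hh; rewrite distrC -addrA -opprD.
near=> w; case: ifPn => [/eqP ->|wnq]; first by rewrite subrr mul0r addr0.
by rewrite mulVKr ?qunitE ?subr_eq0// addrC subrK.
Unshelve. all: by end_near. Qed.

Lemma sdiff_dbar I F x y : imaginary_units I ->
  sdiff I F (slice_point I x y) -> dbar I F x y = 0.
Proof.
set q := slice_point I x y => hI [P cP FE].
have Iq : slice I q by exists x, y.
have key v : slice I v -> 'D_v F q = v * P q.
  move=> Iv; apply/cvg_lim => //.
  have cv : (h *: v + q) @[h --> 0^'] --> slice_nbhs I q.
    have h0 : (h *: v + q) @[h --> (0:R)^'] --> q.
      rewrite -[X in _ --> X]add0r -(scale0r v); apply: cvgD; last exact: cvg_cst.
      apply: cvgZ; last exact: cvg_cst.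
      exact: cvg_within.
    move=> A /= /h0; rewrite /nbhs /= => hA.
    near=> h; apply: (near hA h) => //.
    by apply: sliceD => //; exact: sliceZ.
  apply: (@cvg_near_eq _ _ _ (fun h => v * P (h *: v + q))).
    near=> h; rewrite /= /shift /=.
    have h0 : h != 0 by near: h; exact: nbhs_dnbhs_neq.
    have -> : F (h *: v + q) = F q + (h *: v + q - q) * P (h *: v + q).
      by near: h; exact: (cv _ FE).
    by rewrite addrK addrC addKr -scalerAl scalerA mulVf// scale1r.
  by apply: cvg_qM; [exact: cvg_cst|exact: cvg_comp cv cP].
rewrite dbarE -/q !key; [|exact: slice_unit|exact: slice1].
by rewrite mul1r mulrA unit_mul// mulN1r subrr scaler0.
Unshelve. all: by end_near. Qed.

(** ** Differentiability of products and inverses *)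

Definition mk_linear (V W : lmodType R) (f : V -> W) (hf : linear f) : {linear V -> W} :=
  HB.pack f (GRing.isLinear.Build R V W *:%R f hf).

(** A linear approximation with a quadratic error is available for products, inverses
    and power series; this form avoids the little-o calculus. *)
Lemma differentiable_quad (V W : normedModType R) (F : V -> W) (q : V) (f : V -> W)
    (C d : R) : linear f -> 0 < d ->
  (forall h, `|f h| <= C * `|h|) ->
  (forall h, `|h| < d -> `|F (q + h) - F q - f h| <= C * `|h| ^+ 2) ->
  differentiable F q.
Proof.
move=> lf d0; pose L := mk_linear lf; rewrite -[f]/(L : V -> W) => LC FC.
have cL : continuous L.
  apply: bounded_linear_continuous; exists `|C|; split=> [|M CM]; first exact: num_real.
  apply/nbhs_ballP; exists 1 => //= h; rewrite -ball_normE /= sub0r normrN => h1.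
  rewrite (le_trans (LC h))// (le_trans _ (ltW CM))//.
  by rewrite (le_trans (ler_wpM2r _ (ler_norm _)))// ler_piMr// ltW.
have FE : F \o shift q = cst (F q) + L +o_ (0 : V) id.
  apply/eqaddoP => e e0.
  have dd : 0 < Num.min d (e / (`|C| + 1)).
    by rewrite lt_min d0 divr_gt0// ltr_wpDl.
  apply/nbhs_ballP; exists (Num.min d (e / (`|C| + 1))) => // h.
  rewrite -ball_normE /= sub0r normrN lt_min => /andP[hd he].
  have -> : (F \o shift q - (cst (F q) + L)) h = F (q + h) - F q - L h.
    by rewrite -[LHS]/(F (h + q) - (F q + L h)) opprD addrA [h + q]addrC.
  rewrite (le_trans (FC _ hd))// expr2 mulrA ler_wpM2r//.
  rewrite (le_trans (ler_wpM2r _ (ler_norm _)))//.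
  rewrite ltr_pdivlMr ?ltr_wpDl// in he.
  rewrite mulrC (le_trans _ (ltW he))// ler_wpM2l// lerDl//.
apply/diff_locallyP; have -> : 'd F q = L :> (V -> W) by exact: diff_unique cL FE.
by split.
Unshelve. all: by end_near. Qed.

Lemma differentiable_qM F G q : differentiable F q -> differentiable G q ->
  differentiable (fun w => F w * G w) q.
Proof.
move=> dF dG.
have dm : differentiable (fun p : H * H => p.1 * p.2) (F q, G q).
  pose C : R := `|F q| + `|G q| + 1.
  apply: (@differentiable_quad _ _ _ _ (fun h : H * H => F q * h.2 + h.1 * G q) C 1) => //.
  - move=> c u v /=; rewrite mulrDr mulrDl -scalerAr -scalerAl scalerDr.
    by rewrite -!addrA; congr (_ + _); rewrite addrCA.
  - move=> [h k] /=; rewrite (le_trans (ler_normD _ _))// !qnormM /C mulrDl mulrDl.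
    have h1 : `|h| <= `|(h, k)| by rewrite prod_normE le_max lexx.
    have h2 : `|k| <= `|(h, k)| by rewrite prod_normE le_max lexx orbT.
    rewrite -[leLHS]addr0 lerD ?mul1r//.
    by rewrite lerD ?ler_wpM2l// [leLHS]mulrC ler_wpM2l.
  - move=> [h k] _ /=.
    have h1 : `|h| <= `|(h, k)| by rewrite prod_normE le_max lexx.
    have h2 : `|k| <= `|(h, k)| by rewrite prod_normE le_max lexx orbT.
    have -> : (F q + h) * (G q + k) - F q * G q - (F q * k + h * G q) = h * k.
      by apply: quatP => /=; ring.
    rewrite qnormM expr2 (le_trans (ler_pM _ _ h1 h2))//.
    by rewrite ler_peMl ?mulr_ge0// /C lerDr addr_ge0.
exact: (differentiable_comp (differentiable_pair dF dG) dm).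
Qed.

Lemma differentiable_qV F q : differentiable F q -> F q != 0 ->
  differentiable (fun w => (F w)^-1) q.
Proof.
move=> dF Fq0; apply: (@differentiable_comp _ _ _ _ F (fun w : H => w^-1) _ dF).
move: Fq0; set p := F q => p0.
have np0 : 0 < `|p| by rewrite normr_gt0.
pose C : R := `|p| ^- 2 + 2 * `|p| ^- 3.
have C0 : 0 <= C by rewrite /C addr_ge0// ?mulr_ge0// invr_ge0 exprn_ge0.
apply: (@differentiable_quad _ _ _ _ (fun h : H => - (p^-1 * h * p^-1)) C (`|p| / 2)).
- have lin (a b : H) : linear (fun h : H => - (a * h * b)).
    by move=> c u v; rewrite mulrDr mulrDl opprD -scalerAr -scalerAl scalerN.
  exact: lin.
- by rewrite divr_gt0.
- move=> h; rewrite normrN !qnormM !qnormV mulrAC -invfM -expr2 /C.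
  by rewrite ler_wpM2r// lerDl mulr_ge0// invr_ge0 exprn_ge0.
- move=> h hp.
  have ph : `|p| / 2 <= `|p + h|.
    have := lerB_normD p h; lra.
  have ph0 : p + h != 0 by rewrite -normr_gt0 (lt_le_trans _ ph)// divr_gt0.
  have -> : (p + h)^-1 - p^-1 - - (p^-1 * h * p^-1) = p^-1 * h * p^-1 * h * (p + h)^-1.
    apply: (mulIr (x := p + h)); first by rewrite qunitE.
    rewrite mulrVK ?qunitE// !mulrBl mulVr ?qunitE// mulNr opprK !mulrDr.
    rewrite mulVr ?qunitE// mulrVK ?qunitE//.
    by rewrite opprD addNKr addKr.
  rewrite !qnormM !qnormV.
  have -> : `|p|^-1 * `|h| * `|p|^-1 * `|h| * `|p + h|^-1 =
     (`|p| ^- 2 * `|p + h|^-1) * `|h| ^+ 2 by rewrite -!exprVn; ring.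
  rewrite ler_wpM2r ?exprn_ge0//.
  apply: (@le_trans _ _ (`|p| ^- 2 * (2 * `|p|^-1))).
    rewrite ler_wpM2l ?invr_ge0 ?exprn_ge0// -[leRHS]invrK lef_pV2 ?posrE ?invr_gt0 ?mulr_gt0 ?invr_gt0//.
      by rewrite invfM invrK mulrC.
    by rewrite normr_gt0.
  have -> : `|p| ^- 2 * (2 * `|p|^-1) = 2 * `|p| ^- 3 by rewrite -!exprVn; ring.
  by rewrite /C lerDr invr_ge0 exprn_ge0.
Qed.

End SliceDiff.

(** * The ring of formal power series *)

(** A type distinct from the function space, because the latter already carries the
    pointwise ring structure. *)
Definition fps (R : realType) := nat -> quat R.

Section FormalPowerSeries.
Variable R : realType.
Local Notation H := (quat R).
Implicit Types (a b c : fps R) (Q : {poly R}).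

HB.instance Definition _ := GRing.Zmodule.copy (fps R) (nat -> quat R).

(** Reduces the ring axioms of the star product to those of polynomials. *)
Lemma star_trunc a b N n : (n < N)%N ->
  star a b n = ((\poly_(i < N) a i) * (\poly_(i < N) b i))`_n.
Proof.
move=> nN; rewrite coefM; apply: eq_bigr => k _.
rewrite !coef_poly (leq_ltn_trans (leq_subr _ _) nN).
by rewrite (leq_ltn_trans _ nN)// -ltnS.
Qed.

Fact fps_mulA : associative (fun a b : fps R => star a b : fps R).
Proof.
move=> a b c; apply/funext => n.
transitivity (((\poly_(i < n.+1) a i) * ((\poly_(i < n.+1) b i) * (\poly_(i < n.+1) c i)))`_n).
  rewrite coefM; apply: eq_bigr => k _; rewrite coef_poly ltn_ord.
  by rewrite (star_trunc _ _ (N := n.+1))// ltnS leq_subr.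
rewrite mulrA coefM; apply: eq_bigr => k _.
by rewrite -(star_trunc _ _ (ltn_ord k)) coef_poly ltnS leq_subr.
Qed.

Fact fps_mul1l : left_id (@star_one R : fps R) (fun a b => star a b : fps R).
Proof.
move=> a; apply/funext => n; rewrite /star big_ord_recl /= mul1r subn0.
by rewrite big1 ?addr0// => i _; rewrite mul0r.
Qed.

Fact fps_mul1r : right_id (@star_one R : fps R) (fun a b => star a b : fps R).
Proof.
move=> a; apply/funext => n; rewrite /star big_ord_recr /= subnn mulr1.
rewrite big1 ?add0r// => i _; have : (0 < n - i)%N by rewrite subn_gt0.
by case: (n - i)%N => // m _; rewrite mulr0.
Qed.

Fact fps_mulDl : left_distributive (fun a b : fps R => star a b : fps R) +%R.
Proof.
move=> a b c; apply/funext => n; rewrite /star /= [RHS]/GRing.add /= -big_split /=.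
by apply: eq_bigr => i _; rewrite -mulrDl.
Qed.

Fact fps_mulDr : right_distributive (fun a b : fps R => star a b : fps R) +%R.
Proof.
move=> a b c; apply/funext => n; rewrite /star /= [RHS]/GRing.add /= -big_split /=.
by apply: eq_bigr => i _; rewrite -mulrDr.
Qed.

Fact fps_one_neq0 : (@star_one R : fps R) != 0.
Proof.
apply/eqP => /(congr1 (fun a : fps R => a 0%N)) /= h.
by have := oner_eq0 H; rewrite {1}h eqxx.
Qed.

HB.instance Definition _ := GRing.Zmodule_isNzRing.Build (fps R)
  fps_mulA fps_mul1l fps_mul1r fps_mulDl fps_mulDr fps_one_neq0.

Lemma fpsME a b n : (a * b) n = \sum_(k < n.+1) a k * b (n - k)%N.
Proof. by []. Qed.

Lemma fpsDE a b n : (a + b) n = a n + b n. Proof. by []. Qed.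
Lemma fpsNE a n : (- a) n = - a n. Proof. by []. Qed.

Lemma fpsM_low a b N M : (forall k, (k < N)%N -> a k = 0) -> (forall k, (k < M)%N -> b k = 0) ->
  (a * b) (N + M)%N = a N * b M.
Proof.
move=> aN bM; rewrite fpsME.
have hN : (N < (N + M).+1)%N by rewrite ltnS leq_addr.
rewrite (bigD1 (Ordinal hN)) //= big1 ?addr0 ?addKn// => k kN.
have [kltN|Nlek] := ltnP k N; first by rewrite aN// mul0r.
rewrite bM ?mulr0//.
have Nk : (N < k)%N.
  by rewrite ltn_neqAle Nlek andbT; apply: contra kN => /eqP e; apply/eqP/val_inj.
by rewrite ltn_subLR ?ltn_add2r// -ltnS.
Qed.

Lemma fps_neq0_low a : a != 0 -> exists2 N, a N != 0 & forall k, (k < N)%N -> a k = 0.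
Proof.
move=> a0; have [n an] : exists n, a n != 0.
  apply: contrapT => h; move/eqP : a0; apply; apply/funext => n.
  by apply/eqP/negPn/negP => an; apply: h; exists n.
case: (ex_minnP (ex_intro (fun n => a n != 0) n an)) => N aN Nmin.
exists N => // k; rewrite ltnNge; apply: contraNeq; exact: Nmin.
Qed.

(** The lowest coefficients multiply to a nonzero quaternion. *)
Lemma fpsM_neq0 a b : a != 0 -> b != 0 -> a * b != 0.
Proof.
move=> /fps_neq0_low[N aN Nm] /fps_neq0_low[M bM Mm].
apply/eqP => /(congr1 (fun c : fps R => c (N + M)%N)); rewrite /= fpsM_low// => /eqP.
by apply/negP; exact: qmul_neq0.
Qed.

Lemma fps_mulfI a b c : a != 0 -> a * b = a * c -> b = c.
Proof.
move=> a0 /eqP; rewrite -subr_eq0 -mulrBr => /eqP h; apply/eqP; rewrite -subr_eq0.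
by apply/negPn/negP => bc; have := fpsM_neq0 a0 bc; rewrite h eqxx.
Qed.

(** ** Real coefficients are central *)

Definition real_coef a := forall n, exists x : R, a n = x%:A.

Lemma real_coef_comm a b : real_coef a -> a * b = b * a.
Proof.
move=> ra; apply/funext => n; rewrite !fpsME (reindex_inj rev_ord_inj) /=.
apply: eq_bigr => k _; have kn : (k <= n)%N by rewrite -ltnS.
rewrite subSS subKn//.
by have [x ->] := ra (n - k)%N; exact: real_commute.
Qed.

(** Real polynomials as central elements of the ring of power series. *)
Definition cf Q : fps R := fun n => (Q`_n)%:A.

Lemma cf_real Q : real_coef (cf Q).
Proof. by move=> n; exists Q`_n. Qed.

Lemma cf_comm Q b : cf Q * b = b * cf Q.
Proof. exact/real_coef_comm/cf_real. Qed.

Lemma cfM P Q : cf (P * Q) = cf P * cf Q.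
Proof.
apply/funext => n; rewrite fpsME /cf coefM scaler_suml; apply: eq_bigr => k _.
by rewrite -scalerAl mul1r scalerA.
Qed.

Lemma cf1 : cf 1 = 1.
Proof. by apply/funext => -[|n]; rewrite /cf coef1 /= ?scale1r ?scale0r. Qed.

Lemma cf_eq0 Q : (cf Q == 0) = (Q == 0).
Proof.
apply/eqP/eqP => [h|->]; last by apply/funext => n; rewrite /cf coef0 scale0r.
apply/polyP => n; have /eqP := congr1 (fun c : fps R => c n) h.
by rewrite /= scaler_eq0 oner_eq0 orbF coef0 => /eqP.
Qed.

(** ** Regular conjugation and symmetrization *)

Definition fconj a : fps R := reg_conj a.

Lemma fconjM a b : fconj (a * b) = fconj b * fconj a.
Proof.
apply/funext => n; rewrite fpsME (reindex_inj rev_ord_inj) /= /fconj /reg_conj.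
have qconj_sum m (F : 'I_m -> H) : qconj (\sum_(i < m) F i) = \sum_(i < m) qconj (F i).
  elim: m F => [|m ih] F; first by rewrite !big_ord0; apply: quatP => /=; ring.
  by rewrite !big_ord_recr /= qconjD ih.
rewrite qconj_sum; apply: eq_bigr => k _.
have kn : (k <= n)%N by rewrite -ltnS.
by rewrite qconjM subSS subKn.
Qed.

Lemma fconjK a : fconj (fconj a) = a.
Proof. by apply/funext => n; exact: qconjK. Qed.

Lemma qconj_realP q : qconj q = q -> exists x : R, q = x%:A.
Proof.
move=> h; exists (q0 q); have := congr1 (@q1 R) h.
have := congr1 (@q2 R) h; have := congr1 (@q3 R) h => /= h3 h2 h1.
by apply: quatP => /=; lra.
Qed.

Lemma qconj_real (x : R) : qconj x%:A = x%:A.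
Proof. by apply: quatP => /=; ring. Qed.

Lemma real_coef_fconj a : real_coef a -> fconj a = a.
Proof. by move=> ra; apply/funext => n; have [x E] := ra n; rewrite /fconj /reg_conj E qconj_real. Qed.

(** The series is equal to its own regular conjugate. *)
Lemma symmetrization_real a : real_coef (a * fconj a).
Proof.
move=> n; apply: qconj_realP.
by rewrite -[LHS]/(fconj (a * fconj a) n) fconjM fconjK.
Qed.

Definition fps_linear p : fps R := linear_coef p.

(** [qDelta x y] as a polynomial, so that it can multiply power series. *)
Definition delta (x y : R) : {poly R} := ('X - x%:P) ^+ 2 + (y ^+ 2)%:P.

Lemma deltaE x y : delta x y = 'X^2 - (2 * x) *: 'X + (x ^+ 2 + y ^+ 2)%:P.
Proof.
by rewrite /delta -mul_polyC polyCD polyCM !polyC_exp; ring.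
Qed.

Lemma delta_coef x y n : cf (delta x y) n =
  match n with 0%N => (x ^+ 2 + y ^+ 2)%:A | 1%N => (- (2 * x))%:A | 2%N => 1 | _ => 0 end.
Proof.
rewrite /cf deltaE !coefD coefN coefZ coefX coefXn coefC.
case: n => [|[|[|n]]] /=; rewrite ?mulr0 ?mulr1 ?oppr0 ?add0r ?addr0 ?subr0 ?scale1r ?scale0r//.
Qed.

Lemma delta_neq0 x y : delta x y != 0.
Proof.
rewrite -cf_eq0; apply/eqP => /(congr1 (fun c : fps R => c 2%N)).
by rewrite /= delta_coef => /eqP; rewrite oner_eq0.
Qed.

Lemma fps_linearM0 p b : (fps_linear p * b) 0%N = - p * b 0%N.
Proof. by rewrite fpsME big_ord1. Qed.

Lemma fps_linearMS p b n : (fps_linear p * b) n.+1 = b n - p * b n.+1.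
Proof.
rewrite fpsME !big_ord_recl /= subn0 subSS subn0 mul1r big1 ?addr0; last first.
  by move=> i _; rewrite mul0r.
by rewrite addrC mulNr.
Qed.

(** The points of a sphere share their trace [2 * x] and their squared norm
    [x ^ 2 + y ^ 2], so their minimal polynomial is the same. *)
Lemma fps_linear_conj x y p : sphere x y p -> fps_linear p * fconj (fps_linear p) = cf (delta x y).
Proof.
move=> /sphereP[px py]; have pp : p * qconj p = (x ^+ 2 + y ^+ 2)%:A.
  by rewrite -px -py /imsq; apply: quatP => /=; ring.
have ps : p + qconj p = (2 * x)%:A by rewrite -px; apply: quatP => /=; ring.
have cN q : qconj (- q) = - qconj q by apply: quatP.
have c1 : qconj 1 = 1 :> H by apply: quatP => /=; ring.
have c0 : qconj 0 = 0 :> H by apply: quatP => /=; ring.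
apply/funext => n; rewrite delta_coef; case: n => [|n].
  by rewrite fps_linearM0 /fconj /reg_conj /= cN mulrNN pp.
rewrite fps_linearMS /fconj /reg_conj /=; case: n => [|[|n]] /=.
- by rewrite cN c1 mulr1 -opprD addrC ps scaleNr.
- by rewrite c1 c0 mulr0 subr0.
- by rewrite c0 mulr0 subr0.
Qed.

End FormalPowerSeries.

(** * Convergence of power series *)

Section SeriesConvergence.
Variable R : realType.
Local Notation H := (quat R).

Lemma qseriesE (u : nat -> H) n :
  series u n = Quat (series (@q0 R \o u) n) (series (@q1 R \o u) n)
                    (series (@q2 R \o u) n) (series (@q3 R \o u) n).
Proof.
rewrite !seriesEnat /=; elim: n => [|n ih]; first by rewrite !big_geq.
by rewrite !big_nat_recr//= ih; apply: quatP.
Qed.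

Lemma cvg_quat {T : Type} {F : set_system T} {FF : Filter F} (f0 f1 f2 f3 : T -> R)
    (l0 l1 l2 l3 : R) :
  f0 @ F --> l0 -> f1 @ F --> l1 -> f2 @ F --> l2 -> f3 @ F --> l3 ->
  (fun t => Quat (f0 t) (f1 t) (f2 t) (f3 t)) @ F --> Quat l0 l1 l2 l3.
Proof.
move=> h0 h1 h2 h3.
have E (x0 x1 x2 x3 : R) : Quat x0 x1 x2 x3 =
  x0 *: Quat 1 0 0 0 + x1 *: Quat 0 1 0 0 + x2 *: Quat 0 0 1 0 + x3 *: Quat 0 0 0 1.
  by apply: quatP => /=; ring.
rewrite E (_ : (fun t => _) = (fun t => f0 t *: Quat 1 0 0 0 + f1 t *: Quat 0 1 0 0
  + f2 t *: Quat 0 0 1 0 + f3 t *: Quat 0 0 0 1)); last by apply/funext => t; rewrite E.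
by apply: cvgD; [apply: cvgD; [apply: cvgD|]|]; apply: cvgZr_tmp.
Qed.

Lemma series_bounded_cvg (u : nat -> H) (B : R) :
  (forall N, \sum_(0 <= n < N) `|u n| <= B) -> cvgn (series u).
Proof.
move=> uB.
have cn : cvgn (series (fun n => `|u n|)).
  apply: nondecreasing_is_cvgn.
    by apply: nondecreasing_series => n _ _; exact: normr_ge0.
  by exists B => _ [n _ <-]; rewrite seriesEnat; exact: uB.
have comp (g : H -> R) : (forall q, `|g q| <= `|q|) -> cvgn (series (g \o u)).
  move=> g1; apply: normed_cvg; apply: series_le_cvg cn => n //=.
by rewrite (_ : series u = (fun n => Quat (series (@q0 R \o u) n) (series (@q1 R \o u) n)
                    (series (@q2 R \o u) n) (series (@q3 R \o u) n))); [
  apply/cvg_ex; exists (Quat (limn (series (@q0 R \o u))) (limn (series (@q1 R \o u)))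
   (limn (series (@q2 R \o u))) (limn (series (@q3 R \o u))));
  apply: cvg_quat; apply: comp; [exact: q0_le|exact: q1_le|exact: q2_le|exact: q3_le]
 |apply/funext => n; exact: qseriesE].
Qed.

Lemma cvg_norm_le {T : Type} {F : set_system T} {FF : ProperFilter F} (f : T -> H) (l : H) (B : R) :
  (\forall t \near F, `|f t| <= B) -> f @ F --> l -> `|l| <= B.
Proof.
move=> fB fl; have cl : (fun t => `|f t|) @ F --> `|l| by exact: cvg_norm.
rewrite -(cvg_lim _ cl)//; apply: limr_le => //; by apply/cvg_ex; exists `|l|.
Qed.

Lemma series_norm_le (u : nat -> H) (B : R) l :
  (forall N, \sum_(0 <= n < N) `|u n| <= B) -> series u n @[n --> \oo] --> l -> `|l| <= B.
Proof.
move=> uB; apply: cvg_norm_le; apply: nearW => n.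
by rewrite seriesEnat (le_trans (ler_norm_sum _ _ _)).
Qed.

Lemma geometric_sum_le (t : R) N : 0 <= t -> t < 1 -> \sum_(0 <= n < N) t ^+ n <= (1 - t)^-1.
Proof.
move=> t0 t1; have t1' : 0 < 1 - t by rewrite subr_gt0.
rewrite -[leRHS]mul1r ler_pdivlMr//.
suff -> : (\sum_(0 <= n < N) t ^+ n) * (1 - t) = 1 - t ^+ N by rewrite gerBl exprn_ge0.
elim: N => [|N ih]; first by rewrite big_geq// mul0r expr0 subrr.
by rewrite big_nat_recr//= mulrDl ih exprS; ring.
Qed.

Lemma nexp_le (t : R) n : 0 <= t -> t < 1 -> n%:R * t ^+ n <= (1 - t)^-1.
Proof.
move=> t0 t1; apply: le_trans (geometric_sum_le n t0 t1).
rewrite mulr_natl -[X in _ *+ X](subn0 n) -sumr_const_nat; apply: ler_sum_nat => i /andP[_ iN].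
by rewrite -(subnKC (ltnW iN)) exprD ler_piMr ?exprn_ge0// exprn_ile1// ltW.
Qed.

End SeriesConvergence.

Section PowerSeries.
Variable R : realType.
Local Notation H := (quat R).
Implicit Types (a b : fps R) (p q z w I v e : H) (r s : R).

(** Cauchy--Hadamard in the form of bounds on the coefficients. *)
Definition conv_on r a := forall s, 0 <= s -> s < r -> exists M, forall n, `|a n| * s ^+ n <= M.

Lemma conv_on_le r r' a : r' <= r -> conv_on r a -> conv_on r' a.
Proof. by move=> rr ca s s0 sr; apply: ca => //; exact: lt_le_trans rr. Qed.

Lemma conv_scale r a (c : R) : conv_on r a -> conv_on r (fun n => (n%:R * c) *: a n : H).
Proof.
move=> ca s s0 sr; pose s' := (s + r) / 2.
have ss' : s < s' by rewrite /s'; lra.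
have s'r : s' < r by rewrite /s'; lra.
have s'0 : 0 < s' by exact: le_lt_trans ss'.
have [M aM] := ca s' (ltW s'0) s'r; pose t := s / s'.
have t0 : 0 <= t by rewrite divr_ge0// ltW.
have t1 : t < 1 by rewrite ltr_pdivrMr// mul1r.
exists (`|c| * ((1 - t)^-1 * M)) => n.
have sE : s = t * s' by rewrite /t divfK// gt_eqF.
rewrite normrZ normrM normr_nat sE exprMn.
have -> : n%:R * `|c| * `|a n| * (t ^+ n * s' ^+ n) =
  `|c| * ((n%:R * t ^+ n) * (`|a n| * s' ^+ n)) by ring.
rewrite ler_wpM2l//; apply: ler_pM => //; rewrite ?mulr_ge0 ?exprn_ge0 ?(ltW s'0)//.
exact: nexp_le.
Qed.

(** Comparison with a geometric series of ratio [s / s'], where [s < s' < r]. *)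
Lemma conv_abs_sum r a s : conv_on r a -> 0 <= s -> s < r ->
  exists2 B, 0 <= B & forall N, \sum_(0 <= n < N) `|a n| * s ^+ n <= B.
Proof.
move=> ca s0 sr; pose s' := (s + r) / 2.
have ss' : s < s' by rewrite /s'; lra.
have s'r : s' < r by rewrite /s'; lra.
have s'0 : 0 < s' by exact: le_lt_trans ss'.
have [M aM] := ca s' (ltW s'0) s'r; pose t := s / s'.
have M0 : 0 <= M by apply: le_trans (aM 0%N); rewrite mulr_ge0// exprn_ge0// ltW.
have t0 : 0 <= t by rewrite divr_ge0// ltW.
have t1 : t < 1 by rewrite ltr_pdivrMr// mul1r.
exists (M * (1 - t)^-1) => [|N]; first by rewrite mulr_ge0// invr_ge0 subr_ge0 ltW.
apply: (@le_trans _ _ (M * \sum_(0 <= n < N) t ^+ n)); last first.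
  by rewrite ler_wpM2l//; exact: geometric_sum_le.
rewrite mulr_sumr; apply: ler_sum_nat => n _.
have sE : s = t * s' by rewrite /t divfK// gt_eqF.
by rewrite sE exprMn mulrCA mulrC ler_wpM2r ?exprn_ge0.
Qed.

Definition is_sum a q v := series (power_series_term a q) n @[n --> \oo] --> v.

Lemma conv_term_sum r a q : conv_on r a -> `|q| < r ->
  exists2 B, 0 <= B & forall N, \sum_(0 <= n < N) `|power_series_term a q n| <= B.
Proof.
move=> ca qr; have [B B0 hB] := conv_abs_sum ca (normr_ge0 q) qr.
exists B => // N; apply: le_trans (hB N); apply: ler_sum_nat => n _.
by rewrite qnormM qnormX mulrC.
Qed.

Lemma conv_is_sum r a q : conv_on r a -> `|q| < r -> is_sum a q (power_sum a q).
Proof.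
by move=> ca qr; have [B _ hB] := conv_term_sum ca qr; exact: (series_bounded_cvg hB).
Qed.

Lemma is_sumE a q v : is_sum a q v -> power_sum a q = v.
Proof. by move=> h; apply/cvg_lim. Qed.

Lemma power_series_onP r a : power_series_on r a <-> conv_on r a.
Proof.
split=> [pa s s0 sr|ca q qr]; last first.
  by have [B _ hB] := conv_term_sum ca qr; exact: (series_bounded_cvg hB).
have sr' : `|s%:A : H| < r by rewrite qnorm_real ger0_norm.
have /cvg_series_cvg_0 h := pa _ sr'.
have /cvg_seq_bounded[M [_ /(_ (M + 1))]] : cvgn (power_series_term a s%:A).
  by apply/cvg_ex; exists 0.
rewrite ltrDl ltr01 => /(_ isT) hM; exists (M + 1) => n.
have := hM n I; rewrite /power_series_term /= qnormM qnormX qnorm_real.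
by rewrite ger0_norm// mulrC.
Qed.

Lemma is_sumD a b q v v' : is_sum a q v -> is_sum b q v' -> is_sum (a + b) q (v + v').
Proof.
move=> ha hb; rewrite /is_sum (_ : series _ = (fun n => series (power_series_term a q) n
  + series (power_series_term b q) n)); first exact: cvgD.
apply/funext => n; rewrite !seriesEnat -big_split /=; apply: eq_bigr => i _.
by rewrite /power_series_term -mulrDr.
Qed.

Lemma is_sumZ a q (c : R) v : is_sum a q v -> is_sum (fun n => c *: a n) q (c *: v).
Proof.
move=> ha; rewrite /is_sum (_ : series _ = (fun n => c *: series (power_series_term a q) n)).
  by apply: cvgZ => //; exact: cvg_cst.
apply/funext => n; rewrite !seriesEnat scaler_sumr; apply: eq_bigr => i _.
by rewrite /power_series_term -scalerAr.
Qed.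

Lemma is_sumN a q v : is_sum a q v -> is_sum (- a) q (- v).
Proof.
have -> : - a = (fun n => -1 *: a n) :> fps R by apply/funext => n; rewrite scaleN1r.
by rewrite -(scaleN1r v); exact: is_sumZ.
Qed.

Definition fps_unshift e a : fps R := fun n => if n is m.+1 then a m else e.
Definition fps_shift a : fps R := fun n => a n.+1.

Lemma is_sum_unshift a q e v : is_sum a q v -> is_sum (fps_unshift e a) q (e + q * v).
Proof.
move=> ha; rewrite /is_sum -cvg_shiftS.
rewrite (_ : (fun n => _) = (fun n => e + q * series (power_series_term a q) n)).
  by apply: cvgD; [exact: cvg_cst|apply: cvg_qM => //; exact: cvg_cst].
apply/funext => n; rewrite !seriesEnat /= big_nat_recl// /power_series_term expr0 mul1r.
congr (_ + _); rewrite mulr_sumr; apply: eq_bigr => i _.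
by rewrite exprS mulrA.
Qed.

Lemma conv_shift r a : conv_on r a -> conv_on r (fps_shift a).
Proof.
move=> ca s s0 sr; pose s' := (s + r) / 2.
have ss' : s < s' by rewrite /s'; lra.
have s'r : s' < r by rewrite /s'; lra.
have s'0 : 0 < s' by exact: le_lt_trans ss'.
have [M aM] := ca s' (ltW s'0) s'r.
exists (M / s') => n; rewrite ler_pdivlMr// /fps_shift.
apply: le_trans (aM n.+1); rewrite -mulrA ler_wpM2l// exprSr ler_wpM2r ?(ltW s'0)//.
by rewrite lerXn2r// ?nnegrE ltW.
Qed.

Lemma power_sum_shift r a q : conv_on r a -> `|q| < r ->
  power_sum a q = a 0%N + q * power_sum (fps_shift a) q.
Proof.
move=> ca qr; apply: is_sumE.
have := is_sum_unshift (e := a 0%N) (conv_is_sum (conv_shift ca) qr).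
by rewrite (_ : fps_unshift _ _ = a)//; apply/funext => -[].
Qed.

(** ** Algebraic operations *)

Lemma conv_onD r a b : conv_on r a -> conv_on r b -> conv_on r (a + b).
Proof.
move=> ca cb s s0 sr; have [M hM] := ca s s0 sr; have [N hN] := cb s s0 sr.
exists (M + N) => n; apply: le_trans (lerD (hM n) (hN n)).
by rewrite -mulrDl ler_wpM2r ?exprn_ge0// ler_normD.
Qed.

Lemma conv_onN r a : conv_on r a -> conv_on r (- a).
Proof. by move=> ca s s0 sr; have [M hM] := ca s s0 sr; exists M => n; rewrite fpsNE normrN. Qed.

Lemma conv_fconj r a : conv_on r a -> conv_on r (fconj a).
Proof.
by move=> ca s s0 sr; have [M hM] := ca s s0 sr; exists M => n; rewrite qnorm_conj.
Qed.

Lemma conv_onM r a b : conv_on r a -> conv_on r b -> conv_on r (a * b).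
Proof.
move=> ca cb s s0 sr.
have [B B0 hB] := conv_abs_sum ca s0 sr; have [N hN] := cb s s0 sr.
have N0 : 0 <= N by apply: le_trans (hN 0%N); rewrite mulr_ge0// exprn_ge0.
exists (B * N) => n; rewrite fpsME.
apply: (@le_trans _ _ (\sum_(k < n.+1) (`|a k| * s ^+ k) * (`|b (n - k)%N| * s ^+ (n - k)))).
  rewrite (le_trans (ler_wpM2r (exprn_ge0 _ s0) (ler_norm_sum _ _ _)))// mulr_suml.
  apply: ler_sum => k _; have kn : (k <= n)%N by rewrite -ltnS.
  rewrite qnormM mulrACA -exprD subnKC//.
apply: (@le_trans _ _ (\sum_(k < n.+1) (`|a k| * s ^+ k) * N)).
  by apply: ler_sum => k _; rewrite ler_wpM2l// mulr_ge0// exprn_ge0.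
by rewrite -mulr_suml ler_wpM2r// -(big_mkord xpredT (fun k => `|a k| * s ^+ k)).
Qed.

Lemma conv_fin r a N : (forall n, (N <= n)%N -> a n = 0) -> conv_on r a.
Proof.
move=> aN s s0 sr; exists (\sum_(k < N) `|a k| * s ^+ k) => n.
have [nN|/aN ->] := ltnP n N; last first.
  by rewrite normr0 mul0r sumr_ge0// => k _; rewrite mulr_ge0// exprn_ge0.
rewrite (bigD1 (Ordinal nN)) //= lerDl sumr_ge0// => k _.
by rewrite mulr_ge0// exprn_ge0.
Qed.

Lemma conv_cf r Q : conv_on r (cf Q).
Proof.
by apply: (@conv_fin _ _ (size Q)) => n hn; rewrite /cf nth_default// scale0r.
Qed.

Lemma conv_linear r p : conv_on r (fps_linear p).
Proof. by apply: (@conv_fin _ _ 2) => -[|[|]]. Qed.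

Lemma conv_on1 r : conv_on r 1.
Proof. by apply: (@conv_fin _ _ 1) => -[|]. Qed.

(** Real coefficients commute with the powers of [q], so that for such a left factor
    the star product is the pointwise product. *)
Lemma is_sum_cfM (Q : {poly R}) a q v : is_sum a q v ->
  is_sum (cf Q * a) q (horner_alg q Q * v).
Proof.
move=> ha; elim/poly_ind: Q => [|Q c ih].
  rewrite rmorph0 mul0r (_ : cf 0 * a = (fun n => 0 *: a n)).
    by rewrite -(scale0r v); exact: is_sumZ.
  have -> : cf 0 = 0 :> fps R by apply/eqP; rewrite cf_eq0.
  by apply/funext => n; rewrite mul0r scale0r.
rewrite rmorphD rmorphM /= horner_algX horner_algC mulrDl.
have -> : cf (Q * 'X + c%:P) * a = fps_unshift 0 (cf Q * a) + (fun n => c *: a n) :> fps R.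
  apply/funext => n; rewrite fpsDE fpsME big_ord_recl.
  rewrite /cf coefD coefMX coefC /= add0r subn0 addrC.
  congr (_ + _); last by rewrite -scalerAl mul1r.
  case: n => [|n]; first by rewrite big_ord0.
  rewrite /fps_unshift fpsME; apply: eq_bigr => k _.
  by rewrite /= coefD coefMX coefC /= addr0 /bump /= add1n subSS.
apply: is_sumD; last by rewrite -scalerAl mul1r; exact: is_sumZ.
have qQ : q * horner_alg q Q = horner_alg q Q * q.
  transitivity (horner_alg q ('X * Q)); first by rewrite rmorphM /= horner_algX.
  by rewrite mulrC rmorphM /= horner_algX.
by rewrite -qQ -mulrA -[X in is_sum _ _ X]add0r; exact: is_sum_unshift.
Qed.

Lemma power_sum_cfM r (Q : {poly R}) a q : conv_on r a -> `|q| < r ->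
  power_sum (cf Q * a) q = horner_alg q Q * power_sum a q.
Proof. by move=> ca qr; apply: is_sumE; apply: is_sum_cfM; exact: conv_is_sum ca qr. Qed.

Lemma is_sum1 q : is_sum 1 q 1.
Proof.
rewrite /is_sum -cvg_shiftS (_ : (fun n => _) = (fun=> 1)); first exact: cvg_cst.
apply/funext => n; rewrite seriesEnat /= big_nat_recl// /power_series_term expr0 mul1r.
by rewrite big1 ?addr0// => i _; rewrite /= mulr0.
Qed.

Lemma power_sum_cf Q q : power_sum (cf Q) q = horner_alg q Q.
Proof.
by apply: is_sumE; have := is_sum_cfM (Q := Q) (@is_sum1 q); rewrite !mulr1.
Qed.

Lemma horner_alg_delta x y q : horner_alg q (delta x y) = qDelta x y q.
Proof.
by rewrite /delta rmorphD rmorphXn rmorphB /= horner_algX !horner_algC.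
Qed.

End PowerSeries.

Section PowerSeriesCalculus.
Variable R : realType.
Local Notation H := (quat R).
Implicit Types (a b : fps R) (p q z w I v e h : H) (r s : R).

Lemma power_sum_bounded r a s : conv_on r a -> 0 <= s -> s < r ->
  exists2 B, 0 <= B & forall q, `|q| <= s -> `|power_sum a q| <= B.
Proof.
move=> ca s0 sr; have [B B0 hB] := conv_abs_sum ca s0 sr.
exists B => // q qs; have qr := le_lt_trans qs sr.
apply: series_norm_le (conv_is_sum ca qr) => N; apply: le_trans (hB N).
apply: ler_sum_nat => n _; rewrite qnormM qnormX mulrC ler_wpM2l//.
by rewrite lerXn2r ?nnegrE.
Qed.

(** Vanishing at real points accumulating at the centre forces all coefficients
    to vanish: the constant term is a limit of [t] times a bounded quantity, and the
    remaining factor again vanishes at the same points. *)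
Lemma power_series_identity r a : conv_on r a ->
  (forall d, 0 < d -> exists t : R, [/\ 0 < t, t < d, t < r & power_sum a t%:A = 0]) ->
  a = 0.
Proof.
move=> ca za.
have key0 b : conv_on r b ->
    (forall d, 0 < d -> exists t : R, [/\ 0 < t, t < d, t < r & power_sum b t%:A = 0]) ->
    b 0%N = 0.
  move=> cb zb; have [t0 [t0p _ t0r _]] := zb _ (@ltr01 R).
  have [B B0 hB] := power_sum_bounded (conv_shift cb) (ltW t0p) t0r.
  apply/eqP; rewrite -normr_eq0; apply/negPn/negP => b0.
  have b0p : 0 < `|b 0%N| by rewrite lt_def b0 normr_ge0.
  have d0 : 0 < Num.min t0 (`|b 0%N| / (B + 1)).
    by rewrite lt_min t0p divr_gt0// ltr_wpDl.
  have [t [tp]] := zb _ d0; rewrite lt_min => /andP[tt0 tb] tr.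
  have tr' : `|t%:A : H| < r by rewrite qnorm_real gtr0_norm.
  rewrite (power_sum_shift cb tr') => /eqP; rewrite addr_eq0 => /eqP b0E.
  move: tb; rewrite ltr_pdivlMr ?ltr_wpDl// b0E normrN qnormM qnorm_real gtr0_norm//.
  apply/negP; rewrite -leNgt ler_wpM2l ?(ltW tp)//.
  rewrite (le_trans (hB _ _)) ?lerDl// qnorm_real gtr0_norm// ltW//.
suff key n : forall b, conv_on r b ->
    (forall d, 0 < d -> exists t : R, [/\ 0 < t, t < d, t < r & power_sum b t%:A = 0]) ->
    b n = 0.
  by apply/funext => n; exact: key.
elim: n => [|n ih] b cb zb; first exact: key0.
rewrite -[b n.+1]/(fps_shift b n).
apply: (ih (fps_shift b) (conv_shift cb)) => d /zb[t [tp td tr bt]]; exists t; split => //.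
have tr' : `|t%:A : H| < r by rewrite qnorm_real gtr0_norm.
move: bt; rewrite (power_sum_shift cb tr') key0// add0r => /qmul_eq0[]// /(congr1 (@Num.norm R H)).
by rewrite qnorm_real gtr0_norm// normr0 => t00; move: tp; rewrite t00 ltxx.
Qed.

(** ** Differentiation term by term *)

(** The differential of the n-th power at [q], applied to [h]: the sum of the
    [q ^ i * h * q ^ (n - 1 - i)]. *)
Fixpoint dpow q n h : H := if n is m.+1 then q * dpow q m h + h * q ^+ m else 0.

Lemma dpow_linear q n : linear (dpow q n).
Proof.
elim: n => [|n ih] c u v /=; first by rewrite scaler0 addr0.
by rewrite ih mulrDr mulrDl -!scalerAr -scalerAl scalerDr addrACA.
Qed.

(** On a slice containing [q], this is the complex derivative. *)
Lemma dpow_slice I q n h : imaginary_units I -> slice I q -> slice I h ->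
  dpow q n h = h * dpow q n 1.
Proof.
move=> hI Iq Ih; elim: n => [|n ih] /=; first by rewrite mulr0.
by rewrite ih mul1r mulrDr !mulrA (sliceC hI Iq Ih).
Qed.

Lemma dpow_norm q n h s : 0 < s -> `|q| <= s -> `|dpow q n h| <= n%:R * s ^+ n * (`|h| / s).
Proof.
move=> s0 qs; elim: n => [|n ih] /=; first by rewrite normr0 !mul0r.
rewrite (le_trans (ler_normD _ _))// !qnormM qnormX.
rewrite -natr1 mulrDl mul1r mulrDl lerD//.
  apply: (@le_trans _ _ (s * (n%:R * s ^+ n * (`|h| / s)))); first by rewrite ler_pM.
  by rewrite exprS !mulrA (mulrC s).
have -> : s ^+ n.+1 * (`|h| / s) = `|h| * s ^+ n.
  by rewrite exprSr mulrCA -mulrA divff ?gt_eqF// mulr1.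
rewrite ler_wpM2l//.
by rewrite lerXn2r ?nnegrE// ltW.
Qed.

Lemma pow_sub_norm q n h s : 0 < s -> `|q| <= s -> `|q + h| <= s ->
  `|(q + h) ^+ n - q ^+ n| <= n%:R * s ^+ n * (`|h| / s).
Proof.
move=> s0 qs qhs; elim: n => [|n ih]; first by rewrite !expr0 subrr normr0 !mul0r.
have -> : (q + h) ^+ n.+1 - q ^+ n.+1 = (q + h) * ((q + h) ^+ n - q ^+ n) + h * q ^+ n.
  by rewrite !exprS mulrBr mulrDl [X in _ - X + _]mulrDl opprD addrA subrK.
rewrite (le_trans (ler_normD _ _))// !qnormM qnormX.
rewrite -natr1 mulrDl mul1r mulrDl lerD//.
  apply: (@le_trans _ _ (s * (n%:R * s ^+ n * (`|h| / s)))); first by rewrite ler_pM.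
  by rewrite exprS !mulrA (mulrC s).
have -> : s ^+ n.+1 * (`|h| / s) = `|h| * s ^+ n.
  by rewrite exprSr mulrCA -mulrA divff ?gt_eqF// mulr1.
rewrite ler_wpM2l//.
by rewrite lerXn2r ?nnegrE// ltW.
Qed.

(** The factor [n ^ 2] is harmless: the coefficients [n ^ 2 * a n] have the same radius
    of convergence as [a]. *)
Lemma pow_taylor q n h s : 0 < s -> `|q| <= s -> `|q + h| <= s ->
  `|(q + h) ^+ n - q ^+ n - dpow q n h| <= n%:R ^+ 2 * s ^+ n * (`|h| / s) ^+ 2.
Proof.
move=> s0 qs qhs; elim: n => [|n ih]; first by rewrite !expr0 subrr sub0r normrN normr0 expr0n !mul0r.
have -> : (q + h) ^+ n.+1 - q ^+ n.+1 - dpow q n.+1 h =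
  q * ((q + h) ^+ n - q ^+ n - dpow q n h) + h * ((q + h) ^+ n - q ^+ n).
  rewrite !exprS /= !mulrBr mulrDl opprD !addrA.
  rewrite [LHS](_ : _ = q * (q + h) ^+ n - q * q ^+ n - q * dpow q n h + h * (q + h) ^+ n - h * q ^+ n)//.
  congr (_ - _); rewrite -!addrA; congr (_ + _).
  by rewrite addrC !addrA.
rewrite (le_trans (ler_normD _ _))// !qnormM.
apply: (@le_trans _ _ (s * (n%:R ^+ 2 * s ^+ n * (`|h| / s) ^+ 2) +
  `|h| * (n%:R * s ^+ n * (`|h| / s)))).
  by apply: lerD; [exact: ler_pM|rewrite ler_wpM2l// pow_sub_norm].
have hE : `|h| = s * (`|h| / s) by rewrite mulrCA divff ?gt_eqF// mulr1.
rewrite {2}hE -natr1; set u := `|h| / s; have u0 : 0 <= u by rewrite divr_ge0// ltW.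
rewrite -subr_ge0 (exprS s n).
have -> : (n%:R + 1) ^+ 2 * (s * s ^+ n) * u ^+ 2 -
  (s * (n%:R ^+ 2 * s ^+ n * u ^+ 2) + s * u * (n%:R * s ^+ n * u)) =
  (n%:R + 1) * (s * s ^+ n * u ^+ 2) by ring.
have sn0 : 0 <= s ^+ n by rewrite exprn_ge0// ltW.
exact: (mulr_ge0 (addr_ge0 (ler0n _ _) ler01) (mulr_ge0 (mulr_ge0 (ltW s0) sn0) (exprn_ge0 _ u0))).
Qed.

Lemma power_sum_taylor r a q : conv_on r a -> `|q| < r ->
  exists (L : H -> H) (C d : R), [/\ linear L, 0 < d,
    forall h, `|L h| <= C * `|h|,
    forall h, `|h| < d -> `|power_sum a (q + h) - power_sum a q - L h| <= C * `|h| ^+ 2 &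
    forall I, imaginary_units I -> slice I q -> forall h, slice I h -> L h = h * L 1].
Proof.
move=> ca qr; pose s := (`|q| + r) / 2.
have qs : `|q| < s by rewrite /s; lra.
have sr : s < r by rewrite /s; lra.
have s0 : 0 < s by exact: le_lt_trans qs.
have [B1 B10 hB1] := conv_abs_sum (conv_scale 1 ca) (ltW s0) sr.
have [B2 B20 hB2] := conv_abs_sum (conv_scale 1 (conv_scale 1 ca)) (ltW s0) sr.
have bL h N : \sum_(0 <= n < N) `|dpow q n h * a n| <= B1 * (`|h| / s).
  apply: le_trans (ler_wpM2r _ (hB1 N)); last by rewrite divr_ge0// ltW.
  rewrite mulr_suml; apply: ler_sum_nat => n _.
  rewrite qnormM normrZ mulr1 normr_nat.
  apply: (@le_trans _ _ (n%:R * s ^+ n * (`|h| / s) * `|a n|)).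
    by rewrite ler_wpM2r// dpow_norm// ltW.
  rewrite le_eqVlt; apply/orP; left; apply/eqP; ring.
pose L h := limn (series (fun n => dpow q n h * a n)).
have cL h : series (fun n => dpow q n h * a n) n @[n --> \oo] --> L h.
  exact: (series_bounded_cvg (bL h)).
exists L, (B1 / s + B2 / s ^+ 2), (s - `|q|); split.
- move=> c u v; apply/cvg_lim => //.
  rewrite (_ : series _ = (fun n => c *: series (fun n => dpow q n u * a n) n +
     series (fun n => dpow q n v * a n) n)).
    by apply: cvgD => //; apply: cvgZ => //; exact: cvg_cst.
  apply/funext => n; rewrite !seriesEnat /= scaler_sumr -big_split /=.
  by apply: eq_bigr => i _; rewrite dpow_linear mulrDl scalerAl.
- by rewrite subr_gt0.
- move=> h; apply: le_trans (series_norm_le (bL h) (cL h)) _.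
  rewrite mulrA mulrAC ler_wpM2r// lerDl divr_ge0// exprn_ge0// ltW//.
- move=> h hd.
  have qh : `|q + h| < s by apply: le_lt_trans (ler_normD _ _) _; rewrite addrC -ltrBrDr.
  have qhr := lt_trans qh sr.
  have c3 : series (fun n => ((q + h) ^+ n - q ^+ n - dpow q n h) * a n) n @[n --> \oo] -->
     power_sum a (q + h) - power_sum a q - L h.
    rewrite (_ : series _ = (fun n => series (power_series_term a (q + h)) n -
       series (power_series_term a q) n - series (fun n => dpow q n h * a n) n)).
      by apply: cvgB => //; apply: cvgB; exact: (conv_is_sum ca).
    apply/funext => n; rewrite !seriesEnat /= -!sumrB; apply: eq_bigr => i _.
    by rewrite /power_series_term !mulrBl.
  have hb N : \sum_(0 <= n < N) `|((q + h) ^+ n - q ^+ n - dpow q n h) * a n| <=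
      B2 * (`|h| / s) ^+ 2.
    apply: le_trans (ler_wpM2r _ (hB2 N)); last by rewrite exprn_ge0// divr_ge0// ltW.
    rewrite mulr_suml; apply: ler_sum_nat => n _.
    rewrite !mulr1 qnormM 2!normrZ normr_nat.
    apply: (@le_trans _ _ (n%:R ^+ 2 * s ^+ n * (`|h| / s) ^+ 2 * `|a n|)).
      by rewrite ler_wpM2r// pow_taylor// ltW.
    rewrite le_eqVlt; apply/orP; left; apply/eqP; ring.
  apply: le_trans (series_norm_le hb c3) _.
  rewrite exprMn exprVn mulrA mulrAC ler_wpM2r ?exprn_ge0// lerDr divr_ge0//.
  exact: ltW.
- move=> I hI Iq h Ih; apply/cvg_lim => //.
  rewrite (_ : series _ = (fun n => h * series (fun n => dpow q n 1 * a n) n)).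
    by apply: cvg_qM; [exact: cvg_cst|exact: cL].
  apply/funext => n; rewrite !seriesEnat /= mulr_sumr; apply: eq_bigr => i _.
  by rewrite (dpow_slice _ hI Iq Ih) mulrA.
Qed.

Lemma power_sum_differentiable r a q : conv_on r a -> `|q| < r ->
  differentiable (power_sum a) q.
Proof.
move=> ca qr; have [L [C [d [lL d0 L1 L2 _]]]] := power_sum_taylor ca qr.
exact: differentiable_quad lL d0 L1 L2.
Qed.

Lemma power_sum_sdiff r a I q : conv_on r a -> `|q| < r -> imaginary_units I -> slice I q ->
  sdiff I (power_sum a) q.
Proof.
move=> ca qr hI Iq; have [L [C [d [lL d0 L1 L2 LI]]]] := power_sum_taylor ca qr.
set F := power_sum a in L2 *.
exists (fun w => if w == q then L 1 else (w - q)^-1 * (F w - F q)); rewrite ?eqxx.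
  apply/cvgrPdist_le => e e0.
  have dd : 0 < Num.min d (e / (`|C| + 1)).
    by rewrite lt_min d0 divr_gt0// ltr_wpDl.
  apply/sn_near0; exists (Num.min d (e / (`|C| + 1))) => // w Iw.
  rewrite lt_min => /andP[wd we].
  case: ifPn => [_|wnq]; first by rewrite subrr normr0 ltW.
  have wq0 : w - q != 0 by rewrite subr_eq0.
  have -> : L 1 = (w - q)^-1 * L (w - q).
    by rewrite (LI _ hI Iq (w - q)) ?mulKr ?qunitE//; exact: sliceB.
  rewrite -mulrBr qnormM qnormV ler_pdivrMl ?normr_gt0// mulrC.
  have := L2 _ wd; rewrite [q + _]addrC subrK distrC => h.
  apply: le_trans h _; rewrite expr2 mulrA ler_wpM2r//.
  rewrite (le_trans (ler_wpM2r _ (ler_norm _)))//.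
  rewrite ltr_pdivlMr ?ltr_wpDl// in we.
  by rewrite mulrC (le_trans _ (ltW we))// ler_wpM2l// lerDl.
near=> w; case: ifPn => [/eqP ->|wnq]; first by rewrite subrr mul0r addr0.
by rewrite mulVKr ?qunitE ?subr_eq0// addrC subrK.
Unshelve. all: by end_near. Qed.

(** ** Division by a linear factor *)

Lemma conv_iter_shift r a n : conv_on r a -> conv_on r (iter n (@fps_shift R) a).
Proof. by move=> ca; elim: n => //= n; exact: conv_shift. Qed.

Lemma iter_shiftE a n k : iter n (@fps_shift R) a k = a (n + k)%N.
Proof. by elim: n k => // n ih k; rewrite iterS /fps_shift ih addnS. Qed.

(** The coefficients of the quotient of [a] by [q - p] are the values at [p] of the
    successive shifts of [a] (the Horner scheme). *)
Lemma left_root_div r a p : conv_on r a -> `|p| < r -> power_sum a p = 0 ->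
  exists2 b, conv_on r b & a = fps_linear p * b.
Proof.
move=> ca pr ap0.
pose b : fps R := fun n => power_sum (iter n.+1 (@fps_shift R) a) p.
have bE n : power_sum (iter n (@fps_shift R) a) p = a n + p * b n.
  by rewrite (power_sum_shift (conv_iter_shift n ca) pr) iter_shiftE addn0.
exists b; last first.
  apply/funext => -[|n].
    by rewrite fps_linearM0; have := bE 0%N; rewrite /= ap0 => /esym/eqP; rewrite addr_eq0 mulNr => /eqP.
  by rewrite fps_linearMS {1}/b bE addrK.
move=> s s0 sr; pose t := (Num.max s `|p| + r) / 2.
have sp : Num.max s `|p| < r by rewrite gt_max sr.
have mt : Num.max s `|p| < t by rewrite /t; lra.
have tr : t < r by rewrite /t; lra.
move: mt; rewrite gt_max => /andP[st pt].
have t0 : 0 < t by exact: le_lt_trans st.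
have [B B0 hB] := conv_abs_sum ca (ltW t0) tr.
exists (B / t) => n; rewrite ler_pdivlMr//.
have snt : s ^+ n <= t ^+ n by rewrite lerXn2r ?nnegrE// ltW.
apply: (@le_trans _ _ (`|b n| * t ^+ n.+1)).
  by rewrite -mulrA ler_wpM2l// exprSr ler_wpM2r// ltW.
rewrite -ler_pdivlMr ?exprn_gt0//.
apply: series_norm_le (conv_is_sum (conv_iter_shift n.+1 ca) pr) => N.
rewrite ler_pdivlMr ?exprn_gt0// mulr_suml.
apply: le_trans (hB (n.+1 + N)%N).
have -> : \sum_(0 <= k < n.+1 + N) `|a k| * t ^+ k = \sum_(0 <= k < n.+1) `|a k| * t ^+ k
    + \sum_(n.+1 <= k < n.+1 + N) `|a k| * t ^+ k.
  by apply: big_cat_nat => //; exact: leq_addr.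
rewrite -[X in X <= _]add0r; apply: lerD.
  by apply: sumr_ge0 => i _; rewrite mulr_ge0// exprn_ge0// ltW.
have -> : \sum_(n.+1 <= k < n.+1 + N) `|a k| * t ^+ k =
    \sum_(0 <= k < N) `|a (k + n.+1)%N| * t ^+ (k + n.+1).
  by rewrite -{1}[n.+1]add0n big_addn addKn.
apply: ler_sum_nat => i _.
rewrite /power_series_term iter_shiftE qnormM qnormX [(i + _)%N]addnC [(_ + i)%N]addnC exprD mulrA ler_wpM2r ?exprn_ge0 ?(ltW t0)//.
by rewrite mulrC ler_wpM2l// lerXn2r ?nnegrE ?(ltW t0)// ltW.
Qed.

End PowerSeriesCalculus.

(** * Integrals of quaternion valued continuous functions on segments *)

Section SegmentIntegral.
Variable R : realType.
Local Notation H := (quat R).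
Implicit Types (a b c x t M : R) (f g : R -> R) (F G : R -> H).

Definition rint a b f : R := \int[lebesgue_measure]_(x in `[a, b]) f x.

Definition cont_seg {V : topologicalType} a b (F : R -> V) :=
  forall t, a <= t <= b -> F x @[x --> t] --> F t.

Lemma rint_integrable a b f : cont_seg a b f ->
  lebesgue_measure.-integrable `[a, b] (EFin \o f).
Proof.
move=> cf; apply: continuous_compact_integrable; first exact: segment_compact.
apply: continuous_in_subspaceT => t; rewrite inE /= in_itv /= => tab.
exact: cf.
Qed.

Lemma rint_split a b c f : a <= c -> c <= b -> cont_seg a b f ->
  rint a b f = rint a c f + rint c b f.
Proof.
move=> ac cb cf; have fi := rint_integrable cf.
have /eqP := @Rintegral_itvB _ f (BLeft a) (BRight b) c fi ac cb.
rewrite subr_eq => /eqP E; rewrite {1}/rint E addrC; congr (_ + _).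
rewrite Rintegral_itv_obnd_cbnd//.
by apply: integrableS fi => //; apply: subset_itvr; rewrite bnd_simp.
Qed.

Lemma eq_rint a b f g : (forall t, a <= t <= b -> f t = g t) -> rint a b f = rint a b g.
Proof.
by move=> fg; apply: eq_Rintegral => t; rewrite inE /= in_itv /=; exact: fg.
Qed.

Lemma rintD a b f g : cont_seg a b f -> cont_seg a b g ->
  rint a b (fun t => f t + g t) = rint a b f + rint a b g.
Proof. by move=> cf cg; apply: RintegralD => //; exact: rint_integrable. Qed.

Lemma rintZ a b c f : cont_seg a b f -> rint a b (fun t => c * f t) = c * rint a b f.
Proof. by move=> cf; apply: RintegralZl => //; exact: rint_integrable. Qed.

Lemma rint_cst a b c : a <= b -> rint a b (fun=> c) = (b - a) * c.
Proof.
move=> ab.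
have h : lebesgue_measure (`[a, b]%classic : set R) = (b - a)%:E.
  rewrite lebesgue_measure_itv /= lte_fin.
  move: ab; rewrite le_eqVlt => /orP[/eqP ->|ab]; first by rewrite ltxx subrr.
  by rewrite ab -EFinB.
by rewrite /rint Rintegral_cst// [X in fine X]h /= mulrC.
Qed.

Lemma rint_norm a b f M : a <= b -> cont_seg a b f -> (forall t, a <= t <= b -> `|f t| <= M) ->
  `|rint a b f| <= (b - a) * M.
Proof.
move=> ab cf fM; have fi := rint_integrable cf.
apply: le_trans (le_normr_Rintegral _ fi) _ => //.
rewrite -rint_cst//; apply: le_Rintegral => //.
- apply: rint_integrable => t tab; apply: cvg_norm; exact: cf.
- by apply: rint_integrable => t tab; exact: cvg_cst.
Qed.

Definition qint a b F : H :=
  Quat (rint a b (fun t => q0 (F t))) (rint a b (fun t => q1 (F t)))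
       (rint a b (fun t => q2 (F t))) (rint a b (fun t => q3 (F t))).

Lemma cvg_comp_le {T : Type} {E : set_system T} {FE : Filter E} (g : H -> R) (F : T -> H) (l : H) :
  (forall p q, g (p - q) = g p - g q) -> (forall q, `|g q| <= `|q|) ->
  F @ E --> l -> (fun y => g (F y)) @ E --> g l.
Proof.
move=> gB g1 Fl; apply/cvgrPdist_le => e e0; move/cvgrPdist_le : Fl => /(_ _ e0).
by apply: filterS => t; rewrite -gB; exact: le_trans.
Qed.

Lemma cont_comp a b F : cont_seg a b F ->
  [/\ cont_seg a b (fun t => q0 (F t)), cont_seg a b (fun t => q1 (F t)),
      cont_seg a b (fun t => q2 (F t)) & cont_seg a b (fun t => q3 (F t))].
Proof.
move=> cF; split=> t tab; apply: cvg_comp_le (cF t tab) => //;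
  [exact: q0_le|exact: q1_le|exact: q2_le|exact: q3_le].
Qed.

Lemma qint_split a b c F : a <= c -> c <= b -> cont_seg a b F ->
  qint a b F = qint a c F + qint c b F.
Proof.
move=> ac cb /cont_comp[c0 c1 c2 c3].
by rewrite /qint (rint_split ac cb c0) (rint_split ac cb c1) (rint_split ac cb c2) (rint_split ac cb c3).
Qed.

Lemma eq_qint a b F G : (forall t, a <= t <= b -> F t = G t) -> qint a b F = qint a b G.
Proof. by move=> FG; congr Quat; apply: eq_rint => t /FG ->. Qed.

Lemma qintD a b F G : cont_seg a b F -> cont_seg a b G ->
  qint a b (fun t => F t + G t) = qint a b F + qint a b G.
Proof.
move=> /cont_comp[c0 c1 c2 c3] /cont_comp[d0 d1 d2 d3].
by apply: quatP => /=; rewrite rintD.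
Qed.

Lemma cont_segD a b F G : cont_seg a b F -> cont_seg a b G -> cont_seg a b (fun t => F t + G t).
Proof. by move=> cF cG t tab; apply: cvgD; [exact: cF|exact: cG]. Qed.

Lemma cont_segM a b F G : cont_seg a b F -> cont_seg a b G -> cont_seg a b (fun t => F t * G t).
Proof. by move=> cF cG t tab; apply: cvg_qM; [exact: cF|exact: cG]. Qed.

Lemma cont_seg_cst a b (p : H) : cont_seg a b (fun=> p).
Proof. by move=> t tab; exact: cvg_cst. Qed.

Lemma cont_segN a b F : cont_seg a b F -> cont_seg a b (fun t => - F t).
Proof. by move=> cF t tab; apply: cvgN; exact: cF. Qed.

Lemma qint_linear_comb a b (c0 c1 c2 c3 : R) (f0 f1 f2 f3 : R -> R) :
  cont_seg a b f0 -> cont_seg a b f1 -> cont_seg a b f2 -> cont_seg a b f3 ->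
  rint a b (fun t => c0 * f0 t + c1 * f1 t + c2 * f2 t + c3 * f3 t) =
  c0 * rint a b f0 + c1 * rint a b f1 + c2 * rint a b f2 + c3 * rint a b f3.
Proof.
move=> h0 h1 h2 h3.
have cZ c f : cont_seg a b f -> cont_seg a b (fun t => c * f t).
  by move=> cf t tab; apply: cvgM; [exact: cvg_cst|exact: cf].
have cD f g : cont_seg a b f -> cont_seg a b g -> cont_seg a b (fun t => f t + g t).
  by move=> cf cg t tab; apply: cvgD; [exact: cf|exact: cg].
have e0 := cZ c0 _ h0; have e1 := cZ c1 _ h1; have e2 := cZ c2 _ h2; have e3 := cZ c3 _ h3.
rewrite (rintD (cD _ _ (cD _ _ e0 e1) e2) e3) (rintD (cD _ _ e0 e1) e2) (rintD e0 e1).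
by rewrite !rintZ.
Qed.

Lemma qintMl a b (p : H) F : cont_seg a b F -> qint a b (fun t => p * F t) = p * qint a b F.
Proof.
move=> /cont_comp[c0 c1 c2 c3]; apply: quatP => /=.
- rewrite -!mulNr -qint_linear_comb//; apply: eq_rint => t _; ring.
- rewrite -!mulNr; transitivity (rint a b (fun t => q0 p * q1 (F t) + q1 p * q0 (F t) + q2 p * q3 (F t) + (- q3 p) * q2 (F t))).
    by apply: eq_rint => t _; ring.
  by rewrite qint_linear_comb.
- rewrite -!mulNr; transitivity (rint a b (fun t => q0 p * q2 (F t) + (- q1 p) * q3 (F t) + q2 p * q0 (F t) + (q3 p) * q1 (F t))).
    by apply: eq_rint => t _; ring.
  by rewrite qint_linear_comb.
- rewrite -!mulNr; transitivity (rint a b (fun t => q0 p * q3 (F t) + (q1 p) * q2 (F t) + (- q2 p) * q1 (F t) + (q3 p) * q0 (F t))).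
    by apply: eq_rint => t _; ring.
  by rewrite qint_linear_comb.
Qed.

Lemma qintB a b F G : cont_seg a b F -> cont_seg a b G ->
  qint a b (fun t => F t - G t) = qint a b F - qint a b G.
Proof.
move=> cF cG; have := @qintMl a b (-1) G cG; rewrite mulN1r => <-.
rewrite -qintD//; first by apply: eq_qint => t _; rewrite mulN1r.
by apply: cont_segM => //; exact: cont_seg_cst.
Qed.

Lemma qint_cst a b (p : H) : a <= b -> qint a b (fun=> p) = (b - a) *: p.
Proof. by move=> ab; apply: quatP; rewrite /= rint_cst. Qed.

Lemma qintMr a b (p : H) F : cont_seg a b F -> qint a b (fun t => F t * p) = qint a b F * p.
Proof.
move=> /cont_comp[c0 c1 c2 c3]; apply: quatP => /=.
- transitivity (rint a b (fun t => q0 p * q0 (F t) + (- q1 p) * q1 (F t) + (- q2 p) * q2 (F t) + (- q3 p) * q3 (F t))).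
    by apply: eq_rint => t _; ring.
  rewrite qint_linear_comb//; ring.
- transitivity (rint a b (fun t => q1 p * q0 (F t) + q0 p * q1 (F t) + q3 p * q2 (F t) + (- q2 p) * q3 (F t))).
    by apply: eq_rint => t _; ring.
  rewrite qint_linear_comb//; ring.
- transitivity (rint a b (fun t => q2 p * q0 (F t) + (- q3 p) * q1 (F t) + q0 p * q2 (F t) + q1 p * q3 (F t))).
    by apply: eq_rint => t _; ring.
  rewrite qint_linear_comb//; ring.
- transitivity (rint a b (fun t => q3 p * q0 (F t) + q2 p * q1 (F t) + (- q1 p) * q2 (F t) + q0 p * q3 (F t))).
    by apply: eq_rint => t _; ring.
  rewrite qint_linear_comb//; ring.
Qed.

Lemma qint_norm a b F M : a <= b -> cont_seg a b F -> (forall t, a <= t <= b -> `|F t| <= M) ->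
  `|qint a b F| <= 4 * ((b - a) * M).
Proof.
move=> ab /cont_comp[c0 c1 c2 c3] FM; apply: le_trans (qnorm_le_sum _) _ => /=.
have h f : cont_seg a b f -> (forall t, a <= t <= b -> `|f t| <= `|F t|) ->
    `|rint a b f| <= (b - a) * M.
  by move=> cf fF; apply: rint_norm => // t tab; exact: le_trans (fF _ tab) (FM _ tab).
have := h _ c0 (fun t _ => q0_le (F t)).
have := h _ c1 (fun t _ => q1_le (F t)).
have := h _ c2 (fun t _ => q2_le (F t)).
have := h _ c3 (fun t _ => q3_le (F t)).
lra.
Qed.

End SegmentIntegral.

(** * A bisection principle for rectangles *)

Section Bisection.
Variable R : realType.
Implicit Types (a b c d x y : R).

Definition size_ok (a b c d a0 b0 c0 d0 : R) :=
  [/\ a0 <= a, b <= b0, c0 <= c & d <= d0].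

(** Compactness of a rectangle in the form used below: a property of rectangles
    that is inherited by the union of two halves and that holds for all small
    rectangles around each point holds for the whole rectangle.  The small
    rectangles may be taken similar to the big one. *)
Lemma rectangle_induction (P : R -> R -> R -> R -> Prop) (a0 b0 c0 d0 : R) :
  a0 <= b0 -> c0 <= d0 ->
  (forall a b c d, a <= b -> c <= d -> size_ok a b c d a0 b0 c0 d0 ->
     P a ((a + b) / 2) c d -> P ((a + b) / 2) b c d -> P a b c d) ->
  (forall a b c d, a <= b -> c <= d -> size_ok a b c d a0 b0 c0 d0 ->
     P a b c ((c + d) / 2) -> P a b ((c + d) / 2) d -> P a b c d) ->
  (forall x y, a0 <= x <= b0 -> c0 <= y <= d0 -> exists2 e, 0 < e &
     forall a b c d, a <= x <= b -> c <= y <= d -> b - a < e -> d - c < e ->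
       (b - a) * (d0 - c0) = (d - c) * (b0 - a0) -> size_ok a b c d a0 b0 c0 d0 -> P a b c d) ->
  P a0 b0 c0 d0.
Proof.
move=> ab0 cd0 Ps Pt Ploc; apply: contrapT => nP.
pose T : Type := (R * R * (R * R))%type.
pose PP (r : T) := P r.1.1 r.1.2 r.2.1 r.2.2.
pose m (u : R * R) := (u.1 + u.2) / 2.
(* halve both sides, keeping a half on which the property fails *)
pose step (r : T) : T :=
  let r1 := if pselect (PP ((r.1.1, m r.1), r.2)) then ((m r.1, r.1.2), r.2) else ((r.1.1, m r.1), r.2) in
  if pselect (PP (r1.1, (r1.2.1, m r1.2))) then (r1.1, (m r1.2, r1.2.2)) else (r1.1, (r1.2.1, m r1.2)).
pose r n := iter n step ((a0, b0), (c0, d0)).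
pose ok (r : T) := [/\ r.1.1 <= r.1.2, r.2.1 <= r.2.2,
   size_ok r.1.1 r.1.2 r.2.1 r.2.2 a0 b0 c0 d0 & ~ PP r].
pose half (u v : R * R) := [/\ u.1 <= v.1, v.2 <= u.2 & v.2 - v.1 = (u.2 - u.1) / 2].
have mid (u : R * R) : u.1 <= u.2 -> u.1 <= m u <= u.2 by rewrite /m => h; apply/andP; split; lra.
have step_ok s : ok s -> ok (step s) /\ (half s.1 (step s).1 /\ half s.2 (step s).2).
  case: s => -[a b] [c d]; rewrite /ok /half /PP /size_ok /= => -[ab cd [aa0 bb0 cc0 dd0] nPs].
  have /andP[/= am mb] := mid (a, b) ab; have /andP[/= cm md] := mid (c, d) cd.
  have : exists a' b', [/\ a <= a', a' <= b', b' <= b, b' - a' = (b - a) / 2 &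
    ~ P a' b' c d /\ (if pselect (P a (m (a, b)) c d) then ((m (a, b), b), (c, d)) else ((a, m (a, b)), (c, d))) = ((a', b'), (c, d)) :> T].
    case: pselect => h.
      exists (m (a, b)), b; split => //; first by rewrite /m /=; lra.
      by split=> // h'; apply: nPs; exact: (Ps a b c d).
    by exists a, (m (a, b)); split => //; rewrite /m /=; lra.
  move=> [a' [b' [aa' ab' bb' bE [nP' E]]]].
  rewrite /step /= -/(PP ((a, m (a, b)), (c, d))) /PP /= E /=.
  case: pselect => h /=.
    split; first split => //; first by split; lra.
      move=> h'; apply: nP'; apply: (Pt a' b' c d) => //; split; lra.
    by split; split => //; rewrite /m /=; lra.
  split; first split => //; first by split; rewrite /m /= in cm md *; lra.
  by split; split => //; rewrite /m /=; lra.
have r_ok n : ok (r n).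
  elim: n => [|n ih]; first by split => //; split.
  by have [] := step_ok _ ih.
have r_half n : half (r n).1 (r n.+1).1 /\ half (r n).2 (r n.+1).2.
  by have [_] := step_ok _ (r_ok n).
have len n : (r n).1.2 - (r n).1.1 = (b0 - a0) / 2 ^+ n /\ (r n).2.2 - (r n).2.1 = (d0 - c0) / 2 ^+ n.
  elim: n => [|n [ih1 ih2]]; first by rewrite expr0 !divr1.
  have [[_ _ ->] [_ _ ->]] := r_half n.
  by rewrite ih1 ih2 exprSr invfM !mulrA.
have mono (u v : nat -> R) : (forall n, u n <= u n.+1) -> (forall n, v n.+1 <= v n) ->
    (forall n, u n <= v n) -> exists l, forall n, u n <= l <= v n.
  move=> ui vd uv.
  have un : {homo u : n k / (n <= k)%N >-> n <= k} by apply/nondecreasing_seqP.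
  have vn : {homo v : n k / (n <= k)%N >-> n >= k} by apply/nonincreasing_seqP.
  have bu n k : u k <= v n.
    have [nk|kn] := leqP n k; first exact: le_trans (uv k) (vn _ _ nk).
    exact: le_trans (un _ _ (ltnW kn)) (uv n).
  have cu : cvgn u.
    by apply: nondecreasing_is_cvgn => //; exists (v 0%N) => _ [k _ <-].
  exists (limn u) => n; rewrite nondecreasing_cvgn_le//=.
  by apply: limr_le => //; apply: nearW.
have [x hx] : exists l, forall n, (r n).1.1 <= l <= (r n).1.2.
  apply: mono => n; [by have [[]] := r_half n|by have [[]] := r_half n|by have [] := r_ok n].
have [y hy] : exists l, forall n, (r n).2.1 <= l <= (r n).2.2.
  apply: mono => n; [by have [_ []] := r_half n|by have [_ []] := r_half n|by have [] := r_ok n].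
have [e e0 he] := Ploc x y (hx 0%N) (hy 0%N).
pose K := Num.max (b0 - a0) (d0 - c0) / e.
have K0 : 0 <= K by rewrite divr_ge0 ?(ltW e0)// le_max subr_ge0 ab0.
have [n Kn] : exists n : nat, K < 2 ^+ n.
  have /archi_boundP := K0; set k := Num.bound K => Kk.
  exists k; apply: lt_trans Kk _; rewrite -natrX ltr_nat; exact: ltn_expl.
have p2 : (0 : R) < 2 ^+ n by rewrite exprn_gt0.
have [l1 l2] := len n; have [ro1 ro2 ro3 ro4] := r_ok n.
apply: ro4; apply: he => //.
- rewrite l1 ltr_pdivrMr// mulrC -ltr_pdivrMr// (le_lt_trans _ Kn)// ler_pM2r ?invr_gt0//.
  by rewrite le_max lexx.
- rewrite l2 ltr_pdivrMr// mulrC -ltr_pdivrMr// (le_lt_trans _ Kn)// ler_pM2r ?invr_gt0//.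
  by rewrite le_max lexx orbT.
- rewrite l1 l2; ring.
Qed.

End Bisection.

(** * Goursat's lemma *)

Section Goursat.
Variable R : realType.
Local Notation H := (quat R).
Variable I : H.
Hypothesis hI : imaginary_units I.
Implicit Types (a b c d s t x y : R) (K F : H -> H) (z w : H) (e : seq (R * R)).

Local Notation sp := (slice_point I).

Lemma sp_slice s t : slice I (sp s t).
Proof. by exists s, t. Qed.

Lemma sp_norm s t : `|sp s t| <= `|s| + `|t|.
Proof.
by rewrite (le_trans (ler_normD _ _))// qnorm_real normrZ qnorm_unit// mulr1.
Qed.

Lemma sp_cvg_fst t s : sp u t @[u --> s] --> slice_nbhs I (sp s t).
Proof.
move=> A /= /sn_near0[d d0 h]; apply/nbhs_ballP; exists d => //= u.
rewrite /ball /= distrC => us; apply: h; first exact: sp_slice.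
rewrite slice_pointB subrr; apply: le_lt_trans us.
by rewrite (le_trans (sp_norm _ _))// normr0 addr0.
Qed.

Lemma sp_cvg_snd s t : sp s u @[u --> t] --> slice_nbhs I (sp s t).
Proof.
move=> A /= /sn_near0[d d0 h]; apply/nbhs_ballP; exists d => //= u.
rewrite /ball /= distrC => us; apply: h; first exact: sp_slice.
rewrite slice_pointB subrr; apply: le_lt_trans us.
by rewrite (le_trans (sp_norm _ _))// normr0 add0r.
Qed.

Definition cont_rect K a b c d := forall s t, a <= s <= b -> c <= t <= d ->
  K w @[w --> slice_nbhs I (sp s t)] --> K (sp s t).

Lemma cont_rect_fst K a b c d t : cont_rect K a b c d -> c <= t <= d ->
  cont_seg a b (fun s => K (sp s t)).
Proof. by move=> cK td s sb; exact: cvg_comp (@sp_cvg_fst t s) (cK s t sb td). Qed.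

Lemma cont_rect_snd K a b c d s : cont_rect K a b c d -> a <= s <= b ->
  cont_seg c d (fun t => K (sp s t)).
Proof. by move=> cK sb t td; exact: cvg_comp (@sp_cvg_snd s t) (cK s t sb td). Qed.

Lemma cont_rect_sub K a b c d a' b' c' d' : size_ok a' b' c' d' a b c d ->
  cont_rect K a b c d -> cont_rect K a' b' c' d'.
Proof.
move=> [aa bb cc dd] cK s t /andP[h1 h2] /andP[h3 h4]; apply: cK.
  by rewrite (le_trans aa h1) (le_trans h2 bb).
by rewrite (le_trans cc h3) (le_trans h4 dd).
Qed.

Definition boundary_int K a b c d : H :=
  qint a b (fun s => K (sp s c) - K (sp s d)) +
  I * qint c d (fun t => K (sp b t) - K (sp a t)).

Lemma boundary_int_split_fst K a b c d m : a <= m -> m <= b -> c <= d ->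
  cont_rect K a b c d ->
  boundary_int K a b c d = boundary_int K a m c d + boundary_int K m b c d.
Proof.
move=> am mb cd cK; have ab := le_trans am mb.
have cc : c <= c <= d by rewrite lexx.
have dd : c <= d <= d by rewrite lexx cd.
have aa : a <= a <= b by rewrite lexx.
have bb : a <= b <= b by rewrite lexx ab.
have mm : a <= m <= b by rewrite am.
rewrite /boundary_int (qint_split am mb); last first.
  by apply: cont_segD; [|apply: cont_segN]; exact: cont_rect_fst cK _.
rewrite addrACA -mulrDr -qintD; last first.
- by apply: cont_segD; [|apply: cont_segN]; exact: cont_rect_snd cK _.
- by apply: cont_segD; [|apply: cont_segN]; exact: cont_rect_snd cK _.
congr (_ + _ * _); apply: eq_qint => t _.
by rewrite [RHS]addrC addrA subrK.
Qed.

Lemma boundary_int_split_snd K a b c d m : a <= b -> c <= m -> m <= d ->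
  cont_rect K a b c d ->
  boundary_int K a b c d = boundary_int K a b c m + boundary_int K a b m d.
Proof.
move=> ab cm md cK; have cd := le_trans cm md.
have cc : c <= c <= d by rewrite lexx.
have dd : c <= d <= d by rewrite lexx cd.
have aa : a <= a <= b by rewrite lexx.
have bb : a <= b <= b by rewrite lexx ab.
have mm : c <= m <= d by rewrite cm.
rewrite /boundary_int (qint_split cm md); last first.
  by apply: cont_segD; [|apply: cont_segN]; exact: cont_rect_snd cK _.
rewrite addrACA -mulrDr -qintD; last first.
- by apply: cont_segD; [|apply: cont_segN]; exact: cont_rect_fst cK _.
- by apply: cont_segD; [|apply: cont_segN]; exact: cont_rect_fst cK _.
congr (_ + _ * _); apply: eq_qint => t _.
by rewrite addrA subrK.
Qed.

(** Affine functions have vanishing boundary integral, so only the deviation from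
    an affine function contributes. *)
Lemma boundary_int_small K a b c d (M : R) z B : a <= b -> c <= d -> cont_rect K a b c d ->
  (forall s t, a <= s <= b -> c <= t <= d -> `|K (sp s t) - (K z + (sp s t - z) * B)| <= M) ->
  `|boundary_int K a b c d| <= 8 * M * ((b - a) + (d - c)).
Proof.
move=> ab cd cK hM.
have cc : c <= c <= d by rewrite lexx.
have dd : c <= d <= d by rewrite lexx cd.
have aa : a <= a <= b by rewrite lexx.
have bb : a <= b <= b by rewrite lexx ab.
pose r1 s := (K (sp s c) - K (sp s d)) + (d - c) *: (I * B).
pose r2 t := (K (sp b t) - K (sp a t)) - (b - a) *: B.
have c1 : cont_seg a b (fun s => K (sp s c) - K (sp s d)).
  by apply: cont_segD; [|apply: cont_segN]; exact: cont_rect_fst cK _.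
have c2 : cont_seg c d (fun t => K (sp b t) - K (sp a t)).
  by apply: cont_segD; [|apply: cont_segN]; exact: cont_rect_snd cK _.
have cr1 : cont_seg a b r1 by apply: cont_segD => //; exact: cont_seg_cst.
have cr2 : cont_seg c d r2 by apply: cont_segD => //; exact: cont_seg_cst.
have dev (w1 w2 : H) (k : H) : (w1 - w2) * B = k ->
    `|K w1 - (K z + (w1 - z) * B)| <= M -> `|K w2 - (K z + (w2 - z) * B)| <= M ->
    `|K w1 - K w2 - k| <= 2 * M.
  move=> <- h1 h2; have -> : K w1 - K w2 - (w1 - w2) * B =
    (K w1 - (K z + (w1 - z) * B)) - (K w2 - (K z + (w2 - z) * B)).
    have -> : (w1 - w2) * B = (w1 - z) * B - (w2 - z) * B.
      by rewrite -mulrBl opprB addrA subrK.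
    by rewrite !opprB !opprD !addrA; apply: quatP => /=; ring.
  by rewrite (le_trans (ler_normB _ _))//; lra.
have b1 s : a <= s <= b -> `|r1 s| <= 2 * M.
  move=> sab; rewrite /r1 -[(d - c) *: _]opprK -scaleNr opprB; apply: dev.
  - rewrite slice_pointB subrr /slice_point scale0r add0r -scalerAl; congr (_ *: _).
  - exact: hM.
  - exact: hM.
have b2 t : c <= t <= d -> `|r2 t| <= 2 * M.
  move=> tcd; rewrite /r2; apply: dev.
  - by rewrite slice_pointB subrr /slice_point scale0r addr0 -scalerAl mul1r.
  - exact: hM.
  - exact: hM.
have -> : boundary_int K a b c d = qint a b r1 + I * qint c d r2.
  rewrite /boundary_int /r1 /r2 (qintD c1 (@cont_seg_cst R a b _)).
  rewrite (qintB c2 (@cont_seg_cst R c d _)).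
  rewrite !qint_cst// mulrBr -scalerAr -scalerAr scalerA scalerA [(d - c) * _]mulrC.
  by rewrite addrACA subrr addr0.
rewrite (le_trans (ler_normD _ _))// qnormM qnorm_unit// mul1r.
have := qint_norm ab cr1 b1; have := qint_norm cd cr2 b2; lra.
Qed.

(** The signed square root: its increment over an interval of length [d] containing 0 is
    at least [sqrt d]. *)
Definition ssqrt (u : R) : R := if 0 <= u then Num.sqrt u else - Num.sqrt (- u).

Lemma ssqrt_mono u v : u <= v -> ssqrt u <= ssqrt v.
Proof.
rewrite /ssqrt => uv; case: (leP 0 u) => u0.
  by rewrite (le_trans u0 uv) ler_wsqrtr.
case: (leP 0 v) => v0; first by rewrite (le_trans _ (sqrtr_ge0 _))// oppr_le0.
by rewrite lerN2 ler_wsqrtr// lerN2.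
Qed.

Lemma ssqrt_gap u v : u <= 0 -> 0 <= v -> Num.sqrt (v - u) <= ssqrt v - ssqrt u.
Proof.
move=> u0 v0; have nu : 0 <= - u by rewrite oppr_ge0.
have -> : ssqrt v - ssqrt u = Num.sqrt v + Num.sqrt (- u).
  rewrite /ssqrt v0; case: (leP 0 u) => [u0'|_]; last by rewrite opprK.
  have uE : u = 0 by apply/le_anti; rewrite u0 u0'.
  by rewrite uE oppr0 sqrtr0 subr0 addr0.
rewrite -(ler_pXn2r (n := 2)) ?nnegrE ?addr_ge0 ?sqrtr_ge0//.
rewrite sqrrD !sqr_sqrtr ?addr_ge0//.
by rewrite addrAC lerDl mulrn_wge0// mulr_ge0// sqrtr_ge0.
Qed.

(** An additive majorant of boundary integrals: the area, plus for each exceptional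
    point a product measure which gives a small square around that point a mass
    comparable to its side instead of its area. *)
Definition majorant e a b c d : R := (b - a) * (d - c) +
  \sum_(p <- e) (ssqrt (b - p.1) - ssqrt (a - p.1)) * (ssqrt (d - p.2) - ssqrt (c - p.2)).

Lemma majorant_split_fst e a b c d m :
  majorant e a b c d = majorant e a m c d + majorant e m b c d.
Proof.
rewrite /majorant addrACA -big_split /=; congr (_ + _); first ring.
by apply: eq_bigr => p _; ring.
Qed.

Lemma majorant_split_snd e a b c d m :
  majorant e a b c d = majorant e a b c m + majorant e a b m d.
Proof.
rewrite /majorant addrACA -big_split /=; congr (_ + _); first ring.
by apply: eq_bigr => p _; ring.
Qed.

Lemma majorant_area e a b c d : a <= b -> c <= d -> (b - a) * (d - c) <= majorant e a b c d.
Proof.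
move=> ab cd; rewrite /majorant lerDl sumr_ge0// => p _.
by rewrite mulr_ge0// subr_ge0 ssqrt_mono// lerD2r.
Qed.

Lemma majorant_exc e a b c d x y : a <= x <= b -> c <= y <= d -> (x, y) \in e ->
  Num.sqrt (b - a) * Num.sqrt (d - c) <= majorant e a b c d.
Proof.
move=> /andP[ax xb] /andP[cy yd] xye.
have ab := le_trans ax xb; have cd := le_trans cy yd.
rewrite /majorant (big_rem _ xye) /=.
rewrite -[leLHS]add0r lerD//; first by rewrite mulr_ge0// subr_ge0.
rewrite -[leLHS]addr0 lerD//; last first.
  by rewrite sumr_ge0// => p _; rewrite mulr_ge0// subr_ge0 ssqrt_mono// lerD2r.
apply: ler_pM; rewrite ?sqrtr_ge0//.
  have -> : b - a = (b - x) - (a - x) by ring.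
  by apply: ssqrt_gap; rewrite ?subr_le0 ?subr_ge0.
have -> : d - c = (d - y) - (c - y) by ring.
by apply: ssqrt_gap; rewrite ?subr_le0 ?subr_ge0.
Qed.

(** [K] is only required to be continuous at the exceptional points [e].  Bisection
    compares the boundary integral with [eps * majorant]; both are additive, so small
    rectangles suffice.  Around a regular point the deviation of [K] from an affine
    function is small compared with the diameter, hence the integral is small compared
    with the area; around an exceptional point continuity makes it small compared with
    the perimeter, which the product of signed square roots dominates. *)
Theorem goursat K e a0 b0 c0 d0 : a0 < b0 -> c0 < d0 -> cont_rect K a0 b0 c0 d0 ->
  (forall s t, a0 <= s <= b0 -> c0 <= t <= d0 -> (s, t) \notin e -> sdiff I K (sp s t)) ->
  boundary_int K a0 b0 c0 d0 = 0.
Proof.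
move=> ab0 cd0 cK dK.
pose p := b0 - a0; pose q := d0 - c0.
have p0 : 0 < p by rewrite subr_gt0.
have q0 : 0 < q by rewrite subr_gt0.
suff key : forall eps : R, 0 < eps -> `|boundary_int K a0 b0 c0 d0| <= eps * majorant e a0 b0 c0 d0.
  apply/eqP; rewrite -normr_eq0; apply/negPn/negP => n0.
  have np : 0 < `|boundary_int K a0 b0 c0 d0| by rewrite lt_def n0 normr_ge0.
  have m0 : 0 < majorant e a0 b0 c0 d0.
    by apply: lt_le_trans (majorant_area e (ltW ab0) (ltW cd0)); rewrite mulr_gt0.
  have := key (`|boundary_int K a0 b0 c0 d0| / (2 * majorant e a0 b0 c0 d0)).
  rewrite divr_gt0 ?mulr_gt0// => /(_ isT).
  rewrite invfM mulrA mulfVK ?gt_eqF//; lra.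
(* [eps] is arbitrary, so it is enough to bound the boundary integral by the majorant *)
move=> eps eps0.
apply: (@rectangle_induction R (fun a b c d => `|boundary_int K a b c d| <= eps * majorant e a b c d)).
- exact: ltW.
- exact: ltW.
- move=> a b c d ab cd ok h1 h2; have cK' := cont_rect_sub ok cK.
  have am : a <= (a + b) / 2 by lra.
  have mb : (a + b) / 2 <= b by lra.
  rewrite (boundary_int_split_fst am mb cd cK') (majorant_split_fst _ _ _ _ _ ((a + b) / 2)).
  by rewrite mulrDr (le_trans (ler_normD _ _))// lerD.
- move=> a b c d ab cd ok h1 h2; have cK' := cont_rect_sub ok cK.
  have cm : c <= (c + d) / 2 by lra.
  have md : (c + d) / 2 <= d by lra.
  rewrite (boundary_int_split_snd ab cm md cK') (majorant_split_snd _ _ _ _ _ ((c + d) / 2)).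
  by rewrite mulrDr (le_trans (ler_normD _ _))// lerD.
move=> x y xab ycd.
have pts a b c d s t : a <= x <= b -> c <= y <= d -> a <= s <= b -> c <= t <= d ->
    `|sp s t - sp x y| <= (b - a) + (d - c).
  move=> /andP[? ?] /andP[? ?] /andP[? ?] /andP[? ?].
  rewrite slice_pointB (le_trans (sp_norm _ _))// lerD// ler_norml; apply/andP; split; lra.
have [xye|xyne] := boolP ((x, y) \in e).
  pose eta := eps * Num.sqrt (p * q) / (8 * (p + q)).
  have pq0 : 0 < p + q by exact: addr_gt0.
  have spq0 : 0 < Num.sqrt (p * q) by rewrite sqrtr_gt0 mulr_gt0.
  have eta0 : 0 < eta by rewrite /eta divr_gt0// mulr_gt0.
  have /cvgrPdist_le/(_ _ eta0)/sn_near0[del del0 hdel] := cK _ _ xab ycd.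
  exists (del / 2); first by rewrite divr_gt0.
  move=> a b c d xab' ycd' quotient_poles dcd sim ok.
  have ab : a <= b by case/andP: xab' => ? ?; lra.
  have cd : c <= d by case/andP: ycd' => ? ?; lra.
  have M s t : a <= s <= b -> c <= t <= d ->
      `|K (sp s t) - (K (sp x y) + (sp s t - sp x y) * 0)| <= eta.
    move=> sab tcd; rewrite mulr0 addr0 distrC; apply: hdel; first exact: sp_slice.
    by apply: le_lt_trans (pts _ _ _ _ _ _ xab' ycd' sab tcd) _; lra.
  apply: le_trans (boundary_int_small ab cd (cont_rect_sub ok cK) M) _.
  apply: le_trans (ler_wpM2l (ltW eps0) (majorant_exc xab' ycd' xye)).
  pose l := (b - a) / p.
  have l0 : 0 <= l by apply: divr_ge0; [rewrite subr_ge0|exact: ltW].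
  have bE : b - a = l * p by rewrite /l divfK// gt_eqF.
  have dE : d - c = l * q.
    apply: (mulIf (x := p)); first by rewrite gt_eqF.
    by rewrite -sim bE -/q; ring.
  rewrite -sqrtrM ?subr_ge0// bE dE.
  have -> : l * p * (l * q) = l ^+ 2 * (p * q) by ring.
  rewrite sqrtrM ?sqr_ge0// sqrtr_sqr ger0_norm//.
  rewrite le_eqVlt; apply/orP; left; apply/eqP.
  rewrite /eta; field; by rewrite gt_eqF// addr_gt0.
have [Phi cPhi KE] := dK _ _ xab ycd xyne.
pose eta := eps * (p * q) / (8 * (p + q) ^+ 2).
have pq0 : 0 < p + q by exact: addr_gt0.
have eta0 : 0 < eta by rewrite /eta divr_gt0 ?mulr_gt0 ?exprn_gt0.
have : \forall w \near slice_nbhs I (sp x y), `|Phi (sp x y) - Phi w| <= eta /\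
     K w = K (sp x y) + (w - sp x y) * Phi w.
  near=> w; split; near: w => //.
  by move/cvgrPdist_le : cPhi => /(_ _ eta0).
move=> /sn_near0[del del0 hdel].
exists (del / 2); first by rewrite divr_gt0.
move=> a b c d xab' ycd' quotient_poles dcd sim ok.
have ab : a <= b by case/andP: xab' => ? ?; lra.
have cd : c <= d by case/andP: ycd' => ? ?; lra.
have M s t : a <= s <= b -> c <= t <= d ->
    `|K (sp s t) - (K (sp x y) + (sp s t - sp x y) * Phi (sp x y))| <= eta * ((b - a) + (d - c)).
  move=> sab tcd; have hp := pts _ _ _ _ _ _ xab' ycd' sab tcd.
  have [] := hdel (sp s t) (sp_slice s t); first by apply: le_lt_trans hp _; lra.
  have E (k u v : H) : k + u - (k + v) = u - v by rewrite opprD addrACA subrr add0r.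
  move=> h1 ->; rewrite E -mulrBr qnormM mulrC.
  by rewrite ler_pM// distrC.
apply: le_trans (boundary_int_small ab cd (cont_rect_sub ok cK) M) _.
apply: le_trans (ler_wpM2l (ltW eps0) (majorant_area e ab cd)).
pose l := (b - a) / p.
have l0 : 0 <= l by apply: divr_ge0; [rewrite subr_ge0|exact: ltW].
have bE : b - a = l * p by rewrite /l divfK// gt_eqF.
have dE : d - c = l * q.
  apply: (mulIf (x := p)); first by rewrite gt_eqF.
  by rewrite -sim bE -/q; ring.
rewrite bE dE le_eqVlt; apply/orP; left; apply/eqP.
rewrite /eta; field; by rewrite gt_eqF// addr_gt0.
Unshelve. all: by end_near. Qed.

End Goursat.

(** * Power series expansion of slice differentiable functions *)

Section Cauchy.
Variable R : realType.
Local Notation H := (quat R).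
Variable I : H.
Hypothesis hI : imaginary_units I.
Implicit Types (a b c d s t x y r : R) (K F : H -> H) (z w : H).

Local Notation sp := (slice_point I).

Lemma sp_cvg {T : Type} {E : set_system T} {FE : Filter E} (f g : T -> R) (x y : R) :
  f @ E --> x -> g @ E --> y -> (fun u => sp (f u) (g u)) @ E --> slice_nbhs I (sp x y).
Proof.
move=> fx gy A /= /sn_near0[d d0 h].
have d2 : 0 < d / 2 by rewrite divr_gt0.
rewrite /nbhs /=; near=> u; change (A (sp (f u) (g u))).
apply: h; first exact: sp_slice.
rewrite slice_pointB (le_lt_trans (sp_norm hI _ _))//.
have h1 : `|x - f u| < d / 2 by near: u; move/cvgrPdist_lt : fx; exact.
have h2 : `|y - g u| < d / 2 by near: u; move/cvgrPdist_lt : gy; exact.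
by rewrite (distrC (f u)) (distrC (g u)); lra.
Unshelve. all: by end_near. Qed.

Definition imc w : R := q1 w * q1 I + q2 w * q2 I + q3 w * q3 I.

Lemma imc_sp s t : imc (sp s t) = t.
Proof.
have /unit_coord[_] := hI; rewrite /imsq /imc /= => h.
by rewrite -[RHS]mulr1 -h; ring.
Qed.

(** The exponential of the slice, in polar coordinates. *)
Definition qexp w : H := sp (expR (q0 w) * cos (imc w)) (expR (q0 w) * sin (imc w)).

Lemma qexp_sp s t : qexp (sp s t) = sp (expR s * cos t) (expR s * sin t).
Proof. by rewrite /qexp imc_sp q0_slice_point. Qed.

Lemma qexp_slice w : slice I (qexp w).
Proof. exact: sp_slice. Qed.

Lemma qexpD s t s' t' : qexp (sp (s + s') (t + t')) = qexp (sp s t) * qexp (sp s' t').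
Proof.
rewrite !qexp_sp slice_pointM// expRD cosD sinD; congr slice_point; ring.
Qed.

Lemma deriv0_bound (f : R -> R) (l : R) : is_derive (0 : R) (1 : R) f l ->
  forall e, 0 < e -> exists2 d, 0 < d & forall h, `|h| < d -> `|f h - f 0 - l * h| <= e * `|h|.
Proof.
move=> fl e e0; have [df fE] := fl.
have : h^-1 *: (f (h + 0) - f 0) @[h --> (0:R)^'] --> l.
  rewrite -fE; rewrite /derive.
  have := df; rewrite /derivable => /cvgP; rewrite /= => h.
  apply: cvg_trans h; apply: near_eq_cvg; near=> u => /=.
  by rewrite scaler1.
move=> /cvgrPdist_le/(_ _ e0)/nbhs_ballP[d d0 hd].
exists d => // h hhd; have [->|h0] := eqVneq h 0.
  by rewrite subrr mulr0 subr0 normr0 mulr0.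
have := hd h; rewrite /ball /= sub0r normrN => /(_ hhd h0).
rewrite addr0 => hh; have -> : f h - f 0 - l * h = - (h * (l - h^-1 *: (f h - f 0))).
  have -> : h^-1 *: (f h - f 0) = h^-1 * (f h - f 0) by [].
  by rewrite mulrBr opprB mulVKf// (mulrC l).
by rewrite normrN normrM mulrC ler_wpM2r.
Unshelve. all: by end_near. Qed.

Lemma qexp_at0 e : 0 < e -> exists2 d, 0 < d & forall w, slice I w -> `|w| < d ->
  `|qexp w - 1 - w| <= e * `|w|.
Proof.
move=> e0; pose k := Num.min 1 (e / 6).
have k0 : 0 < k by rewrite lt_min ltr01 divr_gt0.
have k1 : k <= 1 by rewrite ge_min lexx.
have k6 : k <= e / 6 by rewrite ge_min lexx orbT.
have [d1 d10 hexp] := deriv0_bound (is_derive_expR 0) k0.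
have [d2 d20 hcos] := deriv0_bound (is_derive_cos 0) k0.
have [d3 d30 hsin] := deriv0_bound (is_derive_sin 0) k0.
rewrite expR0 in hexp; rewrite sin0 cos0 in hcos; rewrite sin0 cos0 in hsin.
pose d := Num.min (Num.min d1 d2) (Num.min d3 (k / 2)).
exists d; first by rewrite !lt_min d10 d20 d30 divr_gt0.
move=> w [a [b ->]]; rewrite /d !lt_min => /andP[/andP[w1 w2] /andP[w3 wk]].
have an : `|a| <= `|sp a b| by have := q0_le (sp a b); rewrite q0_slice_point.
have bn : `|b| <= `|sp a b|.
  rewrite -(ler_pXn2r (n := 2)) ?nnegrE// qnorm_sqr qsqnorm_slice_point// real_normK ?num_real//.
  by rewrite lerDr sqr_ge0.
rewrite qexp_sp.
have hE := hexp a (le_lt_trans an w1); rewrite mul1r in hE.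
have hC := hcos b (le_lt_trans bn w2); rewrite oppr0 mul0r subr0 in hC.
have hS := hsin b (le_lt_trans bn w3); rewrite subr0 mul1r in hS.
have ak : `|a| < k / 2 by exact: le_lt_trans an wk.
have E1 : `|expR a - 1| <= k.
  have -> : expR a - 1 = (expR a - 1 - a) + a by rewrite subrK.
  rewrite (le_trans (ler_normD _ _))//.
  have : k * `|a| <= `|a| by rewrite ler_piMl.
  lra.
have E2 : `|expR a| <= 2.
  have -> : expR a = (expR a - 1) + 1 by rewrite subrK.
  by rewrite (le_trans (ler_normD _ _))// normr1; lra.
have -> : sp (expR a * cos b) (expR a * sin b) - 1 - sp a b =
  sp ((expR a - 1 - a) + expR a * (cos b - 1)) (expR a * (sin b - b) + (expR a - 1) * b).
  by apply: quatP => /=; ring.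
rewrite (le_trans (sp_norm hI _ _))//.
have h1 : `|expR a - 1 - a + expR a * (cos b - 1)| <= k * `|a| + 2 * (k * `|b|).
  by rewrite (le_trans (ler_normD _ _))// lerD// normrM ler_pM.
have h2 : `|expR a * (sin b - b) + (expR a - 1) * b| <= 2 * (k * `|b|) + k * `|b|.
  by rewrite (le_trans (ler_normD _ _))// lerD// normrM ler_pM.
have h3 : k * `|a| <= (e / 6) * `|sp a b| by rewrite ler_pM// ltW.
have h4 : k * `|b| <= (e / 6) * `|sp a b| by rewrite ler_pM// ltW.
lra.
Qed.

Lemma sdiff_qexp z : slice I z -> sdiff I qexp z.
Proof.
move=> Iz; exists (fun w => if w == z then qexp z else (w - z)^-1 * (qexp w - qexp z)); rewrite ?eqxx.
  apply/cvgrPdist_le => e e0.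
  have e1 : 0 < e / (`|qexp z| + 1) by rewrite divr_gt0// ltr_wpDl.
  have [d d0 hd] := qexp_at0 e1.
  apply/sn_near0; exists d => // w Iw wz; case: ifPn => [_|wnz].
    by rewrite subrr normr0 ltW.
  have wz0 : w - z != 0 by rewrite subr_eq0.
  have Iwz := sliceB Iw Iz.
  have -> : qexp w = qexp z * qexp (w - z).
    move: Iw Iz => [a [b ->]] [a' [b' ->]]; rewrite slice_pointB -qexpD.
    by rewrite (addrC a') subrK (addrC b') subrK.
  have -> : qexp z - (w - z)^-1 * (qexp z * qexp (w - z) - qexp z) =
    - ((w - z)^-1 * (qexp z * (qexp (w - z) - 1 - (w - z)))).
    have cm := sliceC hI (qexp_slice z) Iwz.
    move: (qexp (w - z)) wz0 cm => b; move: (w - z) (qexp z) => v p v0 cm.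
    have -> : p * (b - 1 - v) = (p * b - p) - v * p by rewrite !mulrBr mulr1 cm.
    by rewrite (mulrBr v^-1 (p * b - p)) mulKr ?qunitE// opprB.
  rewrite normrN !qnormM qnormV ler_pdivrMl ?normr_gt0// mulrC (mulrC `|w - z|).
  apply: (@le_trans _ _ (e / (`|qexp z| + 1) * `|w - z| * `|qexp z|)).
    by rewrite ler_wpM2r// hd.
  rewrite mulrAC ler_wpM2r// mulrAC ler_pdivrMr ?ltr_wpDl//.
  by rewrite ler_wpM2l ?(ltW e0)// lerDl.
near=> w; case: ifPn => [/eqP ->|wnq]; first by rewrite subrr mul0r addr0.
by rewrite mulVKr ?qunitE ?subr_eq0// addrC subrK.
Unshelve. all: by end_near. Qed.

(** ** Circles *)

Definition circle_pt r t : H := sp (r * cos t) (r * sin t).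

Lemma circle_pt_slice r t : slice I (circle_pt r t).
Proof. exact: sp_slice. Qed.

Lemma circle_pt_norm r t : 0 <= r -> `|circle_pt r t| = r.
Proof.
move=> r0; apply/eqP; rewrite -(eqrXn2 (n := 2))// qnorm_sqr qsqnorm_slice_point//.
by rewrite !exprMn -mulrDr cos2Dsin2 mulr1.
Qed.

Lemma circle_pt_exp r t : 0 < r -> circle_pt r t = qexp (sp (ln r) t).
Proof. by move=> r0; rewrite qexp_sp lnK ?posrE. Qed.

Definition circ r K : H := qint 0 (2 * pi) (fun t => K (circle_pt r t)).

Definition cont_at K z := K w @[w --> slice_nbhs I z] --> K z.

Lemma circle_cont r K : (forall z, slice I z -> `|z| = r -> cont_at K z) -> 0 <= r ->
  cont_seg 0 (2 * pi) (fun t => K (circle_pt r t)).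
Proof.
move=> cK r0 t _; have := cK (circle_pt r t) (circle_pt_slice r t) (circle_pt_norm t r0).
apply: cvg_comp; apply: sp_cvg; apply: cvgM; try exact: cvg_cst.
  exact: continuous_cos.
exact: continuous_sin.
Qed.

Lemma pi2_ge0 : 0 <= 2 * pi :> R.
Proof. by rewrite mulr_ge0// pi_ge0. Qed.

(** The two preimages under the exponential of a point of the slice within a strip
    of height [2 pi]. *)
Definition lifts w : seq (R * R) :=
  [:: (ln `|w|, acos (q0 w / `|w|)); (ln `|w|, 2 * pi - acos (q0 w / `|w|))].

Lemma lifts_mem s t : 0 <= t <= 2 * pi -> (s, t) \in lifts (qexp (sp s t)).
Proof.
move=> /andP[t0 t2].
have es : expR s = `|qexp (sp s t)|.
  by rewrite qexp_sp -/(circle_pt _ t) circle_pt_norm// expR_ge0.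
rewrite /lifts -es expRK {1 2}qexp_sp q0_slice_point//.
rewrite mulrAC divff ?mul1r ?gt_eqF ?expR_gt0// !inE !xpair_eqE eqxx /=.
have [tpi|tpi] := leP t pi; first by rewrite cosK ?in_itv /= ?t0 ?eqxx.
have -> : cos t = cos (2 * pi - t).
  by rewrite cosB mulr_natl cos2pi sin2pi mul1r mul0r addr0.
rewrite cosK; last by rewrite in_itv /=; apply/andP; split; lra.
by apply/orP; right; apply/eqP; ring.
Qed.

(** Integrals over concentric circles agree: in polar coordinates they are the vertical
    sides of a rectangle whose horizontal sides cancel by periodicity. *)
Lemma circ_const K w0 r r1 r2 : 0 < r1 -> r1 < r2 -> r2 < r ->
  (forall z, slice I z -> 0 < `|z| < r -> cont_at K z) ->
  (forall z, slice I z -> 0 < `|z| < r -> z != w0 -> sdiff I K z) ->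
  circ r1 K = circ r2 K.
Proof.
move=> r10 r12 r2r cK dK.
have r20 := lt_trans r10 r12.
pose K' w := K (qexp w).
have nrm s t : ln r1 <= s <= ln r2 -> 0 < `|qexp (sp s t)| < r.
  move=> /andP[h1 h2]; rewrite qexp_sp -/(circle_pt _ t) circle_pt_norm ?expR_ge0//.
  rewrite expR_gt0 (le_lt_trans _ r2r)// -[leRHS]lnK ?posrE// ler_expR//.
have cK' : cont_rect I K' (ln r1) (ln r2) 0 (2 * pi).
  move=> s t sb tb; apply: (cvg_comp qexp K); last first.
    exact: (cK _ (qexp_slice _) (nrm s t sb)).
  have := sdiff_cvg (sdiff_qexp (sp_slice I s t)).
  move=> h A /= /h; rewrite /nbhs /= => hA; near=> w.
  by apply: (near hA w) => //; exact: qexp_slice.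
have l12 : ln r1 < ln r2 by rewrite ltr_ln.
have p0 : 0 < 2 * pi :> R by rewrite mulr_gt0// pi_gt0.
have := goursat hI (e := lifts w0) l12 p0 cK'.
have dK' s t : ln r1 <= s <= ln r2 -> 0 <= t <= 2 * pi -> (s, t) \notin lifts w0 -> sdiff I K' (sp s t).
  move=> sb tb stn; apply: sdiff_comp (sdiff_qexp (sp_slice I s t)) _.
  - exact: sp_slice.
  - by move=> w _; exact: qexp_slice.
  apply: dK (nrm s t sb) _; first exact: qexp_slice.
  by apply: contraNneq stn => <-; exact: lifts_mem.
move=> /(_ dK'); rewrite /boundary_int.
rewrite (@eq_qint _ _ _ _ (fun=> 0)); last first.
  move=> s sb; rewrite /K' !qexp_sp sin0 cos0 mulr_natl sin2pi cos2pi subrr//.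
rewrite qint_cst ?(ltW l12)// scaler0 add0r => /qmul_eq0[I0|].
  by have := qnorm_unit hI; rewrite I0 normr0 => /eqP; rewrite eq_sym oner_eq0.
rewrite qintB.
- move=> /eqP; rewrite subr_eq0 => /eqP h.
  rewrite /circ; transitivity (qint 0 (2 * pi) (fun t => K' (sp (ln r1) t))).
    by apply: eq_qint => t _; rewrite circle_pt_exp.
  by rewrite -h; apply: eq_qint => t _; rewrite circle_pt_exp.
- by apply: (cont_rect_snd hI cK'); rewrite lexx ltW.
- by apply: (cont_rect_snd hI cK'); rewrite lexx ltW.
Unshelve. all: by end_near. Qed.

Lemma circ_eq K w0 r r1 r2 : 0 < r1 < r -> 0 < r2 < r ->
  (forall z, slice I z -> 0 < `|z| < r -> cont_at K z) ->
  (forall z, slice I z -> 0 < `|z| < r -> z != w0 -> sdiff I K z) ->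
  circ r1 K = circ r2 K.
Proof.
move=> /andP[r10 r1r] /andP[r20 r2r] cK dK; have [h|h|->//] := ltgtP r1 r2.
  exact: (circ_const r10 h r2r cK dK).
by rewrite (circ_const r20 h r1r cK dK).
Qed.

Lemma sdiff_pow_inv n z : slice I z -> z != 0 -> sdiff I (fun w => w^-1 ^+ n) z.
Proof.
move=> Iz z0; elim: n => [|n ih]; first exact: sdiff_cst.
rewrite (_ : (fun w => _) = (fun w => w^-1 * w^-1 ^+ n)); last first.
  by apply/funext => w; rewrite exprS.
apply: (sdiffM hI Iz) ih => [w Iw|]; first exact: sliceV.
by apply: (sdiffV hI Iz) => //; exact: sdiff_id.
Qed.

(** Integrals over the circles of radius [r] and [2 * r] agree, but the second one is
    the first one multiplied by [2 ^ (- (n + 1))]. *)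
Lemma circ_pow r n : 0 < r -> circ r (fun z => z^-1 ^+ n.+1) = 0.
Proof.
move=> r0; set K := fun z => _.
have scal (k : R) t : 0 < k -> K (circle_pt (k * r) t) = k^-1 ^+ n.+1 *: K (circle_pt r t).
  move=> k0; rewrite /K (_ : circle_pt (k * r) t = k *: circle_pt r t); last first.
    by rewrite /circle_pt slice_pointZ !mulrA.
  have p0 : circle_pt r t != 0 by rewrite -normr_gt0 circle_pt_norm// ltW.
  move: p0; move: (circle_pt r t) => p p0.
  have kp0 : k *: p != 0 by rewrite scaler_eq0 negb_or gt_eqF.
  have -> : (k *: p)^-1 = k^-1 *: p^-1.
    apply: (mulrI (x := k *: p)); first by rewrite qunitE.
    by rewrite mulrV ?qunitE// -scalerAl -scalerAr scalerA mulfV ?gt_eqF// scale1r mulrV ?qunitE.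
  by rewrite exprZn.
have cK k : 0 < k -> cont_seg 0 (2 * pi) (fun t => K (circle_pt k t)).
  move=> k0; apply: circle_cont (ltW k0) => z Iz zk; apply: sdiff_cvg.
  by apply: sdiff_pow_inv => //; rewrite -normr_eq0 zk gt_eqF.
have E : circ r K = circ (2 * r) K.
  apply: (@circ_eq K 0 (3 * r)); try by apply/andP; split; lra.
    move=> z Iz /andP[z0 _]; apply: sdiff_cvg; apply: sdiff_pow_inv => //.
    by rewrite -normr_gt0.
  move=> z Iz /andP[z0 _] _; apply: sdiff_pow_inv => //.
  by rewrite -normr_gt0.
clearbody K.
have E2 : circ (2 * r) K = (2^-1 ^+ n.+1)%:A * circ r K.
  rewrite /circ -qintMl; last exact: cK.
  by apply: eq_qint => t _; rewrite (scal 2)// -scalerAl mul1r.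
have : (1 - 2^-1 ^+ n.+1)%:A * circ r K = 0.
  by rewrite scalerBl scale1r mulrBl mul1r -E2 -E subrr.
move=> /qmul_eq0[|//] /eqP; rewrite scaler_eq0 oner_eq0 orbF subr_eq0 => /eqP h.
have : (2^-1 : R) ^+ n.+1 < 1 by rewrite exprn_ilt1// ?invr_ge0// invf_lt1// ltr1n.
by rewrite -h ltxx.
Qed.

End Cauchy.

Section CauchySeries.
Variable R : realType.
Local Notation H := (quat R).
Variables (I : H) (F : H -> H) (r : R).
Hypothesis hI : imaginary_units I.
Hypothesis r0 : 0 < r.
Hypothesis dF : forall z, slice I z -> `|z| < r -> sdiff I F z.
Implicit Types (w z : H) (s t M : R).

Local Notation circ := (circ I).
Local Notation circle_pt := (circle_pt I).
Local Notation cont_at := (cont_at I).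

Lemma circle_bounded K s : (forall z, slice I z -> `|z| = s -> cont_at K z) -> 0 <= s ->
  exists2 M, 0 <= M & forall t, 0 <= t <= 2 * pi -> `|K (circle_pt s t)| <= M.
Proof.
move=> cK s0; have c := circle_cont hI cK s0.
have [||t0 _ ht] := @EVT_max R (fun t => `|K (circle_pt s t)|) 0 (2 * pi).
- exact: pi2_ge0.
- apply: continuous_in_subspaceT => t; rewrite inE /= in_itv /= => tb.
  by apply: cvg_norm; exact: c.
by exists `|K (circle_pt s t0)| => // t tb; apply: ht; rewrite in_itv.
Qed.

Lemma circ_norm K s M : (forall z, slice I z -> `|z| = s -> cont_at K z) -> 0 <= s ->
  (forall t, 0 <= t <= 2 * pi -> `|K (circle_pt s t)| <= M) -> `|circ s K| <= 8 * pi * M.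
Proof.
move=> cK s0 KM; have := qint_norm (pi2_ge0 R) (circle_cont hI cK s0) KM.
by rewrite subr0 -/(circ s K); lra.
Qed.

Let powF n z := z^-1 ^+ n * F z.

Lemma sdiff_powF n z : slice I z -> 0 < `|z| < r -> sdiff I (powF n) z.
Proof.
move=> Iz /andP[z0 zr]; apply: (sdiffM hI Iz).
- by move=> w Iw; apply: sliceX => //; exact: sliceV.
- by apply: sdiff_pow_inv => //; rewrite -normr_gt0.
- exact: dF.
Qed.

Definition cauchy_coef n : H := (2 * pi)^-1 *: circ (r / 2) (powF n).

(** By [circ_eq] the radius of the circle does not matter. *)
Lemma cauchy_coefE n s : 0 < s < r -> cauchy_coef n = (2 * pi)^-1 *: circ s (powF n).
Proof.
move=> sr; congr (_ *: _); apply: (circ_eq (w0 := 0) hI _ sr).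
- by apply/andP; split; lra.
- by move=> z Iz zr; apply: sdiff_cvg; exact: sdiff_powF.
- by move=> z Iz zr _; exact: sdiff_powF.
Qed.

Lemma cauchy_coef_le n s M : 0 < s < r -> (forall z, slice I z -> `|z| = s -> `|F z| <= M) ->
  `|cauchy_coef n| * s ^+ n <= 4 * M.
Proof.
move=> sr FM; have /andP[s0 s1] := sr; rewrite (cauchy_coefE n sr).
have p0 : 0 < pi :> R by exact: pi_gt0.
have h : `|circ s (powF n)| <= 8 * pi * (s^-1 ^+ n * M).
  apply: circ_norm (ltW s0) _ => [z Iz zs|t tb].
    by apply: sdiff_cvg; apply: sdiff_powF => //; rewrite zs.
  rewrite /powF qnormM qnormX qnormV (circle_pt_norm hI) ?(ltW s0)// ler_wpM2l//.
    by rewrite exprn_ge0// invr_ge0 ltW.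
  by apply: FM; [exact: circle_pt_slice|rewrite (circle_pt_norm hI)// ltW].
rewrite normrZ ger0_norm ?invr_ge0 ?pi2_ge0//.
apply: (@le_trans _ _ ((2 * pi)^-1 * (8 * pi * (s^-1 ^+ n * M)) * s ^+ n)).
  by rewrite ler_wpM2r ?exprn_ge0 ?(ltW s0)// ler_wpM2l// invr_ge0 pi2_ge0.
rewrite le_eqVlt; apply/orP; left; apply/eqP.
have sn0 : s ^+ n != 0 by rewrite expf_neq0// gt_eqF.
rewrite exprVn; move: p0; move: (pi : R) => P p0; field.
by rewrite sn0 gt_eqF.
Qed.

Section Expansion.
Variable w : H.
Hypothesis Iw : slice I w.
Hypothesis wr : `|w| < r.
Variable Phi : H -> H.
Hypothesis cPhi : Phi z @[z --> slice_nbhs I w] --> Phi w.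
Hypothesis PhiE : \forall z \near slice_nbhs I w, F z = F w + (z - w) * Phi z.

Let Q z := if z == w then Phi w else (z - w)^-1 * (F z - F w).
Let K z := z * Q z.

Lemma Q_sdiff z : slice I z -> `|z| < r -> z != w -> sdiff I Q z.
Proof.
move=> Iz zr zw.
apply: (@sdiff_near _ _ (fun z => (z - w)^-1 * (F z - F w))) => //.
  have zw0 : 0 < `|z - w| by rewrite normr_gt0 subr_eq0.
  apply/sn_near0; exists `|z - w| => // u Iu uz; rewrite /Q.
  by case: ifPn uz => // /eqP ->; rewrite distrC ltxx.
have Isub u : slice I u -> slice I (u - w) by move=> Iu; exact: sliceB.
have dsub : sdiff I (fun u => u - w) z.
  by apply: sdiffD; [exact: sdiff_id|exact: sdiff_cst].
apply: (sdiffM hI Iz).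
- by move=> u Iu; apply: sliceV => //; exact: Isub.
- by apply: (sdiffV hI Iz) => //; rewrite subr_eq0.
- by apply: sdiffD; [exact: dF|exact: sdiff_cst].
Qed.

Lemma Q_cont z : slice I z -> `|z| < r -> cont_at Q z.
Proof.
move=> Iz zr; have [->|zw] := eqVneq z w; last exact/sdiff_cvg/Q_sdiff.
rewrite /cont_at {2}/Q eqxx; apply: cvg_near_eq cPhi.
near=> u; rewrite /Q; case: ifPn => [/eqP ->//|uw].
have -> : F u = F w + (u - w) * Phi u by near: u.
by rewrite (addrC (F w)) addrK mulKr ?qunitE// subr_eq0.
Unshelve. all: by end_near. Qed.

Lemma K_cont z : slice I z -> `|z| < r -> cont_at K z.
Proof.
by move=> Iz zr; apply: cvg_qM; [exact: cvg_sn_id|exact: Q_cont].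
Qed.

(** [K] is slice differentiable except at [w], where it is continuous, so that its
    circular integrals do not depend on the radius; the one over a circle of radius [t]
    is of order [t], because of the factor [z] of [K]. *)
Lemma circ_K0 s : 0 < s < r -> circ s K = 0.
Proof.
move=> sr; apply/eqP; rewrite -normr_eq0; apply/negPn/negP => n0.
set C := circ s K in n0.
have CE t : 0 < t < r -> circ t K = C.
  move=> tr; apply: (circ_eq (w0 := w) hI tr sr).
  - by move=> z Iz /andP[_ zr]; exact: K_cont.
  - move=> z Iz /andP[_ zr] zw; apply: (sdiffM hI Iz) => //; first exact: sdiff_id.
    exact: Q_sdiff.
have Cp : 0 < `|C| by rewrite lt_def n0 normr_ge0.
have z0r : `|0 : H| < r by rewrite normr0.
have /cvgrPdist_le/(_ _ (@ltr01 R))/sn_near0[d d0 hd] := Q_cont (slice0 I) z0r.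
pose M := `|Q 0| + 1.
have M0 : 0 < M by rewrite ltr_wpDl.
have QM z : slice I z -> `|z| < d -> `|Q z| <= M.
  move=> Iz zd; have := hd z Iz; rewrite subr0 => /(_ zd) h.
  have -> : Q z = Q 0 - (Q 0 - Q z) by rewrite opprB addrC subrK.
  by rewrite (le_trans (ler_normB _ _))// lerD.
have p0 : 0 < pi :> R by exact: pi_gt0.
have pM : 0 < 8 * pi * M by rewrite !mulr_gt0.
pose t := Num.min (Num.min (d / 2) (r / 2)) (`|C| / (2 * (8 * pi * M))).
have t0 : 0 < t by rewrite !lt_min !divr_gt0// mulr_gt0.
have td : t < d.
  by rewrite /t !gt_min; apply/orP; left; apply/orP; left; lra.
have tr : t < r.
  by rewrite /t !gt_min; apply/orP; left; apply/orP; right; lra.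
have tC : t <= `|C| / (2 * (8 * pi * M)) by rewrite /t ge_min lexx orbT.
have : `|circ t K| <= 8 * pi * (t * M).
  apply: circ_norm (ltW t0) _ => [z Iz zt|u _].
    by apply: K_cont => //; rewrite zt.
  rewrite /K qnormM (circle_pt_norm hI) ?(ltW t0)// ler_wpM2l ?(ltW t0)//.
  by apply: QM; [exact: circle_pt_slice|rewrite (circle_pt_norm hI)// ltW].
rewrite CE ?t0// => h.
have : 8 * pi * (t * M) <= `|C| / 2.
  rewrite (_ : 8 * pi * (t * M) = t * (8 * pi * M)); last by ring.
  move: tC pM; move: (8 * pi * M) => X tC X0.
  rewrite ler_pdivlMr ?mulr_gt0// in tC.
  rewrite ler_pdivlMr//; have -> : t * X * 2 = t * (2 * X) by ring.
  by [].
lra.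
Qed.

(** The geometric series of the Cauchy kernel, with remainder: the step from [N] to
    [N + 1] is [K z = (F z - F w) + w * (z^-1 * K z)]. *)
Lemma circ_K_expand s N : 0 < s < r -> circ s K =
  \sum_(0 <= n < N) w ^+ n * (circ s (powF n) - circ s (fun z => z^-1 ^+ n) * F w)
  + w ^+ N * circ s (fun z => z^-1 ^+ N * K z).
Proof.
move=> /andP[s0 sr].
have cp n : cont_seg 0 (2 * pi) (fun t => (circle_pt s t)^-1 ^+ n).
  apply: (circle_cont hI (K := fun z => z^-1 ^+ n)) (ltW s0) => z Iz zs.
  by apply: sdiff_cvg; apply: sdiff_pow_inv => //; rewrite -normr_eq0 zs gt_eqF.
have cF n : cont_seg 0 (2 * pi) (fun t => powF n (circle_pt s t)).
  apply: (circle_cont hI (K := powF n)) (ltW s0) => z Iz zs.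
  by apply: sdiff_cvg; apply: sdiff_powF => //; rewrite zs s0.
have cK : cont_seg 0 (2 * pi) (fun t => K (circle_pt s t)).
  apply: (circle_cont hI (K := K)) (ltW s0) => z Iz zs.
  by apply: K_cont => //; rewrite zs.
elim: N => [|N ->].
  rewrite big_geq// add0r expr0 mul1r; apply: eq_qint => t _.
  by rewrite expr0 mul1r.
rewrite big_nat_recr//= -addrA; congr (_ + _).
rewrite exprSr -mulrA -mulrDr; congr (_ * _).
have cN : cont_seg 0 (2 * pi) (fun t => (circle_pt s t)^-1 ^+ N.+1 * K (circle_pt s t)).
  exact: cont_segM.
rewrite {4}/circ -(qintMl w cN) {3}/circ -(qintMr (F w) (cp N)) {2}/circ -qintB//; last first.
  by apply: cont_segM => //; exact: cont_seg_cst.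
rewrite -qintD; last 2 first.
- apply: cont_segD => //; apply: cont_segN; apply: cont_segM => //; exact: cont_seg_cst.
- by apply: cont_segM => //; exact: cont_seg_cst.
apply: eq_qint => t _; set z := circle_pt s t.
have Iz : slice I z by exact: circle_pt_slice.
have zs : `|z| = s by rewrite (circle_pt_norm hI)// ltW.
have z0 : z != 0 by rewrite -normr_gt0 zs.
have Iv : slice I (z^-1) by exact: sliceV.
have KE : K z = (F z - F w) + w * (z^-1 * K z).
  rewrite /K mulKr ?qunitE// -[z * Q z](subrK (w * Q z)) -mulrBl; congr (_ + _).
  rewrite /Q; case: ifPn => [/eqP ->|zw]; first by rewrite !subrr mul0r.
  by rewrite mulVKr ?qunitE// subr_eq0.
rewrite /powF {1}KE mulrDr mulrBr; congr (_ + _).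
by rewrite exprSr !mulrA (sliceC hI Iw (sliceX N hI Iv)).
Qed.

(** [circ s K = 0] is Cauchy's formula at [w]: expanding it by [circ_K_expand], the
    integrals of [z ^ (- n)] vanish for positive [n], and the remainder is bounded by a
    multiple of [(|w| / s) ^ N]. *)
Lemma cauchy_is_sum : is_sum cauchy_coef w (F w).
Proof.
pose s : R := (`|w| + r) / 2.
have ws : `|w| < s by have := wr; rewrite /s; lra.
have sr : s < r by have := wr; rewrite /s; lra.
have s0 : 0 < s by exact: le_lt_trans ws.
have ssr : 0 < s < r by rewrite s0.
have p0 : 0 < 2 * pi :> R by rewrite mulr_gt0// pi_gt0.
have cK z : slice I z -> `|z| = s -> cont_at K z by move=> Iz zs; apply: K_cont => //; rewrite zs.
have [M M0 hM] := circle_bounded cK (ltW s0).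
pose rem N := (2 * pi)^-1 *: (w ^+ N * circ s (fun z => z^-1 ^+ N * K z)).
have remB N : `|rem N| <= 4 * M * (`|w| / s) ^+ N.
  have h : `|circ s (fun z => z^-1 ^+ N * K z)| <= 8 * pi * (s^-1 ^+ N * M).
    apply: circ_norm (ltW s0) _ => [z Iz zs|t tb].
      apply: cvg_qM; last exact: cK.
      by apply: sdiff_cvg; apply: sdiff_pow_inv => //; rewrite -normr_eq0 zs gt_eqF.
    rewrite qnormM qnormX qnormV (circle_pt_norm hI) ?(ltW s0)// ler_wpM2l//.
      by rewrite exprn_ge0// invr_ge0 ltW.
    exact: hM.
  rewrite /rem normrZ qnormM qnormX ger0_norm ?invr_ge0 ?(ltW p0)//.
  apply: (@le_trans _ _ ((2 * pi)^-1 * (`|w| ^+ N * (8 * pi * (s^-1 ^+ N * M))))).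
    by rewrite ler_wpM2l ?invr_ge0 ?(ltW p0)// ler_wpM2l// exprn_ge0.
  rewrite le_eqVlt; apply/orP; left; apply/eqP; rewrite exprMn.
  have := pi_gt0 R; move: (pi : R) => P P0; rewrite !exprVn; field.
  by rewrite !gt_eqF// exprn_gt0.
have E N : series (power_series_term cauchy_coef w) N.+1 = F w - rem N.+1.
  have := circ_K_expand N.+1 ssr; rewrite circ_K0// => /(congr1 (fun q : H => (2 * pi)^-1 *: q)).
  rewrite scaler0 scalerDr -/(rem N.+1) => /esym/eqP; rewrite addr_eq0 => /eqP h.
  rewrite -[RHS]addrC -h seriesEnat /= scaler_sumr.
  rewrite !big_nat_recl//= !expr0 !mul1r -addrA addrC -addrA.
  rewrite (_ : circ s (fun z => z^-1 ^+ 0) = (2 * pi)%:A); last first.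
    rewrite /circ (@eq_qint _ _ _ _ (fun=> 1)); last by move=> t _; rewrite expr0.
    by rewrite qint_cst ?(ltW p0)// subr0.
  rewrite scalerBr -(cauchy_coefE 0 ssr) -scalerAl mul1r scalerA mulVf ?gt_eqF// scale1r.
  rewrite (addrC (F w)) subrK [LHS]addrC /power_series_term expr0 mul1r; congr (_ + _).
  apply: eq_big_nat => n _.
  by rewrite circ_pow// mul0r subr0 scalerAr -cauchy_coefE.
rewrite /is_sum -cvg_shiftS.
apply: (@cvg_near_eq R _ _ _ (fun n => F w - rem n.+1)).
  by apply: nearW => n; exact: E.
suff h : (fun n => rem n.+1) @ \oo --> (0 : H).
  by have := cvgB (cvg_cst (F w)) h; rewrite subr0; exact.
apply/cvgrPdist_le => e e0; near=> n; rewrite sub0r normrN (le_trans (remB _))//.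
near: n.
have h : (fun n => 4 * M * (`|w| / s) ^+ n.+1) @ \oo --> (0 : R).
  rewrite -(mulr0 (4 * M)); apply: cvgM; first exact: cvg_cst.
  rewrite (cvg_shiftS (fun n => (`|w| / s) ^+ n)); apply: cvg_expr.
  have ws0 : 0 <= `|w| / s by rewrite divr_ge0// ltW.
  by rewrite (ger0_norm ws0) ltr_pdivrMr// mul1r.
move/cvgrPdist_le : h => /(_ _ e0); apply: filterS => n.
by rewrite sub0r normrN; exact: le_trans (ler_norm _).
Unshelve. all: by end_near. Qed.

End Expansion.

(** Slice differentiable functions on a disc are sums of power series.  Only the values
    of [F] on the slice enter, and the coefficients are placed on the right. *)
Theorem cauchy_slice : exists a : fps R, [/\ conv_on r a,
  forall z, slice I z -> `|z| < r -> power_sum a z = F z &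
  forall n s M, 0 < s < r -> (forall z, slice I z -> `|z| = s -> `|F z| <= M) ->
    `|a n| * s ^+ n <= 4 * M].
Proof.
exists cauchy_coef; split; last exact: cauchy_coef_le.
- move=> s s0 sr; pose t := (s + r) / 2.
  have st : s < t by rewrite /t; lra.
  have tr : t < r by rewrite /t; lra.
  have t0 : 0 < t by exact: le_lt_trans st.
  have [z Iz zt|M M0 hM] := @circle_bounded F t _ (ltW t0).
    by apply: sdiff_cvg; apply: dF => //; rewrite zt.
  have p0 : 0 < pi :> R by exact: pi_gt0.
  have h n : `|circ t (powF n)| <= 8 * pi * (t^-1 ^+ n * M).
    apply: circ_norm (ltW t0) _ => [z Iz zs|u tb].
      by apply: sdiff_cvg; apply: sdiff_powF => //; rewrite zs t0.
    rewrite /powF qnormM qnormX qnormV (circle_pt_norm hI) ?(ltW t0)// ler_wpM2l//.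
      by rewrite exprn_ge0// invr_ge0 ltW.
    exact: hM.
  exists (4 * M) => n; rewrite (cauchy_coefE n (s := t)) ?t0// normrZ ger0_norm ?invr_ge0 ?pi2_ge0//.
  apply: (@le_trans _ _ ((2 * pi)^-1 * (8 * pi * (t^-1 ^+ n * M)) * t ^+ n)).
    apply: ler_pM; rewrite ?mulr_ge0 ?exprn_ge0 ?invr_ge0 ?pi2_ge0//.
      by rewrite ler_wpM2l// invr_ge0 pi2_ge0.
    by rewrite lerXn2r ?nnegrE// ltW.
  rewrite le_eqVlt; apply/orP; left; apply/eqP.
  have tn0 : t ^+ n != 0 by rewrite expf_neq0// gt_eqF.
  rewrite exprVn; move: p0; move: (pi : R) => P p0; field.
  by rewrite tn0 gt_eqF.
- move=> z Iz zr; have [Phi cPhi PhiE] := dF Iz zr.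
  by apply: is_sumE; exact: cauchy_is_sum cPhi PhiE.
Qed.

End CauchySeries.

(** * Real denominators *)

Section Denominators.
Variable R : realType.
Local Notation H := (quat R).
Implicit Types (l : seq (R * R)) (I q z w : H) (x y t : R) (Q : {poly R}).

(** The denominators of semiregular functions can be chosen to be products of real
    quadratic polynomials; they are encoded by lists of spheres. *)
Definition den l : {poly R} := \prod_(p <- l) delta p.1 p.2.

Lemma den_cons p l : den (p :: l) = delta p.1 p.2 * den l.
Proof. by rewrite /den big_cons. Qed.

Lemma den_cat l l' : den (l ++ l') = den l * den l'.
Proof. by rewrite /den big_cat. Qed.

Lemma den_nseq n x y : den (nseq n (x, y)) = delta x y ^+ n.
Proof. by elim: n => [|n ih]; [rewrite /den big_nil|rewrite /= den_cons ih exprS]. Qed.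

Lemma den_neq0 l : den l != 0.
Proof.
elim: l => [|p l ih]; first by rewrite /den big_nil oner_eq0.
by rewrite den_cons mulf_neq0// delta_neq0.
Qed.

Lemma cf_den_neq0 l : cf (den l) != 0.
Proof. by rewrite cf_eq0 den_neq0. Qed.

Lemma horner_alg_slice I q Q : imaginary_units I -> slice I q -> slice I (horner_alg q Q).
Proof.
move=> hI Iq; elim/poly_ind: Q => [|Q c ih]; first by rewrite rmorph0; exact: slice0.
rewrite rmorphD rmorphM /= horner_algX horner_algC.
by apply: sliceD; [exact: sliceM|exact: slice_real].
Qed.

Lemma horner_alg_sdiff I q Q : imaginary_units I -> slice I q ->
  sdiff I (fun w => horner_alg w Q) q.
Proof.
move=> hI Iq; have -> : (fun w => horner_alg w Q) = power_sum (cf Q).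
  by apply/funext => w; rewrite power_sum_cf.
apply: (@power_sum_sdiff _ (`|q| + 1)) => //; last by rewrite ltrDl.
exact: conv_cf.
Qed.

Lemma horner_alg_differentiable q Q : differentiable (fun w : H => horner_alg w Q) q.
Proof.
have -> : (fun w => horner_alg w Q) = power_sum (cf Q).
  by apply/funext => w; rewrite power_sum_cf.
apply: (@power_sum_differentiable _ (`|q| + 1)); first exact: conv_cf.
by rewrite ltrDl.
Qed.

(** On a slice each factor of a denominator is the product of two linear ones, with
    zeros at conjugate points. *)
Lemma den_near I q l : imaginary_units I -> slice I q ->
  exists2 d, 0 < d & forall z, slice I z -> 0 < `|z - q| < d -> horner_alg z (den l) != 0.
Proof.
move=> hI Iq; have pt (P : H) : exists2 d, 0 < d & forall z, 0 < `|z - q| < d -> z - P != 0.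
  have [->|Pq] := eqVneq P q.
    by exists 1 => // z /andP[]; rewrite normr_gt0.
  exists `|P - q| => [|z /andP[_]]; first by rewrite normr_gt0 subr_eq0.
  by apply: contraTneq => /eqP; rewrite subr_eq0 => /eqP ->; rewrite ltxx.
elim: l => [|p l [d d0 ih]].
  by exists 1 => // z _ _; rewrite /den big_nil rmorph1 oner_neq0.
have [d1 d10 h1] := pt (slice_point I p.1 p.2).
have [d2 d20 h2] := pt (slice_point I p.1 (- p.2)).
exists (Num.min d (Num.min d1 d2)) => [|z Iz /andP[zq]]; first by rewrite !lt_min d0 d10.
rewrite !lt_min => /andP[zd /andP[zd1 zd2]].
rewrite den_cons rmorphM /= horner_alg_delta (qDelta_factor _ _ hI Iz).
rewrite qmul_neq0//; last by apply: ih; rewrite ?zq.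
by rewrite qmul_neq0// ?h1 ?h2 ?zq.
Qed.

(** Real translations stay in the slice of [q].  This makes the points where a given
    denominator is invertible dense, without any choice of a slice. *)
Lemma den_near_real q l :
  exists2 d, 0 < d & forall t, 0 < `|t| < d -> horner_alg (q + t%:A) (den l) != 0.
Proof.
have [I [x [y [hI qE]]]] := slice_pointP q.
have Iq : slice I q by exists x, y.
have [d d0 h] := den_near l hI Iq; exists d => // t td; apply: h.
  by apply: sliceD => //; exact: slice_real.
by rewrite addrC addKr qnorm_real.
Qed.

(** Two quadratic factors either have the same zero sphere, and then are equal, or have
    disjoint ones. *)
Lemma den_split l x y : exists k l', den l = delta x y ^+ k * den l' /\
  forall q, sphere x y q -> horner_alg q (den l') != 0.
Proof.
elim: l => [|p l [k [l' [E h]]]].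
  by exists 0%N, [::]; split => [|q _]; rewrite /den big_nil ?expr0 ?mul1r// rmorph1 oner_neq0.
have [/andP[/eqP px /eqP py]|nxy] := boolP ((p.1 == x) && (p.2 ^+ 2 == y ^+ 2)).
  exists k.+1, l'; split => //; rewrite den_cons E exprS mulrA; congr (_ * _ * _).
  by rewrite /delta px py.
exists k, (p :: l'); split => [|q hq].
  by rewrite !den_cons E mulrCA.
rewrite den_cons rmorphM /= qmul_neq0//; last exact: h.
rewrite horner_alg_delta; apply/eqP => /qDelta_eq0 /sphereP[h1 h2].
move/sphereP : hq => [h3 h4]; move/negP : nxy; apply.
by rewrite -h1 -h2 h3 h4 !eqxx.
Qed.

(** All slices contain the real axis, so this identifies coefficients obtained in
    different slices. *)
Lemma fps_eq_real r (a b : fps R) d : conv_on r a -> conv_on r b -> 0 < r -> 0 < d ->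
  (forall t, 0 < t -> t < d -> t < r -> power_sum a t%:A = power_sum b t%:A) -> a = b.
Proof.
move=> ca cb r0 d0 h; apply/eqP; rewrite -subr_eq0; apply/eqP.
apply: (power_series_identity (conv_onD ca (conv_onN cb))) => e e0.
pose t := Num.min (Num.min d r) e / 2.
have m0 : 0 < Num.min (Num.min d r) e by rewrite !lt_min d0 r0.
have tm : t < Num.min (Num.min d r) e by rewrite /t; lra.
have t0 : 0 < t by rewrite divr_gt0.
move: tm; rewrite !lt_min => /andP[/andP[td tr] te].
exists t; split => //.
have tr' : `|t%:A : H| < r by rewrite qnorm_real gtr0_norm.
rewrite (is_sumE (is_sumD (conv_is_sum ca tr') (is_sumN (conv_is_sum cb tr')))).
by rewrite h// subrr.
Qed.

Lemma cauchy_estimate r (a : fps R) s M n : conv_on r a -> 0 < s < r ->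
  (forall z, `|z| = s -> `|power_sum a z| <= M) -> `|a n| * s ^+ n <= 4 * M.
Proof.
move=> ca /andP[s0 sr] aM; have r0 := lt_trans s0 sr.
have hI := unit_iP R.
have [z Iz zr|b [cb bE bM]] := @cauchy_slice R (unit_i R) (power_sum a) r hI r0.
  exact: power_sum_sdiff ca zr hI Iz.
have <- : b = a.
  apply: (fps_eq_real cb ca r0 r0) => t t0 tr _; apply: bE; first exact: slice_real.
  by rewrite qnorm_real gtr0_norm.
by apply: bM => [|z _]; [rewrite s0|exact: aM].
Qed.

End Denominators.

(** * Factorization along a sphere *)

Section Factorization.
Variable R : realType.
Local Notation H := (quat R).
Implicit Types (a b A G : fps R) (x y r s : R) (p q z : H).

Lemma fpsM_lt a b N k : (forall j, (j < N)%N -> b j = 0) -> (k < N)%N -> (a * b) k = 0.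
Proof.
move=> bN kN; rewrite fpsME big1// => i _; rewrite bN ?mulr0//.
by rewrite (leq_ltn_trans (leq_subr _ _)).
Qed.

Lemma cf_exp0 (Q : {poly R}) k : cf (Q ^+ k) 0%N = (Q`_0 ^+ k)%:A.
Proof. by rewrite /cf -!horner_coef0 horner_exp. Qed.

(** The reflection of [delta x y] in the circle of radius [s]: both polynomials have the
    same modulus on that circle, but the reflection has no zero inside it.  (Their
    quotient is a Blaschke product.) *)
Definition reflected_delta s x y : {poly R} :=
  (s ^+ 2)%:P - (2 * x) *: 'X + ((x ^+ 2 + y ^+ 2) / s ^+ 2) *: 'X^2.

Lemma reflected_delta_norm s x y z : 0 < s -> `|z| = s ->
  `|horner_alg z (reflected_delta s x y)| = `|horner_alg z (delta x y)|.
Proof.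
move=> s0 zs; set c := x ^+ 2 + y ^+ 2.
have zz : qsqnorm z = s ^+ 2 by rewrite -qnorm_sqr zs.
have hZ k (P : {poly R}) : horner_alg z (k *: P) = k *: horner_alg z P.
  by rewrite -mul_polyC rmorphM /= horner_algC -scalerAl mul1r.
have E1 : horner_alg z (delta x y) = z * z - (2 * x) *: z + c%:A.
  by rewrite deltaE rmorphD rmorphB /= hZ rmorphXn /= horner_algX horner_algC expr2.
have E2 : horner_alg z (reflected_delta s x y) = (s ^+ 2)%:A - (2 * x) *: z + (c / s ^+ 2) *: (z * z).
  rewrite /reflected_delta rmorphD rmorphB /= !hZ horner_algC rmorphXn /= horner_algX.
  by rewrite (expr2 z).
have s2 : s ^+ 2 != 0 by rewrite expf_neq0// gt_eqF.
have E : s ^+ 2 *: horner_alg z (reflected_delta s x y) = z * z * qconj (horner_alg z (delta x y)).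
  rewrite E1 E2 scalerDr scalerA mulrCA divff// mulr1 -zz /qsqnorm.
  by apply: quatP => /=; ring.
have := congr1 (@Num.norm R H) E.
rewrite normrZ !qnormM qnorm_conj zs -expr2 ger0_norm ?exprn_ge0 ?ltW//.
exact: mulfI.
Qed.

(** A nonzero power series is divisible only finitely often by the polynomial of a
    sphere in its ball of convergence.  If [A = delta ^ k * G], then replacing [delta] by
    its reflection leaves the modulus on a circle unchanged, but multiplies the lowest
    coefficient by the k-th power of a number larger than 1; Cauchy's estimate
    bounds that coefficient. *)
Lemma multiplicity_bound r A x y : conv_on r A -> A != 0 -> 0 < r -> x ^+ 2 + y ^+ 2 < r ^+ 2 ->
  exists K : nat, forall k G, conv_on r G -> A = cf (delta x y ^+ k) * G -> (k <= K)%N.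
Proof.
move=> cA A0 r0 cr; set c := x ^+ 2 + y ^+ 2 in cr.
have [N AN Amin] := fps_neq0_low A0.
have c0 : 0 <= c by rewrite addr_ge0 ?sqr_ge0.
(* for [c = 0] the polynomial is X^2, and the lowest degree of [A] is a bound *)
have [c00|cn0] := eqVneq c 0.
  exists N => k G cG AE; rewrite leqNgt; apply/negP => Nk.
  move/eqP : AN; apply; rewrite AE fpsME big1// => i _.
  have -> : delta x y = 'X^2.
    move/eqP : c00; rewrite paddr_eq0 ?sqr_ge0// !sqrf_eq0 => /andP[/eqP -> /eqP ->].
    by rewrite /delta subr0 expr0n /= addr0.
  rewrite /cf -exprM coefXn; case: eqP => [iE|]; last by rewrite scale0r mul0r.
  by exfalso; move: (ltn_ord i); rewrite iE ltnNge (leq_trans Nk)// mul2n -addnn leq_addr.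
have cp : 0 < c by rewrite lt_def cn0.
pose s := (Num.sqrt c + r) / 2.
have sc : Num.sqrt c < r by rewrite -(ltr_pXn2r (n := 2)) ?nnegrE ?sqrtr_ge0 ?(ltW r0)// sqr_sqrtr.
have cs : Num.sqrt c < s by rewrite /s; lra.
have sr : s < r by rewrite /s; lra.
have s0 : 0 < s by apply: le_lt_trans cs; rewrite sqrtr_ge0.
clearbody s.
have cs2 : c < s ^+ 2 by rewrite -[c]sqr_sqrtr// ltr_pXn2r// ?nnegrE ?sqrtr_ge0// ltW.
have [M M0 hM] := power_sum_bounded cA (ltW s0) sr.
(* the ratio of the constant coefficients of [delta x y] and of its reflection *)
pose t := c / s ^+ 2.
have s2 : 0 < s ^+ 2 by rewrite exprn_gt0.
have t0 : 0 < t by rewrite divr_gt0.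
have t1 : t < 1 by rewrite ltr_pdivrMr// mul1r.
pose a := `|A N| * s ^+ N.
have a0 : 0 < a by rewrite mulr_gt0 ?normr_gt0 ?exprn_gt0.
pose C := (1 - t)^-1 * (4 * M / a).
exists (Num.bound C) => k G cG AE.
have C0 : 0 <= C by rewrite mulr_ge0 ?invr_ge0 ?subr_ge0 ?(ltW t1)// divr_ge0 ?(ltW a0)// mulr_ge0.
suff kC : k%:R <= C.
  by rewrite -(ler_nat R) (le_trans kC)// ltW// archi_boundP.
have G0 : G != 0 by apply: contraNneq A0 => G0; rewrite AE G0 mulr0.
have [N' GN' Gmin] := fps_neq0_low G0.
have d0 : (delta x y)`_0 = c by rewrite deltaE !coefE /= mulr0 subr0 add0r.
have AN' : A N' = c ^+ k *: G N'.
  rewrite AE -[N']add0n fpsM_low// cf_exp0 d0 add0n.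
  by rewrite -scalerAl mul1r.
have NN' : N = N'.
  apply/eqP; rewrite eqn_leq; apply/andP; split; rewrite leqNgt; apply/negP.
    by move=> /Amin/eqP; rewrite AN' scaler_eq0 expf_eq0 (negbTE cn0) andbF /= (negbTE GN').
  move=> h; move/eqP : AN; apply; rewrite AE.
  exact: fpsM_lt Gmin h.
subst N'.
pose F := cf (reflected_delta s x y ^+ k) * G.
have cF : conv_on r F by apply: conv_onM => //; exact: conv_cf.
have FM z : `|z| = s -> `|power_sum F z| <= M.
  move=> zs; have zr : `|z| < r by rewrite zs.
  have -> : `|power_sum F z| = `|power_sum A z|.
    rewrite AE !(power_sum_cfM _ cG zr) !qnormM !rmorphXn /= !qnormX.
    by rewrite reflected_delta_norm.
  by apply: hM; rewrite zs.
have FN : F N = s ^+ 2 ^+ k *: G N.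
  rewrite /F -[N]add0n fpsM_low// cf_exp0 add0n.
  by rewrite /reflected_delta !coefE /= !mulr0 subr0 addr0 -scalerAl mul1r.
have := cauchy_estimate N cF _ FM; rewrite s0 sr => /(_ isT).
rewrite FN normrZ ger0_norm; last by rewrite !exprn_ge0 ?ltW.
have aE : a = c ^+ k * (`|G N| * s ^+ N).
  by rewrite /a AN' normrZ ger0_norm ?exprn_ge0// mulrA.
have -> : s ^+ 2 ^+ k * `|G N| * s ^+ N = a / t ^+ k.
  have ck0 : c ^+ k != 0 by rewrite expf_neq0.
  rewrite aE /t expr_div_n invf_div.
  by move: (s ^+ N) `|G N| (s ^+ 2 ^+ k) (c ^+ k) ck0 => u v S' Ck Ck0; field.
move=> h; have nt := nexp_le k (ltW t0) t1.
rewrite /C; apply: le_trans (_ : (1 - t)^-1 * (t ^- k) <= _); last first.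
  rewrite ler_wpM2l ?invr_ge0 ?subr_ge0 ?(ltW t1)//.
  by rewrite ler_pdivlMr// mulrC.
by rewrite ler_pdivlMr ?exprn_gt0.
Qed.

Lemma prod_linear_conv r n (p : nat -> H) : conv_on r (\prod_(1 <= i < n.+1) fps_linear (p i)).
Proof.
elim: n => [|n ih]; first by rewrite big_geq//; exact: conv_on1.
by rewrite big_nat_recr//=; apply: conv_onM => //; exact: conv_linear.
Qed.

(** In [P * P^c] the inner pair of factors is [delta], which is central and can be
    pulled out. *)
Lemma prod_linear_conj n (p : nat -> H) x y :
  (forall i, (1 <= i <= n)%N -> sphere x y (p i)) ->
  let P := \prod_(1 <= i < n.+1) fps_linear (p i) in P * fconj P = cf (delta x y ^+ n).
Proof.
elim: n => [|n ih] hp /=.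
  rewrite big_geq// mul1r expr0 cf1 real_coef_fconj// => -[|k].
    by exists 1; rewrite scale1r.
  by exists 0; rewrite scale0r.
rewrite big_nat_recr//= fconjM mulrA -(mulrA _ (fps_linear _)).
rewrite (fps_linear_conj (hp _ _)) ?leqnn// -cf_comm -mulrA ih; last first.
  by move=> i /andP[i1 iN]; apply: hp; rewrite i1 leqW.
by rewrite -cfM exprS.
Qed.

Lemma fconj_linear p : fconj (fps_linear p) = fps_linear (qconj p).
Proof.
by apply/funext => -[|[|n]]; rewrite /fconj /reg_conj /=; apply: quatP => /=; ring.
Qed.

Lemma sphere_conj x y p : sphere x y p -> sphere x y (qconj p).
Proof. by move=> /sphereP[h1 h2]; apply/sphereP; split=> //; rewrite -h2 /imsq /= !sqrrN. Qed.

Lemma max_nat_ex (P : nat -> Prop) (K : nat) : P 0%N -> (forall k, P k -> (k <= K)%N) ->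
  exists2 k, P k & forall j, P j -> (j <= k)%N.
Proof.
move=> P0 PK.
have ex : exists k, `[< P k >] by exists 0%N; apply/asboolP.
have ub k : `[< P k >] -> (k <= K)%N by move/asboolP; exact: PK.
case: (ex_maxnP ex ub) => k /asboolP Pk kmax.
by exists k => // j Pj; apply: kmax; apply/asboolP.
Qed.

(** Choose the exponent [k] of [delta] maximal, then the number [n] of linear factors.
    Both are bounded by [multiplicity_bound], the second because [P * G] has the
    symmetrization [delta ^ n] times that of [G].  If [G] vanished at a point [q] of the
    sphere, it would be left divisible by the linear factor of [q]; this factor extends
    [P], contradicting the choice of [n], unless [q] is the conjugate of the last [p n],
    in which case the two factors combine into [delta], contradicting the choice of [k]. *)
Lemma factor_sphere r A x y : conv_on r A -> A != 0 -> 0 < r -> x ^+ 2 + y ^+ 2 < r ^+ 2 ->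
  exists (k n : nat) (p : nat -> H) (G : fps R),
  [/\ conv_on r G, forall i, (1 <= i <= n)%N -> sphere x y (p i),
      forall i, (1 <= i < n)%N -> p i <> qconj (p i.+1),
      A = cf (delta x y ^+ k) * ((\prod_(1 <= i < n.+1) fps_linear (p i)) * G) &
      forall q, sphere x y q -> power_sum G q <> 0].
Proof.
move=> cA A0 r0 cr.
have [K hK] := multiplicity_bound cA A0 r0 cr.
have [||k [B cB AB] kmax] := @max_nat_ex (fun k => exists2 G, conv_on r G & A = cf (delta x y ^+ k) * G) K.
- by exists A => //; rewrite expr0 cf1 mul1r.
- by move=> k [G cG]; exact: hK.
have B0 : B != 0 by apply: contraNneq A0 => B0; rewrite AB B0 mulr0.
have cBs : conv_on r (B * fconj B) by apply: conv_onM => //; exact: conv_fconj.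
have Bs0 : B * fconj B != 0.
  apply: fpsM_neq0 => //; apply: contraNneq B0 => h.
  by rewrite -(fconjK B) h; apply/eqP/funext => n; rewrite /fconj /reg_conj /=; apply: quatP => /=; ring.
have [K' hK'] := multiplicity_bound cBs Bs0 r0 cr.
pose PN n := exists (p : nat -> H) G, [/\ conv_on r G,
  forall i, (1 <= i <= n)%N -> sphere x y (p i),
  forall i, (1 <= i < n)%N -> p i <> qconj (p i.+1) &
  B = (\prod_(1 <= i < n.+1) fps_linear (p i)) * G].
have [||n [p [G [cG ps pc BE]]] nmax] := @max_nat_ex PN K'.
- exists (fun=> 0), B; split => //; first by case.
    by move=> i /andP[].
  by rewrite big_geq// mul1r.
- move=> n [p [G [cG ps pc BE]]]; apply: (hK' n (G * fconj G)).
    by apply: conv_onM => //; exact: conv_fconj.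
  rewrite BE fconjM -mulrA [G * (_ * _)]mulrA (real_coef_comm _ (symmetrization_real G)).
  by rewrite mulrA (prod_linear_conj ps).
exists k, n, p, G; split => //; first by rewrite AB BE.
move=> q hq Gq0.
have qr : `|q| < r.
  rewrite -(ltr_pXn2r (n := 2)) ?nnegrE ?(ltW r0)// qnorm_sqr.
  have -> : qsqnorm q = q0 q ^+ 2 + imsq q by rewrite /qsqnorm /imsq; ring.
  by move/sphereP : hq => [-> ->].
have [G1 cG1 GE] := left_root_div cG qr Gq0.
(* the new factor either combines with the last one or prolongs the product *)
have [/andP[n1 /eqP pq]|npq] := boolP ((0 < n)%N && (p n == qconj q)).
  case: n => // n in ps pc BE nmax n1 pq *.
  have : (k.+1 <= k)%N.
    apply: kmax; exists ((\prod_(1 <= i < n.+1) fps_linear (p i)) * G1).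
      by apply: conv_onM => //; exact: prod_linear_conv.
    rewrite AB BE GE big_nat_recr//= exprSr cfM -!mulrA; congr (_ * _).
    have e : fps_linear (qconj q) * fps_linear q = cf (delta x y).
      by rewrite -(fps_linear_conj (sphere_conj hq)) fconj_linear qconjK.
    by rewrite (mulrA (fps_linear _) _ G1) pq e !mulrA cf_comm.
  by rewrite ltnn.
have : (n.+1 <= n)%N; last by rewrite ltnn.
apply: nmax; pose p' i := if i == n.+1 then q else p i.
exists p', G1; split => //.
- move=> i /andP[i1 iN]; rewrite /p'; case: eqP => // /eqP ine; apply: ps.
  by rewrite i1 -ltnS ltn_neqAle ine.
- move=> i /andP[i1]; rewrite ltnS => iN; rewrite /p' (ltn_eqF (_ : (i < n.+1)%N))// eqSS.
  case: eqP => [iE|/eqP ine].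
    subst i; move/negP : npq => h pE; apply: h; rewrite i1 pE; exact: eqxx.
  by apply: pc; rewrite i1 ltn_neqAle ine.
- have pq : p' n.+1 = q by rewrite /p' eqxx.
  have E : \prod_(1 <= i < n.+1) fps_linear (p' i) = \prod_(1 <= i < n.+1) fps_linear (p i).
    by apply: eq_big_nat => i /andP[i1 iN]; rewrite /p' (ltn_eqF iN).
  by rewrite BE GE mulrA [in RHS]big_nat_recr//= pq E.
Qed.

End Factorization.

(** * Semiregular functions as quotients *)

Section LocalLemmas.
Variable R : realType.
Local Notation H := (quat R).
Implicit Types (D S U : set H) (f u v : H -> H) (I p q z w : H) (r x y t : R).

Lemma qnbhsP q (A : set H) : nbhs q A <-> exists2 d, 0 < d & forall w, `|w - q| < d -> A w.
Proof.
split=> [/nbhs_ballP[d d0 h]|[d d0 h]].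
  by exists d => // w wq; apply: h; rewrite -ball_normE /= distrC.
by apply/nbhs_ballP; exists d => // w; rewrite -ball_normE /= distrC; exact: h.
Qed.

Lemma open_ball_sub q (A : set H) : open A -> A q ->
  exists2 d, 0 < d & forall w, `|w - q| < d -> A w.
Proof. by move=> oA Aq; apply/qnbhsP; exact: open_nbhs_nbhs. Qed.

(** The workhorse for identities between quotients: a denominator that vanishes at [q]
    is invertible at [q + t] for small real [t], where it can be cancelled. *)
Lemma eq_by_real u v q d : 0 < d -> differentiable u q -> differentiable v q ->
  (forall t, 0 < `|t| < d -> u (q + t%:A) = v (q + t%:A)) -> u q = v q.
Proof.
move=> d0 /differentiable_continuous cu /differentiable_continuous cv uv.
have tr : (q + t%:A) @[t --> (0 : R)^'] --> q.
  have : (q + t%:A) @[t --> (0 : R)^'] --> q + (0 : R)%:A.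
    apply: cvgD; first exact: cvg_cst.
    by apply: cvgZr_tmp; exact: cvg_within.
  by rewrite scale0r addr0.
have c1 := cvg_comp _ u tr cu; have c2 := cvg_comp _ v tr cv.
apply: (cvg_unique _ c1); first exact: norm_hausdorff.
apply: cvg_near_eq c2; near=> t => /=; apply: uv.
apply/andP; split; first by rewrite normr_gt0; near: t; exact: nbhs_dnbhs_neq.
near: t; apply: dnbhs0_lt => //.
Unshelve. all: by end_near. Qed.

Lemma regular_sdiff U f I q : regular_on U f -> U q -> imaginary_units I -> slice I q ->
  sdiff I f q.
Proof.
move=> [df dbf] Uq hI [x [y qE]]; subst q.
by apply: dbar_sdiff => //; [exact: df|exact: dbf].
Qed.

Lemma regular_onP U f : regular_on U f <->
  (forall q, U q -> differentiable f q) /\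
  (forall I q, imaginary_units I -> slice I q -> U q -> sdiff I f q).
Proof.
split=> [h|[h1 h2]].
  by split=> [q Uq|I q hI Iq Uq]; [exact: h.1|exact: (regular_sdiff h)].
split=> // I hI x y Uq; apply: sdiff_dbar => //; apply: h2 => //; by exists x, y.
Qed.

Lemma horner_cvg q (Q : {poly R}) : (fun w => horner_alg w Q) @ q --> horner_alg q Q.
Proof. exact/differentiable_continuous/horner_alg_differentiable. Qed.

Lemma horner_bounded (Q : {poly R}) r : 0 <= r -> exists2 B, 0 <= B &
  forall q : H, `|q| <= r -> `|horner_alg q Q| <= B.
Proof.
move=> r0; have r1 : r < r + 1 by rewrite ltrDl.
have [B B0 hB] := power_sum_bounded (@conv_cf R (r + 1) Q) r0 r1.
by exists B => // q qr; rewrite -power_sum_cf; exact: hB.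
Qed.

(** The power series obtained by multiplying a Laurent series by [u ^+ N]. *)
Definition laurent_unshift N (a : int -> H) : fps R :=
  fun m => if (m < N)%N then a (Negz (N - m.+1)) else a (Posz (m - N)).

(** A Laurent expansion with finite principal part is treated as a power series after
    multiplication by [(z - p) ^+ N]. *)
Lemma laurent_power_sum D f p a N I : laurent_at D f p a -> principal_part_le a N ->
  imaginary_units I -> slice I p ->
  exists r, [/\ 0 < r, conv_on r (laurent_unshift N a) &
    forall z, slice I z -> 0 < `|z - p| < r ->
      D z /\ (z - p) ^+ N * f z = power_sum (laurent_unshift N a) (z - p)].
Proof.
move=> La aN hI Ip; have [r r0 hr] := La I hI Ip; set c := laurent_unshift N a.
have sums z : slice I z -> 0 < `|z - p| < r -> is_sum c (z - p) ((z - p) ^+ N * f z).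
  move=> Iz zr; have [_ [v [v' [cv cv' ->]]]] := hr z Iz zr.
  pose T := \sum_(0 <= k < N) laurent_term p a z (Negz k).
  have -> : v' = T.
    apply: (cvg_unique _ cv'); first exact: norm_hausdorff.
    apply: cvg_near_cst; exists N => // n /= Nn.
    have E : \sum_(N <= i < n) laurent_term p a z (Negz i) = 0.
      rewrite big_nat_cond big1// => i /andP[/andP[Ni _] _].
      have -> : laurent_term p a z (Negz i) = (z - p) ^ Negz i * a (Negz i) by [].
      by rewrite [a _](aN i.+1) ?ltnS// mulr0.
    by rewrite seriesEnat /= (big_cat_nat (n := N)) ?leq0n//= E addr0.
  set u := z - p in zr cv *.
  have u0 : u != 0 by rewrite -normr_gt0; have /andP[] := zr.
  rewrite /is_sum -(cvg_shiftn N).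
  rewrite (_ : (fun n => _) = fun n => u ^+ N * (series (laurent_term p a z \o Posz) n + T)).
    by apply: cvg_qM; [exact: cvg_cst|apply: cvgD => //; exact: cvg_cst].
  apply/funext => n; rewrite !seriesEnat /= (big_cat_nat (n := N)) ?leq_addl//= mulrDr addrC.
  congr (_ + _).
    rewrite mulr_sumr -{1}[N]add0n big_addn addnK; apply: eq_bigr => i _.
    rewrite /power_series_term /c /laurent_unshift ltnNge leq_addl /= addnK.
    have -> : u ^+ (i + N) = u ^+ N * u ^+ i by rewrite -exprD addnC.
    by rewrite mulrA.
  rewrite mulr_sumr big_nat_rev /= add0n; apply: eq_big_nat => i /andP[_ iN].
  rewrite /power_series_term /c /laurent_unshift ltn_subrL (leq_ltn_trans _ iN)//.
  rewrite subnSK// subKn; last exact: ltnW.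
  rewrite -[laurent_term p a z (Negz i)]/(u ^- i.+1 * a (Negz i)) mulrA; congr (_ * _).
  by rewrite -{2}(subnK iN) exprD mulrK// unitrX// qunitE.
exists r; split => // [t t0 tr|z Iz zr]; last first.
  by have [Dz _] := hr z Iz zr; rewrite (is_sumE (sums z Iz zr)).
pose s := (t + r) / 2; have s0 : 0 < s by rewrite /s; lra.
have [ts sr] : t < s /\ s < r by rewrite /s; split; lra.
have zs : `|(p + s%:A) - p| = s by rewrite addrC addKr qnorm_real gtr0_norm.
have Iz : slice I (p + s%:A) by apply: sliceD => //; exact: slice_real.
(* the terms of the convergent series at the real translate [p + s] are bounded *)
have h := cvg_series_cvg_0 (cvgP _ (sums _ Iz _)); rewrite zs s0 in h.
have /cvg_seq_bounded[M [_ /(_ (M + 1))]] := cvgP _ (h sr).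
rewrite ltrDl ltr01 => /(_ isT) hM; exists (M + 1) => k.
have := hM k Logic.I; rewrite /power_series_term /= qnormM qnormX zs => hk.
have tk : t ^+ k <= s ^+ k by apply: lerXn2r; rewrite ?nnegrE// ltW.
by rewrite mulrC (le_trans _ hk)// ler_wpM2r.
Qed.

Lemma pole_bounded D f p I : pole D f p -> imaginary_units I -> slice I p ->
  exists (n : nat) (M d : R), [/\ 0 < d, 0 <= M & forall z, slice I z -> 0 < `|z - p| < d ->
    `|z - p| ^+ n * `|f z| <= M].
Proof.
move=> [a La [n an]] hI Ip; have [r [r0 cc hr]] := laurent_power_sum La an hI Ip.
have r2 : r / 2 < r by lra.
have [B B0 hB] := power_sum_bounded cc (ltW (divr_gt0 r0 (ltr0n _ 2))) r2.
exists n, B, (r / 2); split => //; first by rewrite divr_gt0.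
move=> z Iz /andP[zp0 zp]; have [|_ E] := hr z Iz; first by rewrite zp0 (lt_trans zp).
by rewrite -qnormX -qnormM E hB// ltW.
Qed.

End LocalLemmas.

Section Representation.
Variable R : realType.
Local Notation H := (quat R).
Variables (rho : \bar R) (S : set H) (f : H -> H).
Hypothesis rho0 : (0 < rho)%E.
Hypothesis fS : semiregular (qball rho) S f.
Implicit Types (I p q z w : H) (r x y t : R) (l : seq (R * R)).

Let D := qball rho `\` S.

Lemma openD : open D. Proof. by have [[]] := fS. Qed.
Lemma regD : regular_on D f. Proof. by have [_ _] := fS. Qed.

Lemma in_qball r q : (r%:E < rho)%E -> `|q| <= r -> qball rho q.
Proof. by move=> rr qr; rewrite /qball /=; apply: le_lt_trans rr; rewrite lee_fin. Qed.

Lemma slice_point_inj I x y x' y' : imaginary_units I ->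
  slice_point I x y = slice_point I x' y' -> (x, y) = (x', y').
Proof.
move=> hI h; have := congr1 (@q0 R) h; have := congr1 (imc I) h.
by rewrite !imc_sp// !q0_slice_point// => -> ->.
Qed.

Lemma isolated_sing I z : imaginary_units I -> slice I z -> qball rho z ->
  exists2 d, 0 < d & forall w, slice I w -> 0 < `|w - z| < d -> ~ S w.
Proof.
move=> hI Iz Bz; have [Sz|nSz] := pselect (S z).
  have [_ /(_ I hI) iso _ _ _] := fS.
  have [_ [V /qnbhsP[d d0 hV] VE]] := iso z (conj Sz Iz).
  exists d => // w Iw /andP[wz0 wzd] Sw.
  have : (V `&` (S `&` slice I)) w by split => //; exact: hV.
  by rewrite VE /= => wz; move: wz0; rewrite wz subrr normr0 ltxx.
have [d d0 h] := open_ball_sub openD (conj Bz nSz).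
by exists d => // w _ /andP[_ /h[]].
Qed.

(** The singularities in a slice are isolated in the whole open ball, so a compact disc
    contains finitely many of them. *)
Lemma finite_sing I r : imaginary_units I -> 0 < r -> (r%:E < rho)%E ->
  exists s : seq (R * R), forall x y, `|slice_point I x y| <= r -> S (slice_point I x y) -> (x, y) \in s.
Proof.
move=> hI r0 rr.
pose P a b c d := exists s : seq (R * R), forall x y, a <= x <= b -> c <= y <= d ->
  `|slice_point I x y| <= r -> S (slice_point I x y) -> (x, y) \in s.
suff [s hs] : P (- r) r (- r) r.
  exists s => x y hxy; apply: hs => //; rewrite -ler_norml; apply: le_trans hxy.
    by have := q0_le (slice_point I x y); rewrite q0_slice_point.
  rewrite -(ler_pXn2r (n := 2)) ?nnegrE// qnorm_sqr qsqnorm_slice_point// real_normK ?num_real//.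
  by rewrite lerDr sqr_ge0.
have rr' : - r <= r by rewrite ge0_cp// ltW.
apply: rectangle_induction => //.
- move=> a b c d ab cd _ [s1 h1] [s2 h2]; exists (s1 ++ s2) => x y /andP[ax xb] cy nxy Sxy.
  rewrite mem_cat; have [xm|xm] := leP x ((a + b) / 2).
    by rewrite h1// ax.
  by rewrite h2 ?orbT// ltW.
- move=> a b c d ab cd _ [s1 h1] [s2 h2]; exists (s1 ++ s2) => x y ax /andP[cy yd] nxy Sxy.
  rewrite mem_cat; have [ym|ym] := leP y ((c + d) / 2).
    by rewrite h1// cy.
  by rewrite h2 ?orbT// ltW.
move=> x0 y0 _ _; pose z := slice_point I x0 y0.
have pts e a b c d x y : a <= x0 <= b -> c <= y0 <= d -> b - a < e / 2 -> d - c < e / 2 ->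
    a <= x <= b -> c <= y <= d -> `|slice_point I x y - z| < e.
  move=> /andP[? ?] /andP[? ?] ? ? /andP[? ?] /andP[? ?].
  rewrite slice_pointB (le_lt_trans (sp_norm hI _ _))//.
  have : `|x - x0| <= b - a by rewrite ler_norml; apply/andP; split; lra.
  have : `|y - y0| <= d - c by rewrite ler_norml; apply/andP; split; lra.
  lra.
have [zr|zr] := leP `|z| r; last first.
  exists ((`|z| - r) / 2); first by rewrite divr_gt0// subr_gt0.
  move=> a b c d ax cy ba dc _ _; exists [::] => x y axb cyd nxy _; exfalso.
  have := pts _ _ _ _ _ _ _ ax cy ba dc axb cyd.
  have := lerB_normD (slice_point I x y) (z - slice_point I x y).
  rewrite (addrC (slice_point I x y)) subrK distrC => h1 h2.
  have := ler_normD (slice_point I x y) (z - slice_point I x y).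
  by rewrite (addrC (slice_point I x y)) subrK distrC; lra.
have Iz : slice I z by exists x0, y0.
have [d d0 hd] := isolated_sing hI Iz (in_qball rr zr).
exists (d / 2); first by rewrite divr_gt0.
move=> a b c d' ax cy ba dc _ _; exists [:: (x0, y0)] => x y axb cyd nxy Sxy.
rewrite inE; apply/eqP/(slice_point_inj hI); apply: contrapT => ne.
apply: (hd (slice_point I x y)) => //; first by exists x, y.
rewrite (pts _ _ _ _ _ _ _ ax cy ba dc axb cyd) andbT normr_gt0 subr_eq0.
exact/eqP.
Qed.

(** One factor per order of the pole makes the product bounded; the two further ones
    make it vanish to second order, so that its extension by zero is slice
    differentiable at the pole. *)
Lemma clear_poles I (s : seq (R * R)) : imaginary_units I ->
  exists l, forall p, (exists x y, (x, y) \in s /\ p = slice_point I x y) -> S p ->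
  exists M d, [/\ 0 < d, 0 <= M & forall z, slice I z -> 0 < `|z - p| < d ->
    `|horner_alg z (den l) * f z| <= M * `|z - p| ^+ 2].
Proof.
move=> hI; elim: s => [|[x y] s [l hl]].
  by exists [::] => p [x [y []]].
pose P := slice_point I x y.
have IP : slice I P by exists x, y.
have [SP|nSP] := pselect (S P); last first.
  exists l => p [x' [y' [h pE]]] Sp; apply: hl => //; exists x', y'; split=> //.
  move: h; rewrite in_cons => /orP[/eqP[xE yE]|//].
  by exfalso; apply: nSP; rewrite /P -xE -yE -pE.
have [_ _ _ poles _] := fS.
have pP : pole D f P by apply: contrapT; exact: poles.
have [n [M [d [d0 M0 hM]]]] := pole_bounded pP hI IP.
have [m mE] : exists m, m = n.+2 by exists n.+2.
exists (nseq m (x, y) ++ l) => p [x' [y' [h pE]]] Sp.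
have bnd Q : exists2 B, 0 <= B & forall z, `|z - p| < 1 -> `|horner_alg z Q| <= B.
  have [B B0 hB] := horner_bounded Q (addr_ge0 (normr_ge0 p) ler01).
  exists B => // z zp; apply: hB; rewrite -[z](subrK p) addrC.
  by rewrite (le_trans (ler_normD _ _))// lerD2l ltW.
have [[xE yE]|] := eqVneq (x', y') (x, y); last first.
  move=> ne; move: h; rewrite in_cons (negbTE ne)/= => h.
  have [M' [d' [d'0 M'0 hM']]] := hl p (ex_intro _ x' (ex_intro _ y' (conj h pE))) Sp.
  have [B B0 hB] := bnd (den (nseq m (x, y))).
  exists (B * M'), (Num.min d' 1); split; first by rewrite lt_min d'0 ltr01.
    by rewrite mulr_ge0.
  move=> z Iz /andP[zp0]; rewrite lt_min => /andP[zd z1].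
  rewrite den_cat rmorphM /= -mulrA qnormM -mulrA ler_pM//.
    exact: hB.
  by apply: hM' => //; rewrite zp0.
have pE' : p = P by rewrite pE xE yE.
have [B B0 hB] := bnd (den l).
have [B' B'0 hB'] : exists2 B', 0 <= B' & forall z, `|z - P| < 1 -> `|z - slice_point I x (- y)| <= B'.
  exists (1 + `|P - slice_point I x (- y)|); first by rewrite addr_ge0.
  move=> z zP; have -> : z - slice_point I x (- y) = (z - P) + (P - slice_point I x (- y)).
    by rewrite addrA subrK.
  by rewrite (le_trans (ler_normD _ _))// lerD2r ltW.
exists (B' ^+ m * B * M), (Num.min d 1); split; first by rewrite lt_min d0 ltr01.
  by rewrite !mulr_ge0// exprn_ge0.
move=> z Iz /andP[zp0]; rewrite lt_min pE' => /andP[zd z1].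
rewrite pE' in zp0 hB.
rewrite den_cat rmorphM /= den_nseq rmorphXn /= horner_alg_delta (qDelta_factor _ _ hI Iz).
rewrite !qnormM qnormX qnormM exprMn -/P.
have h1 := hM z Iz; rewrite zp0 zd in h1; have {}h1 := h1 isT.
have -> : `|z - P| ^+ m = `|z - P| ^+ n * `|z - P| ^+ 2 by rewrite -exprD addn2 mE.
have -> : `|z - P| ^+ n * `|z - P| ^+ 2 * `|z - slice_point I x (- y)| ^+ m *
   `|horner_alg z (den l)| * `|f z| = (`|z - slice_point I x (- y)| ^+ m * `|horner_alg z (den l)|
   * (`|z - P| ^+ n * `|f z|)) * `|z - P| ^+ 2 by ring.
rewrite ler_wpM2r ?exprn_ge0//.
apply: ler_pM => //; rewrite ?mulr_ge0 ?exprn_ge0//.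
apply: ler_pM; rewrite ?exprn_ge0//; last by apply: hB.
by rewrite lerXn2r ?nnegrE//; exact: hB'.
Qed.

(** After multiplication by a denominator the function extends to a slice differentiable
    one on the disc, which [cauchy_slice] expands. *)
Lemma slice_quotient I r : imaginary_units I -> 0 < r -> (r%:E < rho)%E ->
  exists l (A : fps R), conv_on r A /\ forall z, slice I z -> `|z| < r -> ~ S z ->
    horner_alg z (den l) * f z = power_sum A z.
Proof.
move=> hI r0 rr; have [s hs] := finite_sing hI r0 rr; have [l hl] := clear_poles s hI.
pose F z := if `[< S z >] then 0 else horner_alg z (den l) * f z.
have FE z : ~ S z -> F z = horner_alg z (den l) * f z.
  by move=> nS; rewrite /F; case: asboolP.
have [|A [cA AE _]] := @cauchy_slice R I F r hI r0.
  move=> z Iz zr; have Bz := in_qball rr (ltW zr).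
  have [Sz|nSz] := pselect (S z).
    have zE := slice_point_coord Iz hI.
    have [|M [d [d0 M0 hM]]] := hl z _ Sz.
      exists (q0 z), (q1 z * q1 I + q2 z * q2 I + q3 z * q3 I); split => //.
      by apply: hs; rewrite -zE// ltW.
    have Fz : F z = 0 by rewrite /F; case: asboolP.
    exists (fun w => if w == z then 0 else (w - z)^-1 * F w); rewrite ?eqxx.
      apply/cvgrPdist_le => e e0.
      have M1 : 0 < M + 1 by rewrite ltr_wpDl.
      apply/sn_near0; exists (Num.min d (e / (M + 1))); first by rewrite lt_min d0 divr_gt0.
      move=> w Iw; rewrite lt_min => /andP[wd we]; rewrite sub0r normrN.
      case: ifPn => [_|wz]; first by rewrite normr0 ltW.
      have wz0 : 0 < `|w - z| by rewrite normr_gt0 subr_eq0.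
      rewrite qnormM qnormV ler_pdivrMl//.
      rewrite /F; case: asboolP => [_|_]; first by rewrite normr0 mulr_ge0// ltW.
      apply: le_trans (hM w Iw _) _; first by rewrite wz0.
      rewrite expr2 mulrCA ler_wpM2l//.
      rewrite ltr_pdivlMr// in we; apply: le_trans (ltW we).
      by rewrite mulrC ler_wpM2l// lerDl.
    near=> w; rewrite Fz add0r; case: ifPn => [/eqP ->|wz]; first by rewrite subrr mul0r.
    by rewrite mulVKr ?qunitE// subr_eq0.
  apply: (@sdiff_near _ _ (fun w => horner_alg w (den l) * f w)) => //.
    have [d d0 h] := open_ball_sub openD (conj Bz nSz).
    by apply/sn_near0; exists d => // w _ /h[_ nSw]; rewrite FE.
  apply: (sdiffM hI Iz).
  - by move=> w Iw; exact: horner_alg_slice.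
  - exact: horner_alg_sdiff.
  - exact: (regular_sdiff regD).
by exists l, A; split => // z Iz zr nS; rewrite AE// FE.
Unshelve. all: by end_near. Qed.

Lemma real_punctured : exists2 d, 0 < d & forall t, 0 < t < d -> ~ S t%:A.
Proof.
have B0 : qball rho (0 : H) by rewrite /qball /= normr0.
have [d d0 h] := isolated_sing (unit_iP R) (slice0 _) B0.
exists d => // t /andP[t0 td]; apply: h; first exact: slice_real.
by rewrite subr0 qnorm_real gtr0_norm// t0.
Qed.

(** The denominator and the series found in one slice serve for all of them: another
    slice provides its own pair, which is proportional to the first because all slices
    share the real axis. *)
Theorem semiregular_quotient r : 0 < r -> (r%:E < rho)%E ->
  exists l (A : fps R), conv_on r A /\ forall q, `|q| < r -> ~ S q ->
    horner_alg q (den l) * f q = power_sum A q.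
Proof.
move=> r0 rr; have [l [A [cA AE]]] := slice_quotient (unit_iP R) r0 rr.
exists l, A; split => // q qr nSq.
have [J [x [y [hJ qE]]]] := slice_pointP q.
have Jq : slice J q by exists x, y.
have [l' [A' [cA' AE']]] := slice_quotient hJ r0 rr.
have [d d0 hd] := real_punctured.
have E : cf (den l) * A' = cf (den l') * A.
  apply: (@fps_eq_real _ r _ _ d) => //; try by apply: conv_onM => //; exact: conv_cf.
  move=> t t0 td tr; have tr' : `|t%:A : H| < r by rewrite qnorm_real gtr0_norm.
  have nSt : ~ S t%:A by apply: hd; rewrite t0.
  rewrite (power_sum_cfM _ cA' tr') (power_sum_cfM _ cA tr').
  rewrite -(AE _ (slice_real _ _) tr' nSt) -(AE' _ (slice_real _ _) tr' nSt).
  by rewrite !mulrA -!rmorphM mulrC.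
have [d1 d10 h1] := open_ball_sub openD (conj (in_qball rr (ltW qr)) nSq).
have [d2 d20 h2] := den_near_real q l'.
have d30 : 0 < r - `|q| by rewrite subr_gt0.
apply: (@eq_by_real R (fun q => horner_alg q (den l) * f q) (power_sum A) q (Num.min d1 (Num.min d2 (r - `|q|)))).
- by rewrite !lt_min d10 d20.
- apply: differentiable_qM; first exact: horner_alg_differentiable.
  by apply: regD.1; split => //; exact: in_qball (ltW qr).
- exact: power_sum_differentiable cA qr.
move=> t /andP[t0]; rewrite !lt_min => /andP[t1 /andP[t2 t3]].
set w := q + t%:A.
have wq : `|w - q| < d1 by rewrite /w addrC addKr qnorm_real.
have [_ nSw] := h1 _ wq.
have wr : `|w| < r.
  by rewrite (le_lt_trans (ler_normD _ _))// qnorm_real addrC -ltrBrDr.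
have Jw : slice J w by apply: sliceD => //; exact: slice_real.
have lw : horner_alg w (den l') != 0 by apply: h2; rewrite t0.
apply: (mulrI (x := horner_alg w (den l'))); first by rewrite qunitE.
have := congr1 (fun a : fps R => power_sum a w) E; rewrite /= (power_sum_cfM _ cA' wr) (power_sum_cfM _ cA wr) => <-.
by rewrite -(AE' _ Jw wr nSw) !mulrA -!rmorphM mulrC.
Qed.

End Representation.

(** * Semiregular functions from compatible quotients *)

Section LaurentExpansion.
Variable R : realType.
Local Notation H := (quat R).
Implicit Types (D S U : set H) (f g : H -> H) (I p q z w : H) (r x y t : R).

Lemma differentiable_near_eq f g q : (\forall w \near q, f w = g w) ->
  differentiable f q -> differentiable g q.
Proof.
move=> fg df; have fgq : f q = g q by exact: nbhs_singleton fg.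
have cL : continuous ('d f q) by exact: diff_continuous.
have FE : g \o shift q = cst (g q) + 'd f q +o_ (0 : H) id.
  apply/eqaddoP => e e0; move: (diff_locally df) => /eqaddoP /(_ e e0) h.
  have fg0 : \forall w \near (0 : H), f (w + q) = g (w + q).
    move/qnbhsP : fg => [d d0 hd]; apply/qnbhsP; exists d => // w.
    by rewrite subr0 => wd; apply: hd; rewrite addrK.
  apply: filterS2 h fg0 => w h fgw; apply: le_trans h.
  rewrite -[(g \o _ - _) w]/(g (w + q) - (g q + 'd f q w)) -fgq -fgw.
  by [].
apply/diff_locallyP; have -> : 'd g q = 'd f q :> (H -> H) by exact: diff_unique cL FE.
by split.
Qed.

Lemma regular_near_eq U f g : open U -> regular_on U f -> (forall q, U q -> f q = g q) ->
  regular_on U g.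
Proof.
move=> oU /regular_onP[f1 f2] fg; apply/regular_onP; split=> [q Uq|I q hI Iq Uq].
  apply: differentiable_near_eq (f1 q Uq).
  by apply: filterS (open_nbhs_nbhs (conj oU Uq)) => w; exact: fg.
apply: sdiff_near (f2 I q hI Iq Uq) => //.
have [d d0 hd] := open_ball_sub oU Uq.
by apply/sn_near0; exists d => // w _ /hd; exact: fg.
Qed.

Lemma cauchy_slice_at I p F d : imaginary_units I -> slice I p -> 0 < d ->
  (forall z, slice I z -> `|z - p| < d -> sdiff I F z) ->
  exists2 b : fps R, conv_on d b &
    forall z, slice I z -> `|z - p| < d -> F z = power_sum b (z - p).
Proof.
move=> hI Ip d0 dF.
have [|b [cb bE _]] := @cauchy_slice R I (fun w => F (w + p)) d hI d0.
  move=> z Iz zd; apply: (@sdiff_comp _ _ F (fun w => w + p)) => //.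
  - by move=> w Iw; exact: sliceD.
  - by apply: sdiffD; [exact: sdiff_id|exact: sdiff_cst].
  by apply: dF; [exact: sliceD|rewrite addrK].
by exists b => // z Iz zd; rewrite bE ?subrK//; exact: sliceB.
Qed.

(** The Laurent coefficients of [u ^- N] times the power series [b]. *)
Definition laurent_shift N (b : fps R) (n : int) : H :=
  match n with
  | Posz k => b (k + N)%N
  | Negz k => if (k < N)%N then b (N - k.+1)%N else 0
  end.

Lemma laurent_shift_principal N b : principal_part_le (laurent_shift N b) N.
Proof. by case=> // m Nm; rewrite -NegzE /= ltnNge -ltnS Nm. Qed.

Lemma laurent_shift_sum N (b : fps R) d p z (v : H) : conv_on d b -> 0 < `|z - p| < d ->
  (z - p) ^+ N * v = power_sum b (z - p) -> laurent_sum p (laurent_shift N b) z v.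
Proof.
move=> cb /andP[zp0 zd] vE; set u := z - p in zp0 zd vE *.
have u0 : u != 0 by rewrite -normr_gt0.
have uN0 : u ^+ N \is a GRing.unit by rewrite unitrX// qunitE.
pose T M := series (power_series_term b u) M.
exists (u ^- N * (power_sum b u - T N)), (u ^- N * T N); split.
- rewrite (_ : series _ = fun n => u ^- N * (T (n + N)%N - T N)).
    apply: cvg_qM; first exact: cvg_cst.
    apply: cvgB; last exact: cvg_cst.
    by rewrite cvg_shiftn; exact: conv_is_sum cb zd.
  apply/funext => n.
  have -> : T (n + N)%N - T N = \sum_(N <= i < n + N) power_series_term b u i.
    by rewrite /T !seriesEnat /= [X in X - _](big_cat_nat (n := N)) ?leq_addl//= addrAC subrr add0r.
  rewrite seriesEnat mulr_sumr -{2}[N]add0n big_addn addnK; apply: eq_bigr => i _.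
  rewrite -[LHS]/(u ^+ i * b (i + N)%N) /power_series_term.
  have -> : u ^+ (i + N) = u ^+ N * u ^+ i by rewrite -exprD addnC.
  by rewrite -mulrA mulKr.
- apply: cvg_near_cst; exists N => // n /= Nn.
  have E : \sum_(N <= i < n) laurent_term p (laurent_shift N b) z (Negz i) = 0.
    rewrite big_nat_cond big1// => i /andP[/andP[Ni _] _].
    by rewrite /laurent_term /= ltnNge Ni mulr0.
  rewrite /T !seriesEnat /= (big_cat_nat (n := N)) ?leq0n//= E addr0.
  rewrite mulr_sumr [RHS]big_nat_rev /= add0n; apply: eq_big_nat => i /andP[_ iN].
  rewrite /laurent_term /= iN /power_series_term -/u -[u ^ Negz i]/(u ^- i.+1).
  rewrite mulrA; congr (_ * _).
  have -> : u ^+ N = u ^+ (N - i.+1) * u ^+ i.+1 by rewrite -exprD subnK.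
  by rewrite invrM ?unitrX ?qunitE// divrK ?unitrX ?qunitE//.
by rewrite -mulrDr subrK -vE mulKr.
Qed.

End LaurentExpansion.

Section Construction.
Variable R : realType.
Local Notation H := (quat R).
Variables (rho : \bar R) (L : R -> seq (R * R)) (A : R -> fps R).
Implicit Types (U : set H) (h : H -> H) (I p q z w v : H) (r t : R).

(** Each ball of smaller radius has its own denominator, since the poles may accumulate
    at the boundary of the large ball. *)
Definition inner_radius r := 0 < r /\ (r%:E < rho)%E.
Hypothesis cA : forall r, inner_radius r -> conv_on r (A r).
Hypothesis compat : forall r r', inner_radius r -> inner_radius r' ->
  cf (den (L r)) * A r' = cf (den (L r')) * A r.

Lemma radius_above q : qball rho q -> exists2 r, inner_radius r & `|q| < r.
Proof.
rewrite /qball /inner_radius /=; case: rho => [s| |//] /=.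
  rewrite lte_fin => qs; exists ((`|q| + s) / 2); last by lra.
  by split; [have := normr_ge0 q; lra|rewrite lte_fin; lra].
move=> _; exists (`|q| + 1); last by rewrite ltrDl.
by split; [rewrite ltr_wpDl|exact: ltry].
Qed.

Lemma compat_eval r r' q : inner_radius r -> inner_radius r' -> `|q| < r -> `|q| < r' ->
  horner_alg q (den (L r)) * power_sum (A r') q = horner_alg q (den (L r')) * power_sum (A r) q.
Proof.
move=> hr hr' qr qr'; have := congr1 (fun a : fps R => power_sum a q) (compat hr hr').
by rewrite /= (power_sum_cfM _ (cA hr') qr') (power_sum_cfM _ (cA hr) qr).
Qed.

Definition local_quotient r U h := [/\ inner_radius r, open U, regular_on U h &
  forall w, U w -> `|w| < r /\ horner_alg w (den (L r)) * h w = power_sum (A r) w].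

(** A value that is taken at [q] by some regular function which locally is a quotient of
    [A r] by [den (L r)].  Removable singularities are thereby removed: the denominator
    may vanish at [q]. *)
Definition quotient_value q v := exists r U h, [/\ local_quotient r U h, U q & v = h q].

Definition quotient_domain := [set q | exists v, quotient_value q v].

Definition glued q : H := xget 0 (quotient_value q).

Lemma horner_alg_comm Q Q' q : horner_alg q Q * horner_alg q Q' = horner_alg q Q' * horner_alg q Q.
Proof. by rewrite -!rmorphM mulrC. Qed.

(** The quotients at different radii agree, by compatibility and cancellation at nearby
    real translates. *)
Lemma local_quotient_eq r r' U h q : local_quotient r' U h -> U q -> inner_radius r -> `|q| < r ->
  horner_alg q (den (L r)) * h q = power_sum (A r) q.
Proof.
move=> [hr' oU rU hU] Uq hr qr.
have [d1 d10 hd1] := open_ball_sub oU Uq.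
have [d2 d20 hd2] := den_near_real q (L r').
have d30 : 0 < r - `|q| by rewrite subr_gt0.
apply: (@eq_by_real R (fun q => horner_alg q (den (L r)) * h q) (power_sum (A r)) q
  (Num.min d1 (Num.min d2 (r - `|q|)))).
- by rewrite !lt_min d10 d20.
- by apply: differentiable_qM; [exact: horner_alg_differentiable|exact: rU.1].
- exact: power_sum_differentiable (cA hr) qr.
move=> t /andP[t0]; rewrite !lt_min => /andP[t1 /andP[t2 t3]].
have wU : U (q + t%:A) by apply: hd1; rewrite addrC addKr qnorm_real.
have wr : `|q + t%:A| < r.
  by rewrite (le_lt_trans (ler_normD _ _))// qnorm_real addrC -ltrBrDr.
have lw : horner_alg (q + t%:A) (den (L r')) != 0 by apply: hd2; rewrite t0.
have [wr' hw] := hU _ wU.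
apply: (mulrI (x := horner_alg (q + t%:A) (den (L r')))); first by rewrite qunitE.
by rewrite -(compat_eval hr hr' wr wr') -hw !mulrA (horner_alg_comm (den (L r))).
Qed.

Lemma quotient_value_uniq q v v' : quotient_value q v -> quotient_value q v' -> v = v'.
Proof.
move=> [r [U [h [lq Uq ->]]]] [r' [U' [h' [lq' Uq' ->]]]].
have [hr oU rU hU] := lq; have [hr' oU' rU' hU'] := lq'.
have [d1 d10 hd1] := open_ball_sub oU Uq.
have [d2 d20 hd2] := open_ball_sub oU' Uq'.
have [d3 d30 hd3] := den_near_real q (L r).
apply: (@eq_by_real R h h' q (Num.min d1 (Num.min d2 d3))).
- by rewrite !lt_min d10 d20.
- exact: rU.1.
- exact: rU'.1.
move=> t /andP[t0]; rewrite !lt_min => /andP[t1 /andP[t2 t3]].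
have wU : U (q + t%:A) by apply: hd1; rewrite addrC addKr qnorm_real.
have wU' : U' (q + t%:A) by apply: hd2; rewrite addrC addKr qnorm_real.
have lw : horner_alg (q + t%:A) (den (L r)) != 0 by apply: hd3; rewrite t0.
have [wr hw] := hU _ wU.
apply: (mulrI (x := horner_alg (q + t%:A) (den (L r)))); first by rewrite qunitE.
by rewrite hw (local_quotient_eq lq' wU').
Qed.

Lemma gluedE q v : quotient_value q v -> glued q = v.
Proof.
move=> hv; apply: (@quotient_value_uniq q) => //.
by rewrite /glued; apply: xgetPex; exists v.
Qed.

Lemma glued_quotient r q : inner_radius r -> `|q| < r -> quotient_domain q ->
  horner_alg q (den (L r)) * glued q = power_sum (A r) q.
Proof.
move=> hr qr [v hv]; rewrite (gluedE hv); move: hv => [r' [U [h [lq Uq ->]]]].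
exact: local_quotient_eq lq Uq hr qr.
Qed.

(** A common factor [Q] of the denominator and of the numerator causes no singularity,
    even where it vanishes. *)
Lemma quotient_value_cancel r Q l' (A' : fps R) q : inner_radius r -> `|q| < r -> den (L r) = Q * den l' ->
  A r = cf Q * A' -> conv_on r A' -> horner_alg q (den l') != 0 ->
  quotient_value q ((horner_alg q (den l'))^-1 * power_sum A' q).
Proof.
move=> hr qr dE AE cA' q0.
pose U := [set w : H | `|w| < r /\ horner_alg w (den l') != 0].
pose h w := (horner_alg w (den l'))^-1 * power_sum A' w.
exists r, U, h; split => //; split => //.
- rewrite openE => w [wr w0]; rewrite /interior; apply: filterI.
    apply/qnbhsP; exists (r - `|w|); first by rewrite subr_gt0.
    move=> w' h'; rewrite -[w'](subrK w) (le_lt_trans (ler_normD _ _))//.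
    by rewrite -ltrBrDr.
  exact: (cvg_neq0 w0 (@horner_cvg R w (den l'))).
- apply/regular_onP; split=> [w [wr w0]|I w hI Iw [wr w0]].
    apply: differentiable_qM; last exact: power_sum_differentiable cA' wr.
    by apply: differentiable_qV => //; exact: horner_alg_differentiable.
  apply: (sdiffM hI Iw); last exact: power_sum_sdiff cA' wr hI Iw.
    by move=> w' Iw'; apply: sliceV => //; exact: horner_alg_slice.
  apply: (sdiffV hI Iw) => //; last exact: horner_alg_sdiff.
  by move=> w' Iw'; exact: horner_alg_slice.
move=> w [wr w0]; split => //; rewrite dE rmorphM /= -mulrA /h mulVKr ?qunitE//.
by rewrite AE (power_sum_cfM _ cA' wr).
Qed.

Lemma quotient_domain_den r q : inner_radius r -> `|q| < r -> horner_alg q (den (L r)) != 0 -> quotient_domain q.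
Proof.
move=> hr qr q0; eexists; apply: (@quotient_value_cancel r 1 (L r) (A r)) => //.
- by rewrite mul1r.
- by rewrite cf1 mul1r.
- exact: cA.
Qed.

Lemma quotient_domain_open : open quotient_domain.
Proof.
rewrite openE => q [v [r [U [h [lq Uq vE]]]]]; have [hr oU _ _] := lq.
apply: filterS (open_nbhs_nbhs (conj oU Uq)) => w Uw.
by exists (h w); exists r, U, h.
Qed.

Lemma quotient_domain_ball : quotient_domain `<=` qball rho.
Proof.
move=> q [v [r [U [h [[[r0 rr] _ _ hU] Uq vE]]]]].
by have [qr _] := hU q Uq; rewrite /qball /=; apply: lt_trans rr; rewrite lte_fin.
Qed.

Lemma glued_regular : regular_on quotient_domain glued.
Proof.
have loc q : quotient_domain q -> exists2 U, U q & regular_on U glued.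
  move=> [v [r [U [h [lq Uq vE]]]]]; have [hr oU rU _] := lq; exists U => //.
  apply: regular_near_eq oU rU _ => w Uw; apply/esym/gluedE.
  by exists r, U, h.
apply/regular_onP; split=> [q /loc[U Uq /regular_onP[h1 _]]|]; first exact: h1.
by move=> I q hI Iq /loc[U Uq /regular_onP[_ h2]]; exact: h2.
Qed.

Definition quotient_poles := qball rho `\` quotient_domain.

Lemma ball_quotient_poles : qball rho `\` quotient_poles = quotient_domain.
Proof.
apply/seteqP; split=> q; last by move=> gq; split; [exact: quotient_domain_ball|case].
by move=> [Bq nb]; apply: contrapT => ng; apply: nb.
Qed.

Lemma quotient_poles_isolated I : imaginary_units I -> quotient_poles `&` slice I `<=` isolated (quotient_poles `&` slice I).
Proof.
move=> hI q [[Bq nq] Iq]; split; first by rewrite inE.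
have [r hr qr] := radius_above Bq.
have [d d0 hd] := den_near (L r) hI Iq.
exists [set w | `|w - q| < Num.min d (r - `|q|)].
  apply/qnbhsP; exists (Num.min d (r - `|q|)) => //.
  by rewrite lt_min d0 subr_gt0.
apply/seteqP; split=> w; last first.
  by move=> ->; split => //=; rewrite subrr normr0 lt_min d0 subr_gt0.
rewrite /= lt_min => -[/andP[wd wr] [[Bw nw] Iw]]; apply: contrapT => wq.
apply: nw; apply: (@quotient_domain_den r) => //.
  rewrite -[w](subrK q) (le_lt_trans (ler_normD _ _))//.
  by rewrite -ltrBrDr.
by apply: hd => //; rewrite wd andbT normr_gt0 subr_eq0; exact/eqP.
Qed.

(** A regular extension of [glued] across [p] satisfies the quotient equation near [p] by
    continuity, so it is a local quotient there. *)
Lemma quotient_poles_not_removable p : quotient_poles p -> ~ removable_singularity quotient_domain glued p.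
Proof.
move=> [Bp np] [V [h [[oV Vp] rV hV]]]; apply: np.
have [r hr pr] := radius_above Bp.
have [d d0 hd] := open_ball_sub oV Vp.
have e0 : 0 < Num.min d (r - `|p|) by rewrite lt_min d0 subr_gt0.
pose U := ball p (Num.min d (r - `|p|)).
have UE w : U w -> `|w - p| < d /\ `|w| < r.
  rewrite /U -ball_normE /= distrC lt_min => /andP[wd wr]; split=> //.
  rewrite -[w](subrK p) (le_lt_trans (ler_normD _ _))//.
  by rewrite -ltrBrDr.
have rU : regular_on U h.
  by split=> [q /UE[/hd Vq _]|I hI x y /UE[/hd Vq _]]; [exact: rV.1|exact: rV.2].
exists (h p); exists r, U, h; split => //; last exact: ballxx.
have oU : open U by exact: ball_open.
split => //; move=> w Uw; have [wd wr] := UE w Uw; split=> //.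
have [d1 d10 h1] := open_ball_sub oU Uw.
have [d2 d20 h2] := den_near_real w (L r).
apply: (@eq_by_real R (fun q => horner_alg q (den (L r)) * h q) (power_sum (A r)) w
  (Num.min d1 d2)).
- by rewrite lt_min d10.
- by apply: differentiable_qM; [exact: horner_alg_differentiable|exact: rU.1].
- exact: power_sum_differentiable (cA hr) wr.
move=> t /andP[t0]; rewrite lt_min => /andP[t1 t2].
have Uw' : U (w + t%:A) by apply: h1; rewrite addrC addKr qnorm_real.
have [wd' wr'] := UE _ Uw'.
have gw : quotient_domain (w + t%:A).
  by apply: (@quotient_domain_den r) => //; apply: h2; rewrite t0.
by rewrite (hV _ (hd _ wd') gw) (glued_quotient hr wr' gw).
Qed.


(** In the slice, [delta] is the product of [z - p] and [z - p'] with [p'] the conjugate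
    of [p].  Multiplying by [(z - p) ^ (2 * k)] clears the denominator whether or not
    [p] is real: the same exponent then serves for all slices through [p]. *)
Lemma quotient_poles_expansion r x y k l' I : inner_radius r -> imaginary_units I ->
  let p := slice_point I x y in `|p| < r ->
  den (L r) = delta x y ^+ k * den l' -> horner_alg p (den l') != 0 ->
  exists d (b : fps R), [/\ 0 < d, conv_on d b & forall z, slice I z -> 0 < `|z - p| < d ->
    quotient_domain z /\ (z - p) ^+ (k + k) * glued z = power_sum b (z - p)].
Proof.
move=> hr hI p pr dE p0; have Ip : slice I p by exists x, y.
pose p' := slice_point I x (- y); have Ip' : slice I p' by exists x, (- y).
have [d1 d10 hd1] := den_near l' hI Ip.
have [d2 d20 hd2] := den_near (L r) hI Ip.
(* the factor cancelling the zeros of [z - p'] when [p'] differs from [p] *)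
have [c [d3 [d30 cI cd cE]]] : exists c d3, [/\ 0 < d3, forall z, slice I z -> slice I (c z),
    forall z, slice I z -> `|z - p| < d3 -> sdiff I c z &
    forall z, slice I z -> `|z - p| < d3 ->
      c z * ((z - p) * (z - p')) ^+ k = (z - p) ^+ (k + k)].
  have [<-|pp'] := eqVneq p p'.
    exists (fun=> 1), 1; split=> [//|z _|z _ _|z _ _]; first exact: slice1.
      exact: sdiff_cst.
    by rewrite mul1r -expr2 -exprM mul2n addnn.
  have Iq (q : H) : slice I q -> forall z, slice I z -> slice I (z - q).
    by move=> Iq z Iz; exact: sliceB.
  have dq (q : H) z : sdiff I (fun z => z - q) z.
    by apply: sdiffD; [exact: sdiff_id|exact: sdiff_cst].
  have z0 z : `|z - p| < `|p - p'| -> z - p' != 0.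
    by apply: contraTneq => /eqP; rewrite subr_eq0 => /eqP ->; rewrite distrC ltxx.
  have Ic n z : slice I z -> slice I (((z - p) * (z - p')^-1) ^+ n).
    move=> Iz; apply: sliceX => //; apply: sliceM => //; first exact: Iq.
    by apply: sliceV => //; exact: Iq.
  exists (fun z => ((z - p) * (z - p')^-1) ^+ k), `|p - p'|; split.
  - by rewrite normr_gt0 subr_eq0.
  - exact: Ic.
  - move=> z Iz zp; elim: k {dE} => [|n ih].
      by under eq_fun do rewrite expr0; exact: sdiff_cst.
    under eq_fun do rewrite exprS.
    apply: (sdiffM hI Iz) => //; first by move=> w Iw; have := Ic 1%N w Iw; rewrite expr1.
    apply: (sdiffM hI Iz) => //; first exact: Iq.
    by apply: (sdiffV hI Iz) => //; [exact: Iq|exact: z0].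
  move=> z Iz zp.
  have h1 : GRing.comm (z - p) (z - p') by apply: (sliceC hI); exact: Iq.
  have E : (z - p) * (z - p')^-1 * ((z - p) * (z - p')) = (z - p) ^+ 2.
    by rewrite h1 mulrA divrK ?qunitE ?z0.
  rewrite -exprMn_comm ?E -?exprM ?mul2n ?addnn//.
  have Iu := Iq p Ip z Iz; have Iu' := Iq p' Ip' z Iz.
  by apply: (sliceC hI); apply: sliceM => //; exact: sliceV.
pose d := Num.min (Num.min d1 d2) (Num.min d3 (r - `|p|)).
have d0 : 0 < d by rewrite !lt_min d10 d20 d30 subr_gt0.
have dP z : `|z - p| < d -> [/\ `|z - p| < d1, `|z - p| < d2, `|z - p| < d3 & `|z| < r].
  rewrite !lt_min => /andP[/andP[? ?] /andP[? h]]; split => //.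
  rewrite -[z](subrK p) (le_lt_trans (ler_normD _ _))//.
  by rewrite -ltrBrDr.
have q0 z : slice I z -> `|z - p| < d -> horner_alg z (den l') != 0.
  move=> Iz /dP[zd1 _ _ _]; have [->//|zp] := eqVneq z p.
  by apply: hd1 => //; rewrite zd1 andbT normr_gt0 subr_eq0.
pose F z := (horner_alg z (den l'))^-1 * (c z * power_sum (A r) z).
have [|b cb FE] := @cauchy_slice_at R I p F d hI Ip d0.
  move=> z Iz zd; have [_ _ zd3 zr] := dP z zd.
  apply: (sdiffM hI Iz); first by move=> w Iw; apply: sliceV => //; exact: horner_alg_slice.
    apply: (sdiffV hI Iz); first by move=> w Iw; exact: horner_alg_slice.
      exact: q0.
    exact: horner_alg_sdiff.
  by apply: (sdiffM hI Iz) => //; [exact: cd|exact: power_sum_sdiff (cA hr) zr hI Iz].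
exists d, b; split => // z Iz /andP[zp0 zd]; have [zd1 zd2 zd3 zr] := dP z zd.
have gz : quotient_domain z by apply: (quotient_domain_den hr zr); apply: hd2 => //; rewrite zp0.
split => //; rewrite -FE// /F -(glued_quotient hr zr gz) dE rmorphM rmorphXn /=.
rewrite horner_alg_delta (qDelta_factor _ _ hI Iz) -/p -/p' !mulrA -(mulrA _ (c z)) cE//.
have Ie := horner_alg_slice (den l') hI Iz.
rewrite -(mulrA _ _ (horner_alg z _)) (sliceC hI (sliceX _ hI (sliceB Iz Ip)) Ie).
by rewrite mulKr// qunitE q0.
Qed.

(** A nonreal quaternion determines its slice. *)
Lemma slice_eq I I' p : imaginary_units I -> imaginary_units I' -> slice I p -> slice I' p ->
  (exists t, p = t%:A) \/ slice I' = slice I.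
Proof.
move=> hI hI' Ip Ip'.
have key J J' x y : imaginary_units J -> imaginary_units J' -> p = slice_point J x y ->
    y != 0 -> slice J' p -> slice J `<=` slice J'.
  move=> hJ hJ' pE y0 Jp.
  have JJ : slice J' J.
    have -> : J = y^-1 *: (p - x%:A).
      by rewrite pE /slice_point addrC addKr scalerA mulVf// scale1r.
    by apply: sliceZ; apply: sliceB => //; exact: slice_real.
  move=> z [a [b ->]]; apply: sliceD; first exact: slice_real.
  exact: sliceZ.
have [x [y pE]] := Ip; have [x' [y' pE']] := Ip'.
have [y0|y0] := eqVneq y 0; first by left; exists x; rewrite pE y0 /slice_point scale0r addr0.
have [y0'|y0'] := eqVneq y' 0; first by left; exists x'; rewrite pE' y0' /slice_point scale0r addr0.
right; apply/seteqP; split; [exact: key pE' y0' Ip|exact: key pE y0 Ip'].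
Qed.

(** For real [p] the expansions in different slices have the same coefficients since they
    agree at real points. *)
Lemma quotient_poles_pole p : quotient_poles p -> pole quotient_domain glued p.
Proof.
move=> [Bp np]; have [r hr pr] := radius_above Bp.
have [I [x [y [hI pE]]]] := slice_pointP p.
have [k [l' [dE hl']]] := den_split (L r) x y.
have exps J : imaginary_units J -> slice J p -> exists d (b : fps R),
    [/\ 0 < d, conv_on d b & forall z, slice J z -> 0 < `|z - p| < d ->
    quotient_domain z /\ (z - p) ^+ (k + k) * glued z = power_sum b (z - p)].
  move=> hJ Jp; have pJ := slice_point_coord Jp hJ.
  have q0p : q0 p = x by rewrite pE q0_slice_point.
  have p0 : horner_alg p (den l') != 0 by apply: hl'; exists I.
  set y' := _ + q3 p * q3 J in pJ.
  have yy : y' ^+ 2 = y ^+ 2.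
    by rewrite -(imsq_slice_point (q0 p) _ hJ) -pJ pE imsq_slice_point.
  have dd : delta x y = delta x y' by rewrite /delta yy.
  have pJ' : slice_point J x y' = p by rewrite -q0p -pJ.
  by have := @quotient_poles_expansion r x y' k l' J hr hJ; rewrite /= pJ' -dd; apply.
have Ip : slice I p by exists x, y.
have [d [b [d0 cb hb]]] := exps I hI Ip.
exists (laurent_shift (k + k) b); last by exists (k + k)%N; exact: laurent_shift_principal.
move=> J hJ Jp; have [[t pt]|JI] := slice_eq hI hJ Ip Jp; last first.
  exists d => // z; rewrite JI => Iz zd; have [gz bE] := hb z Iz zd.
  by split => //; exact: laurent_shift_sum cb zd bE.
have [d' [b' [d'0 cb' hb']]] := exps J hJ Jp.
have bb' : b = b'.
  have m0 : 0 < Num.min d d' by rewrite lt_min d0.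
  have [cm cm'] : conv_on (Num.min d d') b /\ conv_on (Num.min d d') b'.
    have le1 : Num.min d d' <= d by rewrite ge_min lexx.
    have le2 : Num.min d d' <= d' by rewrite ge_min lexx orbT.
    by split; [exact: conv_on_le le1 cb|exact: conv_on_le le2 cb'].
  apply: (fps_eq_real cm cm' m0 m0) => s s0 sm _.
  have ps : p + s%:A - p = s%:A by rewrite addrC addKr.
  have slice_nbhs : `|p + s%:A - p| = s by rewrite ps qnorm_real gtr0_norm.
  move: sm; rewrite lt_min => /andP[sd sd'].
  have sn' e : s < e -> 0 < `|p + s%:A - p| < e by rewrite slice_nbhs s0.
  have [_] := hb _ (sliceD Ip (slice_real _ s)) (sn' _ sd).
  have [_] := hb' _ (sliceD Jp (slice_real _ s)) (sn' _ sd').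
  by rewrite !ps => <- <-.
subst b'; exists d' => // z Jz zd; have [gz bE] := hb' z Jz zd.
by split => //; exact: laurent_shift_sum cb' zd bE.
Qed.

Theorem glued_semiregular : semiregular (qball rho) quotient_poles glued.
Proof.
rewrite /semiregular ball_quotient_poles; split => //.
- by split; [move=> q []|exact: quotient_domain_open].
- exact: quotient_poles_isolated.
- exact: glued_regular.
- by move=> p bp; apply; exact: quotient_poles_pole.
- exact: quotient_poles_not_removable.
Qed.

End Construction.

(** The converse of [semiregular_quotient]: semiregular functions are constructed by
    prescribing denominators and numerators.  The last clause locates the domain: where
    the fraction can be reduced to a nonvanishing denominator there is no singularity. *)
Theorem glue_quotients (R : realType) (rho : \bar R) (L : R -> seq (R * R)) (A : R -> fps R) :
  (forall r, inner_radius rho r -> conv_on r (A r)) ->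
  (forall r r', inner_radius rho r -> inner_radius rho r' ->
    cf (den (L r)) * A r' = cf (den (L r')) * A r) ->
  exists S (g : quat R -> quat R), [/\ semiregular (qball rho) S g,
    forall r (q : quat R), inner_radius rho r -> `|q| < r -> ~ S q ->
      horner_alg q (den (L r)) * g q = power_sum (A r) q &
    forall r Q l' (A' : fps R) (q : quat R), inner_radius rho r -> `|q| < r -> den (L r) = Q * den l' ->
      A r = cf Q * A' -> conv_on r A' -> horner_alg q (den l') != 0 ->
      ~ S q /\ g q = (horner_alg q (den l'))^-1 * power_sum A' q].
Proof.
move=> cA compat; exists (quotient_poles rho L A), (glued rho L A); split.
- exact: glued_semiregular.
- move=> r q hr qr nq; apply: glued_quotient => //; apply: contrapT => ng; apply: nq.
  by split => //; have [_ rr] := hr; rewrite /qball /=; apply: lt_trans rr; rewrite lte_fin.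
move=> r Q l' A' q hr qr dE AE cA' q0.
have hv := quotient_value_cancel hr qr dE AE cA' q0; split; last exact: (gluedE cA compat hv).
by move=> [_]; apply; eexists; exact: hv.
Qed.

(** * The factorization *)

Section Assembly.
Variable R : realType.
Local Notation H := (quat R).
Implicit Types (D S : set H) (f g h : H -> H) (I p q z w : H) (r x y t : R).

(** If the coefficient of index [- n.+1] were the lowest one, then [(z - q) ^ n.+1 * g z]
    would tend to it as well as to 0. *)
Lemma pole_order_regular D g q n : differentiable g q -> pole_order D g q n -> n = 0%N.
Proof.
move=> dg [a La [an amin]]; case: n an amin => // n an amin.
have [I [x [y [hI qE]]]] := slice_pointP q.
have Iq : slice I q by exists x, y.
have [r [r0 cc hr]] := laurent_power_sum La an hI Iq; set c := laurent_unshift _ _ in cc hr.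
have dw N : differentiable (fun w : H => (w - q) ^+ N) q.
  elim: N => [|N ih]; first by under eq_fun do rewrite expr0.
  by under eq_fun do rewrite exprS; apply: differentiable_qM => //; exact: differentiableB.
have cE : power_sum c 0 = c 0%N.
  have r0' : `|0 : H| < r by rewrite normr0.
  by rewrite (power_sum_shift cc r0') mul0r addr0.
have : (q - q) ^+ n.+1 * g q = power_sum c (q - q).
  apply: (@eq_by_real R (fun w => (w - q) ^+ n.+1 * g w) (fun w => power_sum c (w - q)) q r) => //.
  - exact: differentiable_qM.
  - apply: (@differentiable_comp _ _ _ _ (fun w : H => w - q) (power_sum c)).
      exact: differentiableB.
    by rewrite subrr; apply: power_sum_differentiable cc _; rewrite normr0.
  move=> t tr; have [|_ E] := hr _ (sliceD Iq (slice_real _ t)); last exact: E.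
  by rewrite addrC addKr qnorm_real.
rewrite subrr expr0n mul0r cE => c0.
have : (n.+1 <= n)%N; last by rewrite ltnn.
apply: amin => m; rewrite leq_eqVlt => /orP[/eqP <-|]; last exact: an.
by rewrite c0 /c /laurent_unshift /= subSS subn0.
Qed.

(** The pairs obtained at different radii are compatible since they represent the same
    function at small real points. *)
Lemma semiregular_family (rho : \bar R) S f : (0 < rho)%E -> semiregular (qball rho) S f ->
  exists (L : R -> seq (R * R)) (A : R -> fps R), [/\
    forall r, inner_radius rho r -> conv_on r (A r),
    forall r r', inner_radius rho r -> inner_radius rho r' ->
      cf (den (L r)) * A r' = cf (den (L r')) * A r &
    forall r q, inner_radius rho r -> `|q| < r -> ~ S q ->
      horner_alg q (den (L r)) * f q = power_sum (A r) q].
Proof.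
move=> rho0 fS.
have [F hF] : exists F : R -> seq (R * R) * fps R, forall r, inner_radius rho r ->
    conv_on r (F r).2 /\ forall q, `|q| < r -> ~ S q ->
      horner_alg q (den (F r).1) * f q = power_sum (F r).2 q.
  suff /choice[F hF] : forall r, exists lA : seq (R * R) * fps R, inner_radius rho r ->
    conv_on r lA.2 /\ forall q, `|q| < r -> ~ S q ->
      horner_alg q (den lA.1) * f q = power_sum lA.2 q by exists F.
  move=> r; have [[r0 rr]|nr] := pselect (inner_radius rho r); last by exists ([::], 0).
  by have [l [A [cA E]]] := semiregular_quotient rho0 fS r0 rr; exists (l, A).
exists (fun r => (F r).1), (fun r => (F r).2); split.
- by move=> r /hF[].
- move=> r r' hr hr'; have [cA E] := hF r hr; have [cA' E'] := hF r' hr'.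
  have [d d0 hd] := real_punctured rho0 fS.
  have m0 : 0 < Num.min r r' by have [? _] := hr; have [? _] := hr'; rewrite lt_min; apply/andP.
  have le1 : Num.min r r' <= r by rewrite ge_min lexx.
  have le2 : Num.min r r' <= r' by rewrite ge_min lexx orbT.
  apply: (@fps_eq_real _ (Num.min r r') _ _ d) => //.
  + by apply: conv_onM; [exact: conv_cf|exact: conv_on_le le2 cA'].
  + by apply: conv_onM; [exact: conv_cf|exact: conv_on_le le1 cA].
  move=> t t0 td; rewrite lt_min => /andP[tr tr'].
  have nt : `|t%:A : H| = t by rewrite qnorm_real gtr0_norm.
  have nS : ~ S t%:A by apply: hd; rewrite t0.
  rewrite (@power_sum_cfM _ r')// ?nt// (@power_sum_cfM _ r)// ?nt//.
  by rewrite -E' ?nt// -E ?nt// !mulrA (horner_alg_comm (den _)).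
by move=> r q hr qr nq; have [_ E] := hF r hr; exact: E.
Qed.

(** From [P * P^c = delta ^ n] by cancelling [P], as [delta ^ n] is central. *)
Lemma prod_linear_conj_l n (p : nat -> H) x y :
  (forall i, (1 <= i <= n)%N -> sphere x y (p i)) ->
  let P := \prod_(1 <= i < n.+1) fps_linear (p i) in fconj P * P = cf (delta x y ^+ n).
Proof.
move=> hp P; have E := prod_linear_conj hp; rewrite -/P /= in E.
have P0 : P != 0.
  apply/eqP => P0; move: E; rewrite P0 mul0r => /esym/eqP.
  by rewrite cf_eq0 expf_eq0 (negbTE (delta_neq0 _ _)) andbF.
by apply: (fps_mulfI P0); rewrite mulrA E cf_comm.
Qed.


(** If one numerator vanishes then so do all of them by compatibility, and [f] vanishes
    at nearby real translates of every point. *)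
Lemma numerator_neq0 (rho : \bar R) S f (L : R -> seq (R * R)) (A : R -> fps R) r :
  semiregular (qball rho) S f ->
  (forall r, inner_radius rho r -> conv_on r (A r)) ->
  (forall r r', inner_radius rho r -> inner_radius rho r' ->
      cf (den (L r)) * A r' = cf (den (L r')) * A r) ->
  (forall r q, inner_radius rho r -> `|q| < r -> ~ S q ->
      horner_alg q (den (L r)) * f q = power_sum (A r) q) ->
  (exists q, (qball rho `\` S) q /\ f q <> 0) -> inner_radius rho r -> A r != 0.
Proof.
move=> fS cA compat AE [q [[Bq nSq] fq0]] hr; apply/negP => /eqP Ar0; apply: fq0.
have [r' hr' qr'] := radius_above Bq.
have A0 : A r' = 0.
  by apply: (fps_mulfI (cf_den_neq0 (L r))); rewrite (compat r r' hr hr') Ar0 !mulr0.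
have [d d0 hd] := open_ball_sub (openD fS) (conj Bq nSq).
have [d1 d10 hd1] := den_near_real q (L r').
have d2 : 0 < r' - `|q| by rewrite subr_gt0.
have regD := regD fS.
apply: (@eq_by_real R f (fun=> 0) q (Num.min (Num.min d d1) (r' - `|q|))).
- by rewrite !lt_min d0 d10.
- exact: regD.1.
- exact: differentiable_cst.
move=> t /andP[t0]; rewrite !lt_min => /andP[/andP[td td1] tr].
have [_ nS] : (qball rho `\` S) (q + t%:A) by apply: hd; rewrite addrC addKr qnorm_real.
have wr : `|q + t%:A| < r'.
  by rewrite (le_lt_trans (ler_normD _ _))// qnorm_real addrC -ltrBrDr.
apply: (mulrI (x := horner_alg (q + t%:A) (den (L r')))).
  by rewrite qunitE hd1// t0.
rewrite (AE r' _ hr' wr nS) A0 mulr0.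
have -> : (0 : fps R) = cf 0 by apply/esym/eqP; rewrite cf_eq0.
by rewrite power_sum_cf rmorph0.
Qed.

(** For real [Q] the symmetrization is [Q ^ 2] and the regular conjugate is [Q], so that
    the left regular quotient is the pointwise quotient by [Q]. *)
Lemma left_quotient_real r S g (Q : {poly R}) (d : fps R) : conv_on r d -> Q != 0 ->
  (forall q, `|q| < r -> ~ S q -> horner_alg q Q * g q = power_sum d q) ->
  left_quotient_on r S g (cf Q) d.
Proof.
move=> cd Q0 gE; have cQ : reg_conj (cf Q) = cf Q by exact/real_coef_fconj/cf_real.
have sQ : symmetrization (cf Q) = cf (Q * Q).
  by rewrite cfM /symmetrization cQ.
split.
- by apply/power_series_onP; exact: conv_cf.
- exact/power_series_onP.
- have : cf Q != 0 by rewrite cf_eq0.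
  by move=> /fps_neq0_low[N QN _]; exists N; exact/eqP.
move=> q qr nS; rewrite sQ power_sum_cf rmorphM /= => QQ.
have Qq : horner_alg q Q != 0 by apply/eqP => Q0'; apply: QQ; rewrite Q0' mul0r.
have -> : star (reg_conj (cf Q)) d = cf Q * d by rewrite cQ.
rewrite (power_sum_cfM _ cd qr) -(gE q qr nS).
by rewrite mulrA mulKr// qunitE qmul_neq0.
Qed.

(** Both sides satisfy the same equation over the series [A], whose coefficient
    [den L * delta] is invertible after small real translations; hence they agree there,
    and at [q] itself by continuity. *)
Lemma delta_quotient_eq (rho : \bar R) Sf f Sh h (L : R -> seq (R * R)) (A : R -> fps R) x y k l :
  semiregular (qball rho) Sf f -> semiregular (qball rho) Sh h ->
  (forall r, inner_radius rho r -> conv_on r (A r)) ->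
  (forall r q, inner_radius rho r -> `|q| < r -> ~ Sf q ->
      horner_alg q (den (L r)) * f q = power_sum (A r) q) ->
  (forall r q, inner_radius rho r -> `|q| < r -> ~ Sh q ->
      horner_alg q (delta x y ^+ k * den (L r)) * h q =
      power_sum (cf (delta x y ^+ l) * A r) q) ->
  forall q, (qball rho `\` Sf) q -> (qball rho `\` Sh) q ->
    (k%:Z - l%:Z < 0 -> qDelta x y q <> 0) -> f q = qDelta x y q ^ (k%:Z - l%:Z) * h q.
Proof.
move=> fS hS cA fE hE q Dq Dq' Delta0; have [Bq _] := Dq; have [r hr qr] := radius_above Bq.
have [d1 d10 hd1] := open_ball_sub (openD fS) Dq.
have [d2 d20 hd2] := open_ball_sub (openD hS) Dq'.
have [d3 d30 hd3] := den_near_real q ((x, y) :: L r).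
have d40 : 0 < r - `|q| by rewrite subr_gt0.
(* [d] keeps the translates within both domains, off the zeros of the denominators and
   within the disc of convergence *)
pose d := Num.min (Num.min d1 d2) (Num.min d3 (r - `|q|)).
have d0 : 0 < d by rewrite !lt_min d10 d20 d30.
have E t : 0 < `|t| < d -> let w := q + t%:A in qDelta x y w != 0 /\
    qDelta x y w ^+ l * f w = qDelta x y w ^+ k * h w.
  move=> /andP[t0]; rewrite !lt_min => /andP[/andP[td1 td2] /andP[td3 td4]] w.
  have [_ nSf] : (qball rho `\` Sf) w by apply: hd1; rewrite /w addrC addKr qnorm_real.
  have [_ nSh] : (qball rho `\` Sh) w by apply: hd2; rewrite /w addrC addKr qnorm_real.
  have wr : `|w| < r.
    by rewrite (le_lt_trans (ler_normD _ _))// qnorm_real addrC -ltrBrDr.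
  have := hd3 t; rewrite t0 td3 den_cons rmorphM /= horner_alg_delta -/w => /(_ isT) n0.
  have Dw : qDelta x y w != 0 by apply: contraNneq n0 => ->; rewrite mul0r.
  have Lw : horner_alg w (den (L r)) != 0 by apply: contraNneq n0 => ->; rewrite mulr0.
  split=> //; apply: (mulrI (x := horner_alg w (den (L r)))); first by rewrite qunitE.
  have := hE r w hr wr nSh; rewrite (power_sum_cfM _ (cA r hr) wr) -(fE r w hr wr nSf).
  rewrite rmorphM !rmorphXn /= -!horner_alg_delta.
  move: (f w) (h w) => u v; rewrite -!rmorphXn !mulrA !(horner_alg_comm (den (L r))).
  by move=> ->.
have dDelta (n : nat) : differentiable (fun w : H => qDelta x y w ^+ n) q.
  have -> : (fun w : H => qDelta x y w ^+ n) = (fun w => horner_alg w (delta x y ^+ n)).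
    by apply/funext => w; rewrite rmorphXn /= horner_alg_delta.
  exact: horner_alg_differentiable.
have df : differentiable f q by apply: (regD fS).1.
have dh : differentiable h q by apply: (regD hS).1.
have [lk|kl] := leqP l k.
  rewrite subzn// -exprnP.
  apply: (@eq_by_real R f (fun w => qDelta x y w ^+ (k - l) * h w) q d) => //.
    exact: differentiable_qM.
  move=> t /E[Dw Ew]; apply: (mulrI (x := qDelta x y (q + t%:A) ^+ l)).
    by rewrite unitrX// qunitE.
  by rewrite Ew mulrA -exprD subnKC.
have D0 : qDelta x y q != 0 by apply/eqP/Delta0; rewrite subr_lt0 ltz_nat.
have -> : k%:Z - l%:Z = - (l - k)%N%:Z by rewrite -subzn 1?ltnW// opprB.
rewrite -exprnN.
apply: (mulrI (x := qDelta x y q ^+ (l - k))); first by rewrite unitrX// qunitE.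
rewrite mulrA mulrV ?unitrX ?qunitE// mul1r.
apply: (@eq_by_real R (fun w => qDelta x y w ^+ (l - k) * f w) h q d) => //.
  exact: differentiable_qM.
move=> t /E[Dw Ew]; apply: (mulrI (x := qDelta x y (q + t%:A) ^+ k)).
  by rewrite unitrX// qunitE.
by rewrite -Ew mulrA -exprD subnKC// ltnW.
Qed.

Lemma fpsM_cf_rearrange (P B a : fps R) (Q D E : {poly R}) : P * B = cf D ->
  P * cf Q * (cf E * (B * a)) = cf Q * (cf D * (cf E * a)).
Proof.
move=> PB; rewrite -(cf_comm Q P) -(mulrA (cf Q) P).
have -> : P * (cf E * (B * a)) = cf E * (P * B * a).
  by rewrite mulrA -(cf_comm E P) -!mulrA.
by rewrite PB !mulrA -!(mulrA (cf Q)) -!cfM (mulrC E).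
Qed.

Lemma fconj1 : fconj (1 : fps R) = 1.
Proof. by rewrite -(cf1 R); exact/real_coef_fconj/cf_real. Qed.

End Assembly.

Theorem theorem1p8 (R : realType) (rho : \bar R) (rho_gt0 : (0 < rho)%E)
  (Sf : set (quat R)) (f : quat R -> quat R)
  (f_semiregular : semiregular (qball rho) Sf f)
  (f_neq0 : exists q, (qball rho `\` Sf) q /\ f q <> 0)
  (x y : R) (sphere_sub : sphere x y `<=` qball rho) :
  exists (m : int) (n : nat) (p : nat -> quat R),
  [/\ forall i, (1 <= i <= n)%N -> sphere x y (p i),
      forall i, (1 <= i < n)%N -> p i <> qconj (p i.+1) &
      exists (Sg : set (quat R)) (g : quat R -> quat R),
      [/\ semiregular (qball rho) Sg g,
          forall q k, sphere x y q ->
            pole_order (qball rho `\` Sg) g q k -> k = 0%N,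
          forall q, sphere x y q -> ~ Sg q /\ g q <> 0 &
          exists (Sh : set (quat R)) (h : quat R -> quat R),
            semiregular_product rho
              set0 (power_sum (\big[@star R/@star_one R]_(1 <= i < n.+1)
                                 linear_coef (p i)))
              Sg g Sh h /\
            forall q, (qball rho `\` Sf) q -> (qball rho `\` Sh) q ->
              (m < 0 -> (q - x%:A) ^+ 2 + (y ^+ 2)%:A <> 0) ->
              f q = ((q - x%:A) ^+ 2 + (y ^+ 2)%:A) ^ m * h q]].
Proof.
have [L [A [cA compat fE]]] := semiregular_family rho_gt0 f_semiregular.
pose c := slice_point (unit_i R) x y.
have cn : `|c| ^+ 2 = x ^+ 2 + y ^+ 2.
  by rewrite qnorm_sqr qsqnorm_slice_point//; exact: unit_iP.
have sphere_norm q : sphere x y q -> `|q| = `|c|.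
  move=> [I hI <-]; apply/eqP; rewrite -(eqrXn2 (n := 2))// cn.
  by rewrite qnorm_sqr qsqnorm_slice_point.
have Bc : qball rho c by apply: sphere_sub; exists (unit_i R) => //; exact: unit_iP.
have [r0 hr0 cr0] := radius_above Bc; have [r00 _] := hr0.
have A0 : A r0 != 0 by exact: numerator_neq0 f_semiregular cA compat fE f_neq0 hr0.
have c2 : x ^+ 2 + y ^+ 2 < r0 ^+ 2 by rewrite -cn ltrXn2r.
have [k [n [p [G [cG ps pc AE Gn0]]]]] := factor_sphere (cA r0 hr0) A0 r00 c2.
have [l [l' [LE l'n0]]] := den_split (L r0) x y.
set P := \prod_(1 <= i < n.+1) fps_linear (p i) in AE.
have cP r : conv_on r P by exact: prod_linear_conv.
have PP : fconj P * P = cf (delta x y ^+ n) by exact: prod_linear_conj_l ps.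
have PP' : P * fconj P = cf (delta x y ^+ n) by exact: prod_linear_conj ps.
exists (k%:Z - l%:Z), n, p; split => //.
(* On the sphere the numerator [delta^l P^c A] of [g] is [delta^(l+k+n) G], since
   [P^c P = delta^n]; its denominator [delta^(k+n) den L] is [delta^(k+n+l) den l'].
   The powers of [delta] cancel. *)
have dLg r : den (nseq (k + n) (x, y) ++ L r) = delta x y ^+ (k + n) * den (L r).
  by rewrite den_cat den_nseq.
have dLh r : den (nseq k (x, y) ++ L r) = delta x y ^+ k * den (L r).
  by rewrite den_cat den_nseq.
have [||Sg [g [gS gE gval]]] := @glue_quotients R rho (fun r => nseq (k + n) (x, y) ++ L r)
  (fun r => cf (delta x y ^+ l) * (fconj P * A r)).
- move=> r hr; apply: conv_onM; first exact: conv_cf.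
  by apply: conv_onM; [exact/conv_fconj/cP|exact: cA].
- have sw (Q Q' : {poly R}) (a b : fps R) : cf (Q * Q') * (cf (delta x y ^+ l) * (a * b)) =
      cf Q * cf (delta x y ^+ l) * (a * (cf Q' * b)).
    rewrite cfM (mulrA a) -(cf_comm Q' a) -!mulrA; congr (_ * _).
    by rewrite !mulrA (cf_comm Q').
  by move=> r r' hr hr'; rewrite !dLg !sw compat.
have [||Sh [h [hS hE _]]] := @glue_quotients R rho (fun r => nseq k (x, y) ++ L r)
  (fun r => cf (delta x y ^+ l) * A r).
- by move=> r hr; apply: conv_onM; [exact: conv_cf|exact: cA].
- have sw (Q Q' : {poly R}) (b : fps R) : cf (Q * Q') * (cf (delta x y ^+ l) * b) =
      cf Q * cf (delta x y ^+ l) * (cf Q' * b).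
    rewrite cfM -!mulrA; congr (_ * _).
    by rewrite !mulrA (cf_comm Q').
  by move=> r r' hr hr'; rewrite !dLh !sw compat.
have gsphere q : sphere x y q -> ~ Sg q /\ g q = (horner_alg q (den l'))^-1 * power_sum G q.
  move=> hq; apply: (gval r0 (delta x y ^+ (k + n) * delta x y ^+ l)) => //.
  - by rewrite (sphere_norm q hq).
  - by rewrite dLg LE mulrA.
  - rewrite AE -[delta x y ^+ (k + n) * _]mulrC exprD !cfM -!mulrA; congr (_ * _).
    rewrite (mulrA (fconj P)) -(cf_comm _ (fconj P)) -!mulrA; congr (_ * _).
    by rewrite mulrA PP.
  exact: l'n0.
exists Sg, g; split => //.
- move=> q j hq; have [nSg _] := gsphere q hq; apply: pole_order_regular.
  by apply: (regD gS).1; split => //; exact: sphere_sub.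
- move=> q hq; have [nSg ->] := gsphere q hq; split => //; apply/eqP.
  rewrite qmul_neq0//; last exact/eqP/Gn0.
  by rewrite -qunitE unitrV qunitE l'n0.
exists Sh, h; split; last first.
  apply: (delta_quotient_eq f_semiregular hS cA fE) => r q hr qr nS.
  by rewrite -dLh hE.
split => // r r_gt0 r_lt; have hr : inner_radius rho r by split.
have cAg : conv_on r (cf (delta x y ^+ l) * (fconj P * A r)).
  apply: conv_onM; first exact: conv_cf.
  by apply: conv_onM; [exact/conv_fconj/cP|exact: cA].
pose Q := den (nseq (k + n) (x, y) ++ L r).
have s1 : star (reg_conj (@star_one R)) P = P.
  have -> : reg_conj (@star_one R) = 1 :> fps R by exact: fconj1.
  by rewrite -[LHS]/(1 * P) mul1r.
exists (@star_one R), P, (cf Q), (cf (delta x y ^+ l) * (fconj P * A r)); split.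
- have := @left_quotient_real R r set0 (power_sum P) 1 P (cP r) (oner_neq0 _).
  by rewrite cf1; apply => q _ _; rewrite rmorph1 mul1r.
- apply: left_quotient_real => //; first exact: den_neq0.
  by move=> q qr nS; exact: gE.
move=> q qr nSh _; rewrite s1.
have -> : symmetrization (@star_one R) = cf 1.
  by rewrite cf1 -[LHS]/(1 * fconj 1) fconj1 mul1r.
have cQ : reg_conj (cf Q) = cf Q by exact/real_coef_fconj/cf_real.
have -> : symmetrization (cf Q) = cf (Q * Q) by rewrite cfM /symmetrization cQ.
have QE : Q = delta x y ^+ n * (delta x y ^+ k * den (L r)).
  by rewrite /Q dLg mulrA -exprD addnC.
rewrite !power_sum_cf rmorph1 invr1 mul1r => QQ0.
have Q0 : horner_alg q Q != 0 by apply/eqP => Q0; apply: QQ0; rewrite rmorphM /= Q0 mul0r.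
have -> : star (star P (reg_conj (cf Q))) (cf (delta x y ^+ l) * (fconj P * A r)) =
    cf Q * (cf (delta x y ^+ n) * (cf (delta x y ^+ l) * A r)).
  rewrite cQ -[LHS]/((P * cf Q) * (cf (delta x y ^+ l) * (fconj P * A r))).
  exact: fpsM_cf_rearrange.
have cB : conv_on r (cf (delta x y ^+ l) * A r).
  by apply: conv_onM; [exact: conv_cf|exact: cA].
have cB' : conv_on r (cf (delta x y ^+ n) * (cf (delta x y ^+ l) * A r)).
  by apply: conv_onM => //; exact: conv_cf.
rewrite (power_sum_cfM _ cB' qr) (power_sum_cfM _ cB qr) -(hE r q hr qr nSh) dLh.
have -> : horner_alg q (delta x y ^+ n) * (horner_alg q (delta x y ^+ k * den (L r)) * h q) =
    horner_alg q Q * h q by rewrite mulrA -rmorphM -QE.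
by rewrite rmorphM /= mulrA mulKr// qunitE qmul_neq0.
Qed.
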